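(* Let $G$ be a continuous family groupoid. Then there exists a continuous left Haar system on $G$.
   Context: **$C^{0,\infty}$ maps.** Let $k\ge 1$. For open $V_1,V_2\subset\mathbb{R}^k$, $C^\infty(V_1,V_2)$ carries the topology of uniform convergence on compact subsets of $V_1$ of all partial derivatives. Let $Y$ be a topological space and $q_1:Y\times\mathbb{R}^k\to Y$ the projection. Let $A_1,A_2\subset Y\times\mathbb{R}^k$ be open with $q_1(A_1)\subset q_1(A_2)$, and let $A_i^y=\{x:(y,x)\in A_i\}$. A continuous map $f:A_1\to A_2$ is fiber preserving if $f(\{y\}\times A_1^y)\subset\{y\}\times A_2^y$ for all $y\in q_1(A_1)$; then $f^y:A_1^y\to A_2^y$ is defined by $f(y,x)=(y,f^y(x))$. Such an $f$ belongs to $C^{0,\infty}(A_1,A_2)$ if, whenever $U_i\subset Y$, $V_i\subset\mathbb{R}^k$ are open with $U_i\times V_i\subset A_i$ ($i=1,2$) and $f(U_1\times V_1)\subset U_2\times V_2$, the map $y\mapsto f^y|_{V_1}$ is continuous from $U_1$ into $C^\infty(V_1,V_2)$. $\mathrm{Diff}^0(A_1,A_2)$ is the set of bijective $f\in C^{0,\infty}(A_1,A_2)$ with $f^{-1}\in C^{0,\infty}(A_2,A_1)$. **Continuous families.** A fiber space $(X,p)$ over $Y$ consists of locally compact Hausdorff spaces $X,Y$ and a continuous open surjection $p:X\to Y$; write $X^y=p^{-1}(\{y\})$. A continuous family (of manifolds) over $Y$ is a fiber space $(X,p)$ over $Y$ with a (maximal) atlas of charts $(U_\alpha,\phi_\alpha)$,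 where the $U_\alpha$ are open and cover $X$, such that (i) $\phi_\alpha$ is a homeomorphism of $U_\alpha$ onto an open subset of $Y\times\mathbb{R}^k$ with $q_1\circ\phi_\alpha=p|_{U_\alpha}$; (ii) $\phi_\beta\circ\phi_\alpha^{-1}\in\mathrm{Diff}^0(\phi_\alpha(U_\alpha\cap U_\beta),\phi_\beta(U_\alpha\cap U_\beta))$ for all $\alpha,\beta$. Each $X^y$ is then a smooth $k$-manifold. Write $U\sim p(U)\times W$ for a chart $(U,\phi)$ with $\phi(U)=p(U)\times W$, $W\subset\mathbb{R}^k$ open. **Morphisms.** Let $(X_1,p_1),(X_2,p_2)$ be continuous families over $Y_1,Y_2$ and $q:Y_1\to Y_2$ continuous. A continuous $f:X_1\to X_2$ with $p_2\circ f=q\circ p_1$ is a morphism with respect to $q$ if each restriction $f^y:X_1^y\to X_2^{q(y)}$ is $C^\infty$ and, given $x\in X_1$ and a chart $U_2\sim p_2(U_2)\times W_2$ containing $f(x)$, there is a chart $U_1\sim p_1(U_1)\times W_1$ with $x\in U_1$, $f(U_1)\subset U_2$, such that, in local coordinates $f(y,w_1)=(q(y),f^y(w_1))$, the map $y\mapsto f^y$ is continuous from $p_1(U_1)$ into $C^\infty(W_1,W_2)$. When $Y_1=Y_2$ and no $q$ is mentioned, $q$ is the identity. Isomorphisms are morphisms with an inverse morphism. **Groupoids.** A locally compact groupoid is a groupoid $G$ that is a second countable locally compact Hausdorff space with continuous multiplication and inversion; $r(x)=xx^{-1}$, $s(x)=x^{-1}x$, $G^0=r(G)=s(G)$ is the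 unit space, $G^u=r^{-1}(\{u\})$; $xy$ is defined iff $s(x)=r(y)$. A locally compact groupoid $G$ is a continuous family groupoid if: (i) $(G,s)$ and $(G,r)$ are continuous families of manifolds over $G^0$; (ii) inversion $i:(G,s)\to(G,r)$, $i(x)=x^{-1}$, is an isomorphism of continuous families over $G^0$; (iii) multiplication $m:(G*G,t_1)\to(G,r)$ is a morphism with respect to $r:G\to G^0$, where $G*G=\{(x,y)\in G\times G:s(x)=r(y)\}$, $t_1(x,y)=x$, and $(G*G,t_1)$ is the continuous family over $G$ with charts: for each chart $(U,\phi)$ of $(G,r)$, $\phi(y)=(r(y),h(y))$, the set $\{(x,y)\in G*G:y\in U\}$ with the map $(x,y)\mapsto(x,h(y))$. **Left Haar systems.** A left Haar system on $G$ is a family $\{\lambda^u\}_{u\in G^0}$, with $\lambda^u$ a positive regular Borel measure on $G^u$, such that (i) the support of $\lambda^u$ is all of $G^u$; (ii) for every $g\in C_c(G)$ the function $u\mapsto\int_{G^u}g\,d\lambda^u$ belongs to $C_c(G^0)$; (iii) for all $x\in G$ and $f\in C_c(G)$, $\int_{G^{s(x)}}f(xz)\,d\lambda^{s(x)}(z)=\int_{G^{r(x)}}f(y)\,d\lambda^{r(x)}(y)$. For a chart $(U,\phi)$ of $(G,r)$ and $u\in r(U)$, let $\phi^u$ be the restriction of $\phi$ to $U\cap G^u$, regarded as a map into $\mathbb{R}^k$, and $W^u=\phi^u(U\cap G^u)$. Let $\lambda^u\circ\phi^u$ be the measure $E\mapsto\lambda^u((\phi^u)^{-1}(E))$ on $W^u$,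 and $\lambda^{W^u}$ Lebesgue measure on $W^u$. The left Haar system is called continuous if for every chart $(U,\phi)$ of $(G,r)$ and every $u\in r(U)$, $\lambda^u\circ\phi^u$ is equivalent to $\lambda^{W^u}$, and the function $(u,t)\mapsto\frac{d(\lambda^u\circ\phi^u)}{d\lambda^{W^u}}(t)$ is (has a version which is) a continuous function on $\phi(U)$. *)

(* Defs.v *)
From HB Require Import structures.
From mathcomp Require Import all_boot all_order all_algebra.
From mathcomp Require Import all_classical all_reals all_analysis.
Import Order.TTheory GRing.Theory Num.Theory numFieldNormedType.Exports.
Set Implicit Arguments.
Unset Strict Implicit.
Unset Printing Implicit Defensive.
Local Open Scope classical_set_scope.
Local Open Scope ring_scope.

Notation borel T := (g_sigma_algebraType (@open T)).

Section lebesgue_rV.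
Context {R : realType}.

Lemma measurable_borel_rV d (T : measurableType d) n
    (f : T -> borel 'rV[R]_n) :
  (forall i, measurable_fun [set: T] (fun t => (f t : 'rV[R]_n) ord0 i)) ->
  measurable_fun [set: T] f.
Proof.
move=> mf; apply: (measurability (@open _ : set (set (borel _)))) => //.
move=> _ [U oU <-].
rewrite setTI.
pose box (q : {ffun 'I_n -> rat * rat}) : set 'rV[R]_n :=
  [set w | forall i, ratr (q i).1 < w ord0 i < ratr (q i).2].
pose F q := if `[< box q `<=` U >] then f @^-1` box q else set0.
have -> : f @^-1` U = \bigcup_q F q.
  apply/seteqP; split => [t Ut|t [q _]]; last first.
    by rewrite /F; case: asboolP => // bO /bO.
  have /nbhs_ballP[e e0 eU] : nbhs (f t : 'rV[R]_n) U.
    exact: open_nbhs_nbhs.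
  have /choice[q qP] : forall i : 'I_n, exists q : rat * rat,
      (f t : 'rV[R]_n) ord0 i - e < ratr q.1 < (f t : 'rV[R]_n) ord0 i /\
      (f t : 'rV[R]_n) ord0 i < ratr q.2 < (f t : 'rV[R]_n) ord0 i + e.
    move=> i; set x : R := _ ord0 i.
    have [a] : exists q : rat, ratr q \in `](x - e), x[.
      by apply: rat_in_itvoo; rewrite ltrBlDr ltrDl.
    have [b] : exists q : rat, ratr q \in `]x, (x + e)[.
      by apply: rat_in_itvoo; rewrite ltrDl.
    by rewrite !in_itv /= => ? ?; exists (a, b).
  exists [ffun i => q i] => //; rewrite /F; case: asboolP => [_|].
    move=> i; rewrite ffunE.
    by have [/andP[_ ->] /andP[-> _]] := qP i.
  case => w bw; apply: eU; split => // i j; rewrite ord1.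
  have := bw j; rewrite ffunE => /andP[w1 w2].
  have [/andP[q1 _] /andP[_ q2]] := qP j.
  rewrite /ball /= ltr_distlC.
  by rewrite (lt_trans q1 w1) (lt_trans w2 q2).
apply: countable_bigcupT_measurable => // q.
rewrite /F; case: asboolP => // _.
have -> : f @^-1` box q = \big[setI/setT]_(i < n)
    ((fun t => (f t : 'rV[R]_n) ord0 i) @^-1`
      `]ratr (q i).1, ratr (q i).2[%classic).
  apply/seteqP; split => t /=.
    move=> bt; elim/big_ind : _ => // i _ /=; rewrite in_itv/=; exact: bt.
  by move=> + i; rewrite (bigD1 i)//= => -[]; rewrite in_itv.
elim/big_ind : _ => // [A B mA mB|i _]; first exact: measurableI.
by rewrite -[X in measurable X]setTI; apply: mf.
Qed.

Lemma measurable_coord_rV n (i : 'I_n) :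
  measurable_fun [set: borel 'rV[R]_n] (fun v : 'rV[R]_n => v ord0 i).
Proof.
apply: (measurability _ (measurable_realfun.RGenOpens.measurableE R)).
move=> _ [_ [a [b ->] <-]].
rewrite setTI; apply: sub_sigma_algebra.
apply: open_comp; last exact: interval_open.
by move=> v _; exact: coord_continuous.
Qed.

Definition rV_cons n (xv : measurableTypeR R * borel 'rV[R]_n) :
  borel 'rV[R]_n.+1 := row_mx (const_mx xv.1 : 'rV[R]_1) (xv.2 : 'rV[R]_n).

Lemma measurable_rV_cons n : measurable_fun setT (@rV_cons n).
Proof.
apply: measurable_borel_rV => i.
rewrite (_ : (fun _ => _) = fun xv : measurableTypeR R * borel 'rV[R]_n =>
   if fintype.split (i : 'I_(1 + n)) is inr j then (xv.2 : 'rV[R]_n) ord0 j else xv.1).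
  case: fintype.split => j; first exact: measurable_fst.
  exact: (measurableT_comp (measurable_coord_rV j) measurable_snd).
by apply/funext => xv; rewrite /rV_cons mxE; case: fintype.split => // j; rewrite mxE.
Qed.

(* The image of [lebesgue_measure \x^ lebesgue_rV m] under [rV_cons]. *)
Fixpoint lebesgue_rV n : {measure set (borel 'rV[R]_n) -> \bar R} :=
  match n with
  | 0 => dirac ((0 : 'rV[R]_0) : borel 'rV[R]_0)
  | m.+1 => measure_function_pushforward__canonical__measure_function_Measure
      (lebesgue_measure \x^ lebesgue_rV m)%E (@measurable_rV_cons m)
  end.

Lemma lebesgue_rV_box n (a b : 'rV[R]_n) :
  (forall i, a ord0 i <= b ord0 i) ->
  lebesgue_rV n [set v : 'rV[R]_n | forall i, a ord0 i <= v ord0 i <= b ord0 i] =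
  (\prod_(i < n) (b ord0 i - a ord0 i))%:E.
Proof.
elim: n a b => [|n IH] a b ab.
  by rewrite big_ord0 /= diracE mem_set// => -[].
pose tl (w : 'rV[R]_n.+1) : 'rV[R]_n := \row_j w ord0 (lift ord0 j).
have consE (x : R) (v : 'rV[R]_n) (i : 'I_n.+1) :
    (rV_cons (x, v) : 'rV[R]_n.+1) ord0 i =
    if unlift ord0 i is Some j then v ord0 j else x.
  rewrite /rV_cons mxE; case: fintype.splitP => j ij.
    by rewrite mxE (_ : i = ord0) ?unlift_none//; apply: ord_inj; rewrite ij ord1.
  by rewrite (_ : i = lift ord0 j) ?liftK//; apply: ord_inj; rewrite ij.
rewrite big_ord_recl EFinM.
transitivity ((lebesgue_measure \x^ lebesgue_rV n)%E
  (`[a ord0 ord0, b ord0 ord0] `*`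
   [set v : 'rV[R]_n | forall i, tl a ord0 i <= v ord0 i <= tl b ord0 i])).
  rewrite /= /pushforward; congr (_ _); apply/seteqP; split => -[x v]/=.
    move=> h; split.
      by rewrite in_itv/=; have := h ord0; rewrite consE unlift_none.
    by move=> i; have := h (lift ord0 i); rewrite consE liftK !mxE.
  move=> [h1 h2] i; rewrite consE; case: unliftP => [j ->|->] //.
  by have := h2 j; rewrite !mxE.
rewrite product_measure2E//=; last first.
  set B := [set v | _].
  have -> : B = \big[setI/setT]_(i < n) ((fun v : 'rV[R]_n => v ord0 i) @^-1`
      `[tl a ord0 i, tl b ord0 i]%classic).
    apply/seteqP; split => t /=.
      move=> bt; elim/big_ind : _ => // i _ /=; rewrite in_itv/=; exact: bt.
    by move=> + i; rewrite (bigD1 i)//= => -[]; rewrite in_itv.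
  apply: (@big_ind _ (fun A : set (borel 'rV[R]_n) => measurable A)) => //
    [A C mA mC|i _]; first exact: measurableI.
  by rewrite -[X in measurable X]setTI; apply: measurable_coord_rV.
rewrite (IH (tl a) (tl b)); last by move=> i; rewrite !mxE.
rewrite lebesgue_measure_itv/= lte_fin.
have -> : \prod_(i < n) (tl b ord0 i - tl a ord0 i) =
  \prod_(i < n) (b ord0 (lift ord0 i) - a ord0 (lift ord0 i)).
  by apply: eq_bigr => i _; rewrite !mxE.
case: ltP => [_|ba]; first by rewrite -EFinB.
have -> : b ord0 ord0 = a ord0 ord0 by apply/eqP; rewrite eq_le ba ab.
by rewrite subrr.
Qed.

End lebesgue_rV.

Section smooth_maps.
Context {R : realType} {k : nat}.
Local Notation E := 'rV[R]_k.

(* Iterated partial derivatives are indexed by lists of directions; for smooth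
   maps these are the usual multi-indices, up to the order of the list. *)
Definition pderiv (s : seq 'I_k) (f : E -> E) : E -> E :=
  foldr (fun i g => 'D_(delta_mx ord0 i) g) f s.

(* Maps between open subsets of [E] are represented by total functions whose
   values off the source are irrelevant; [V] is always open below, so that the
   derivatives at points of [V] only depend on the restriction to [V]. *)
Definition smooth_on (V : set E) (f : E -> E) : Prop :=
  forall s x, V x -> {for x, continuous (pderiv s f)} /\
    forall i, derivable (pderiv s f) x (delta_mx ord0 i).

Definition Cinf (V1 V2 : set E) : set (E -> E) :=
  [set f | smooth_on V1 f /\ f @` V1 `<=` V2].

Definition jet (V : set E) (f : E -> E) :
    prod_topology (fun _ : seq 'I_k =>
      {family [set K | compact K /\ K `<=` V], E -> E}) :=
  fun s => pderiv s f.

(* [initial_topology (jet V1)] is the topology of uniform convergence of all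
   partial derivatives on the compact subsets of [V1]. *)
Definition continuous_into_Cinf (Y : topologicalType) (U1 : set Y)
    (V1 V2 : set E) (F : Y -> E -> E) : Prop :=
  (forall y, U1 y -> Cinf V1 V2 (F y)) /\
  {within U1, continuous (F : Y -> initial_topology (jet V1))}.

Definition fiber_preserving (Y : topologicalType) (A1 A2 : set (Y * E))
    (f : Y * E -> Y * E) : Prop :=
  forall a, A1 a -> A2 (f a) /\ (f a).1 = a.1.

Definition C0inf (Y : topologicalType) (A1 A2 : set (Y * E))
    (f : Y * E -> Y * E) : Prop :=
  [/\ {within A1, continuous f},
      fiber_preserving A1 A2 f &
      forall (U1 U2 : set Y) (V1 V2 : set E),
        open U1 -> open U2 -> open V1 -> open V2 ->
        U1 `*` V1 `<=` A1 -> U2 `*` V2 `<=` A2 ->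
        f @` (U1 `*` V1) `<=` U2 `*` V2 ->
        continuous_into_Cinf U1 V1 V2 (fun y x => (f (y, x)).2)].

Definition Diff0 (Y : topologicalType) (A1 A2 : set (Y * E))
    (f : Y * E -> Y * E) : Prop :=
  C0inf A1 A2 f /\ exists g, [/\ C0inf A2 A1 g,
    forall a, A1 a -> g (f a) = a & forall b, A2 b -> f (g b) = b].

End smooth_maps.

Section continuous_families.
Context {R : realType} {k : nat}.
Local Notation E := 'rV[R]_k.

Record fiber_space (X Y : topologicalType) (p : X -> Y) : Prop := FiberSpace {
  fs_locally_compact_total : locally_compact [set: X];
  fs_hausdorff_total : hausdorff_space X;
  fs_locally_compact_base : locally_compact [set: Y];
  fs_hausdorff_base : hausdorff_space Y;
  fs_continuous : continuous p;
  fs_open : forall U : set X, open U -> open (p @` U);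
  fs_surjective : forall y, exists x, p x = y }.

(* A partial homeomorphism [X -> Y * E]: [cmap] is relevant on [cdom] and [cinv]
   on [cimg] only. *)
Record chart (X Y : topologicalType) := Chart {
  cdom : set X;
  cmap : X -> Y * E;
  cinv : Y * E -> X }.

Section charts.
Variables (X Y : topologicalType) (p : X -> Y).
Implicit Types (c : chart X Y) (A B : set (chart X Y)).

Definition cimg c : set (Y * E) := cmap c @` cdom c.

Record is_chart c : Prop := IsChart {
  chart_open_dom : open (cdom c);
  chart_open_img : open (cimg c);
  chart_continuous : {within cdom c, continuous (cmap c)};
  chart_cancel : forall x, cdom c x -> cinv c (cmap c x) = x;
  chart_continuous_inv : {within cimg c, continuous (cinv c)};
  chart_base : forall x, cdom c x -> (cmap c x).1 = p x }.

Definition compatible c1 c2 : Prop :=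
  Diff0 (cmap c1 @` (cdom c1 `&` cdom c2)) (cmap c2 @` (cdom c1 `&` cdom c2))
        (cmap c2 \o cinv c1).

Record is_atlas A : Prop := IsAtlas {
  atlas_chart : forall c, A c -> is_chart c;
  atlas_cover : forall x, exists2 c, A c & cdom c x;
  atlas_compatible : forall c1 c2, A c1 -> A c2 -> compatible c1 c2 }.

Definition continuous_family A : Prop :=
  [/\ fiber_space p, is_atlas A &
      forall B, is_atlas B -> A `<=` B -> B `<=` A].

(* The charts compatible with all those of [A]: the maximal atlas determined by
   an atlas [A]. *)
Definition maximal_atlas A : set (chart X Y) :=
  [set c | is_chart c /\ forall c', A c' -> compatible c c'].

(* U ~ p(U) x W *)
Definition product_chart c (W : set E) : Prop :=
  open W /\ cimg c = (p @` cdom c) `*` W.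

End charts.

Section morphisms.
Variables (X1 Y1 X2 Y2 : topologicalType).

Definition local_rep (c1 : chart X1 Y1) (c2 : chart X2 Y2) (f : X1 -> X2)
    (y : Y1) (w : E) : E :=
  (cmap c2 (f (cinv c1 (y, w)))).2.

Record is_morphism (p1 : X1 -> Y1) (A1 : set (chart X1 Y1))
    (p2 : X2 -> Y2) (A2 : set (chart X2 Y2))
    (q : Y1 -> Y2) (f : X1 -> X2) : Prop := IsMorphism {
  mor_continuous_base : continuous q;
  mor_continuous : continuous f;
  mor_commute : p2 \o f = q \o p1;
  (* each restriction X1^y -> X2^(q y) is smooth *)
  mor_smooth : forall c1 c2 y, A1 c1 -> A2 c2 ->
    smooth_on [set w | cimg c1 (y, w) /\ cdom c2 (f (cinv c1 (y, w)))]
              (local_rep c1 c2 f y);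
  mor_local : forall x c2 W2, A2 c2 -> product_chart p2 c2 W2 ->
    cdom c2 (f x) ->
    exists c1 W1, [/\ A1 c1, product_chart p1 c1 W1, cdom c1 x,
      f @` cdom c1 `<=` cdom c2 &
      continuous_into_Cinf (p1 @` cdom c1) W1 W2 (local_rep c1 c2 f)] }.

End morphisms.

Definition is_isomorphism (X1 X2 Y : topologicalType)
    (p1 : X1 -> Y) (A1 : set (chart X1 Y))
    (p2 : X2 -> Y) (A2 : set (chart X2 Y)) (f : X1 -> X2) : Prop :=
  is_morphism p1 A1 p2 A2 id f /\
  exists g, [/\ is_morphism p2 A2 p1 A1 id g, cancel f g & cancel g f].

End continuous_families.
Arguments chart R k X Y : clear implicits.

Section groupoid_laws.
Variables (T : Type) (mul : T -> T -> T) (inv : T -> T).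
Local Notation r x := (mul x (inv x)).
Local Notation s x := (mul (inv x) x).

(* [mul] is total, but [mul x y] is only meaningful when [s x = r y]. *)
Record groupoid_law : Prop := GroupoidLaw {
  law_invK : involutive inv;
  law_mulA : forall x y z, s x = r y -> s y = r z ->
    mul x (mul y z) = mul (mul x y) z;
  law_range_mul : forall x y, s x = r y -> r (mul x y) = r x;
  law_source_mul : forall x y, s x = r y -> s (mul x y) = s y;
  law_unitl : forall x, mul (r x) x = x;
  law_unitr : forall x, mul x (s x) = x }.

End groupoid_laws.

Record groupoid := Groupoid {
  gcarrier :> topologicalType;
  gmul : gcarrier -> gcarrier -> gcarrier;
  ginv : gcarrier -> gcarrier;
  glaw : groupoid_law gmul ginv }.
Arguments gmul {g}.
Arguments ginv {g}.

Section groupoids.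
Variable G : groupoid.

Definition grange (x : G) : G := gmul x (ginv x).
Definition gsource (x : G) : G := gmul (ginv x) x.

Definition units : set G := range grange.

Lemma grange_inv x : grange (ginv x) = gsource x.
Proof. by rewrite /grange (law_invK (glaw G)). Qed.

Lemma grange_unit u : units u -> grange u = u.
Proof.
by move=> [x _ <-]; apply: (law_range_mul (glaw G)); rewrite (law_invK (glaw G)).
Qed.

Lemma units_source x : units (gsource x).
Proof. by exists (ginv x) => //; exact: grange_inv. Qed.

Definition rmap (x : G) : units := SigSub (mem_set (imageT grange x)).
Definition smap (x : G) : units := SigSub (mem_set (units_source x)).

Definition composable : set (G * G) := [set xy | gsource xy.1 = grange xy.2].
Definition gmult (xy : composable) : G := gmul (\val xy).1 (\val xy).2.
Definition t1 (xy : composable) : G := (\val xy).1.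

Definition locally_compact_groupoid : Prop :=
  [/\ second_countable (T := G), locally_compact [set: G], hausdorff_space G,
      continuous gmult & continuous (@ginv G)].

Definition gfiber (u : units) : Type :=
  set_type [set z : G | grange z = \val u].

HB.instance Definition _ (u : units) := Topological.copy (gfiber u)
  (set_type [set z : G | grange z = \val u]).

Lemma gfiber_unit (u : units) : grange (\val u) = \val u.
Proof. by apply: grange_unit; exact: set_valP. Qed.

HB.instance Definition _ (u : units) := isPointed.Build (gfiber u)
  (SigSub (mem_set (gfiber_unit u))).

Definition gfiber_val (u : units) (z : gfiber u) : G := \val z.

End groupoids.
Arguments units G : clear implicits.
Arguments composable G : clear implicits.

Section continuous_family_groupoids.
Context {R : realType} {k : nat} (G : groupoid).

Definition composable_atlas (Ar : set (chart R k G (units G))) :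
    set (chart R k (composable G) G) :=
  maximal_atlas (@t1 G) [set c | is_chart (@t1 G) c /\
    exists c0, [/\ Ar c0,
      cdom c = [set xy | cdom c0 (\val xy).2] &
      forall xy, cdom c xy ->
        cmap c xy = ((\val xy).1, (cmap c0 (\val xy).2).2)]].

Record continuous_family_groupoid
    (As Ar : set (chart R k G (units G))) : Prop := ContinuousFamilyGroupoid {
  cfg_locally_compact : locally_compact_groupoid G;
  cfg_source : continuous_family (@smap G) As;
  cfg_range : continuous_family (@rmap G) Ar;
  cfg_inv : is_isomorphism (@smap G) As (@rmap G) Ar (@ginv G);
  cfg_mul : is_morphism (@t1 G) (composable_atlas Ar) (@rmap G) Ar
              (@rmap G) (@gmult G) }.

End continuous_family_groupoids.

(* Real-valued functions; the complex case follows by linearity. *)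
Definition Cc {R : realType} (T : topologicalType) : set (T -> R) :=
  [set g | continuous g /\ compact (closure [set x | g x != 0])].
Arguments Cc {R} T.

Section haar_systems.
Context {R : realType}.

Record regular_borel (T : ptopologicalType)
    (mu : {measure set (borel T) -> \bar R}) : Prop := RegularBorel {
  regular_finite : forall K : set T, compact K -> (mu K < +oo)%E;
  regular_outer : forall B : set (borel T), measurable B ->
    mu B = ereal_inf [set mu U | U in [set U | @open T U /\ B `<=` U]];
  regular_inner : forall B : set (borel T), measurable B ->
    mu B = ereal_sup [set mu K | K in [set K | @compact T K /\ K `<=` B]] }.

Variable G : groupoid.
Implicit Type lam : forall u : units G, {measure set (borel (gfiber u)) -> \bar R}.

Record left_haar_system lam : Prop := LeftHaarSystem {
  haar_regular : forall u, regular_borel (lam u);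
  haar_support : forall u (U : set (gfiber u)),
    open U -> U !=set0 -> (0 < lam u U)%E;
  haar_Cc : forall g : G -> R, Cc G g -> exists2 h, Cc (units G) h &
    forall u, (\int[lam u]_z (g (gfiber_val z))%:E = (h u)%:E)%E;
  haar_invariant : forall (x : G) (f : G -> R), Cc G f ->
    (\int[lam (smap x)]_z (f (gmul x (gfiber_val z)))%:E =
     \int[lam (rmap x)]_y (f (gfiber_val y))%:E)%E }.

Section densities.
Variables (k : nat) (c : chart R k G (units G)) (u : units G).

Definition chart_fiber (z : gfiber u) : 'rV[R]_k := (cmap c (gfiber_val z)).2.

Definition chart_fiber_dom : set (gfiber u) :=
  [set z | cdom c (gfiber_val z)].

Definition chart_fiber_img : set 'rV[R]_k := chart_fiber @` chart_fiber_dom.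

Definition chart_measure lam (B : set 'rV[R]_k) : \bar R :=
  lam u (chart_fiber_dom `&` chart_fiber @^-1` B).

End densities.

(* [D] is the continuous version of the Radon-Nikodym derivatives of the
   [chart_measure c u lam] with respect to Lebesgue measure. *)
Definition continuous_haar_system (k : nat) (Ar : set (chart R k G (units G)))
    lam : Prop :=
  forall c, Ar c ->
    (forall u, (@rmap G @` cdom c) u ->
      forall B : set (borel 'rV[R]_k), measurable B ->
        B `<=` chart_fiber_img c u ->
        (chart_measure c u lam B = 0%E <-> lebesgue_rV k B = 0%E)) /\
    exists D : units G * 'rV[R]_k -> R,
      [/\ {within cimg c, continuous D},
          forall a, cimg c a -> 0 <= D a &
          forall u, (@rmap G @` cdom c) u ->
          forall B : set (borel 'rV[R]_k), measurable B ->
            B `<=` chart_fiber_img c u ->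
            chart_measure c u lam B =
              (\int[lebesgue_rV k]_(t in B) (D (u, t))%:E)%E].

End haar_systems.

(* Main.v *)
Require Import Defs.
From HB Require Import structures.
From mathcomp Require Import all_boot all_order all_algebra.
From mathcomp Require Import all_classical all_reals all_analysis measurable_realfun.
From mathcomp Require Import ring lra.
Import Order.TTheory GRing.Theory Num.Theory numFieldNormedType.Exports.
Set Implicit Arguments.
Unset Strict Implicit.
Unset Printing Implicit Defensive.
Local Open Scope classical_set_scope.
Local Open Scope ring_scope.

(** A left Haar measure on a Lie group is obtained by carrying a density at the
    unit to the other points by left translation.  For a continuous family
    groupoid the same idea works along all units at once.  The choice of a
    continuous positive density on the tangent spaces of the fibers at the units
    is free;
    left translation by [z] is a diffeomorphism from [G^(s z)] onto [G^(r z)]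
    that maps the unit [s z] to [z], and so it carries the density at [s z] to
    a density at [z].

    In a chart [c] this reads as follows.  Let [chi_n] be a partition of unity on
    [G], subordinate to charts [c_n].  For charts [b] and [c], write [trans b c x]
    for the left translation by [x] read in these charts, and
    [inv_jacobian b c x w] for the inverse of the absolute value of its Jacobian
    determinant at [w].  The density at [z] is
    [[
      haar_density c z = \sum_n chi_n (s z) * inv_jacobian c_n c z (c_n (s z)).
    ]]
    It is positive.  By the chain rule, its values at [x z] (in a chart [c']) and
    at [z] (in a chart [c]) differ by the factor [inv_jacobian c c' x] at the
    point [c z]; this is lemma [dens_trans].  Let [J_c] be the measure on the fiber over [u]
    with the density [haar_density c] in the chart [c].  Through the change of
    variables formula, [dens_trans] says that left translation by [x] maps [J_c]
    to [J_c'] wherever both are defined ([chart_haar_transl]).  For [x] a unit,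
    this is the agreement of [J_c] and [J_c'] on the common part of the charts;
    in general, it is left invariance.  The Haar measure on the fiber over [u] is
    [\sum_n chi_n J_(c_n)] ([haar]); it agrees with [J_c] in every chart [c]
    ([haar_local]) and is left invariant ([haar_transl]).

    Continuity rests on the morphism property of the multiplication: it makes
    the Jacobian of [trans b c x] at [w] continuous in [(x, w)]
    ([inv_jacobian_continuous]), hence [haar_density c] is continuous on the
    domain of [c].  This gives the continuous Radon-Nikodym derivatives
    ([haar_continuous]) and, as all but finitely many of the [chi_n] vanish on a
    given compact set, expresses the integral of a function of [Cc G] as a finite sum
    of integrals over [R^k] that depend continuously on a parameter
    ([haar_integral_Cc]).  Regularity is automatic, because the
    fibers are Hausdorff, locally compact and second countable and the measures
    are finite on compact sets ([haar_regular_borel]).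

    The differential calculus uses strict derivatives instead of continuous
    partial derivatives: [phi] is strictly differentiable at [a] with derivative
    [A] when [phi - A] has an arbitrarily small Lipschitz constant near [a].
    This passes to compositions and inverses, is uniform in a parameter for the
    families at hand ([continuous_into_Cinf_strict_diff]), and is exactly what
    the change of variables formula needs: near [a], the map [phi] followed by
    the inverse of [A] is bi-Lipschitz with constants close to [1], and a
    Lipschitz map with constant [c] increases volumes at most by [c ^ k]
    ([lebesgue_lipschitz]).  The effect of a linear map on volumes comes from the
    uniqueness of translation invariant measures ([lebesgue_mulmx]). *)

(** * Borel sets and boxes *)

Section borel_sets.
Context {T : ptopologicalType}.

Lemma open_borel (A : set T) : open A -> measurable (A : set (borel T)).
Proof. exact: sub_sigma_algebra. Qed.

Lemma closed_borel (A : set T) : closed A -> measurable (A : set (borel T)).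
Proof.
by move=> cA; rewrite -(setCK A); apply: measurableC; apply: open_borel; exact: closed_openC.
Qed.

Lemma within_continuous_borel {U : ptopologicalType} (A : set T) (f : T -> U) :
  open A -> {within A, continuous f} ->
  measurable_fun (A : set (borel T)) (f : borel T -> borel U).
Proof.
move=> oA cf; apply: (measurability (@open _ : set (set (borel U)))) => //.
move=> _ [V oV <-]; apply: open_borel.
by have /continuousP/(_ V oV) := cf; rewrite open_setSI.
Qed.

Lemma continuous_borel {U : ptopologicalType} (f : T -> U) :
  continuous f -> measurable_fun [set: borel T] (f : borel T -> borel U).
Proof.
move=> cf; apply: (measurability (@open _ : set (set (borel U)))) => //.
move=> _ [V oV <-]; rewrite setTI; apply: open_borel.
by apply: open_comp => // x _; exact: cf.
Qed.

End borel_sets.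

Section boxes.
Context {R : realType} {k : nat}.
Local Notation E := 'rV[R]_k.
Local Notation lam := (lebesgue_rV k : {measure set (borel 'rV[R]_k) -> \bar R}).

Definition box (a b : E) : set (borel E) :=
  [set v : E | forall i, a ord0 i <= v ord0 i <= b ord0 i].

Lemma box_setI (a b a' b' : E) : box a b `&` box a' b' =
  box (\row_i Num.max (a ord0 i) (a' ord0 i)) (\row_i Num.min (b ord0 i) (b' ord0 i)).
Proof.
apply/seteqP; split => v /=.
  move=> [h h'] i; rewrite !mxE ge_max le_min.
  by apply/andP; split; apply/andP; split; have /andP[] := h i; have /andP[] := h' i.
move=> h; split => i; have := h i; rewrite !mxE ge_max le_min;
  by move=> /andP[/andP[? ?] /andP[? ?]]; apply/andP.
Qed.

Lemma measurable_box (a b : E) : measurable (box a b).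
Proof.
rewrite (_ : box a b = \big[setI/setT]_(i < k)
    ((fun v : E => v ord0 i) @^-1` `[a ord0 i, b ord0 i]%classic)).
  apply: (@big_ind _ (fun A : set (borel E) => measurable A)) => //
    [A C mA mC|i _]; first exact: measurableI.
  by rewrite -[X in measurable X]setTI; apply: measurable_coord_rV.
apply/seteqP; split => t /=.
  move=> bt; elim/big_ind : _ => // i _ /=; rewrite in_itv/=; exact: bt.
by move=> + i; rewrite (bigD1 i)//= => -[]; rewrite in_itv.
Qed.

Lemma compact_box (a b : E) : compact (box a b : set E).
Proof.
have := @rV_compact R k (fun i => `[a ord0 i, b ord0 i]%classic).
move=> /(_ (fun i => @segment_compact R _ _)).
by congr (compact _); apply/seteqP; split => v /= h i; have := h i; rewrite in_itv.
Qed.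

Lemma lebesgue_box_lty (a b : E) : (lam (box a b) < +oo)%E.
Proof.
have [ab|/existsNP[i /negP]] := pselect (forall i, a ord0 i <= b ord0 i).
  by rewrite lebesgue_rV_box// ltry.
rewrite -ltNge => ba; rewrite (_ : box a b = set0) ?measure0//.
by apply/seteqP; split => // v /(_ i) /andP[h1 h2]; have := lt_le_trans ba (le_trans h1 h2); rewrite ltxx.
Qed.

Lemma rV_norm_le (v : E) (r : R) : 0 <= r ->
  `|v| <= r <-> forall i, `|v ord0 i| <= r.
Proof.
move=> r0; rewrite [X in X <= _]mx_normrE; split => [vr i|vr].
  by apply: le_trans vr; exact: (le_bigmax _ (fun ij => `|v ij.1 ij.2|) (ord0, i)).
by apply: bigmax_le => // -[i j] _ /=; rewrite ord1.
Qed.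

Lemma rV_norm_lt (v : E) (r : R) : 0 < r ->
  `|v| < r <-> forall i, `|v ord0 i| < r.
Proof.
move=> r0; rewrite [X in X < _]mx_normrE; split => [vr i|vr].
  by apply: le_lt_trans vr; exact: (le_bigmax _ (fun ij => `|v ij.1 ij.2|) (ord0, i)).
by apply: bigmax_lt => // -[i j] _ /=; rewrite ord1.
Qed.

Definition cube (c : E) (r : R) : set (borel E) :=
  box (c - const_mx r) (c + const_mx r).

Lemma cubeE c r v : cube c r v <-> forall i, `|v ord0 i - c ord0 i| <= r.
Proof.
by split => h i; have := h i; rewrite !mxE ler_distl.
Qed.

Lemma cube_norm c r v : 0 <= r -> cube c r v <-> `|(v : E) - c| <= r.
Proof.
by move=> r0; rewrite cubeE rV_norm_le//; split => h i; have := h i; rewrite !mxE.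
Qed.

Lemma lebesgue_cube c r : 0 <= r -> lam (cube c r) = ((r *+ 2) ^+ k)%:E.
Proof.
move=> r0; rewrite lebesgue_rV_box; last first.
  by move=> i; rewrite !mxE; lra.
congr (_ %:E); rewrite (eq_bigr (fun=> r *+ 2)) ?prodr_const ?card_ord//.
by move=> i _; rewrite !mxE; lra.
Qed.

Lemma bigcup_cube c : \bigcup_n cube c n%:R = setT.
Proof.
apply/seteqP; split => // v _.
exists (Num.truncn `|(v : E) - c|).+1 => //; apply/cube_norm => //.
by rewrite ltW// truncnS_gt.
Qed.

Lemma rV_nbhsE (v : E) (U : set E) : nbhs v U ->
  exists2 e : R, 0 < e & forall w : E, (forall i, `|w ord0 i - v ord0 i| < e) -> U w.
Proof.
move=> /nbhs_ballP[e e0 eU]; exists e => // w we; apply: eU; split => // i j.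
by rewrite ord1 /ball /= distrC; exact: we.
Qed.

Definition qbox (q : {ffun 'I_k -> rat * rat}) : set (borel E) :=
  box (\row_i ratr (q i).1) (\row_i ratr (q i).2).

(** There are countably many boxes [qbox q], so this makes every open set a
    countable union of compact boxes.  It gives the generation of the Borel sets
    by boxes, and the passage from local to global comparisons of measures. *)
Lemma open_bigcup_qbox (U : set E) : open U ->
  U = \bigcup_(q in [set q | qbox q `<=` U]) qbox q.
Proof.
move=> oU; apply/seteqP; split => [v Uv|v [q /= qU]]; last exact: qU.
have [e e0 eU] : exists2 e : R, 0 < e &
    forall w : E, (forall i, `|w ord0 i - v ord0 i| < e) -> U w.
  by apply: rV_nbhsE; exact: open_nbhs_nbhs.
have /choice[q qP] : forall i : 'I_k, exists q : rat * rat,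
    v ord0 i - e < ratr q.1 < v ord0 i /\ v ord0 i < ratr q.2 < v ord0 i + e.
  move=> i; set x : R := _ ord0 i.
  have [a] : exists q : rat, ratr q \in `](x - e), x[.
    by apply: rat_in_itvoo; rewrite ltrBlDr ltrDl.
  have [b] : exists q : rat, ratr q \in `]x, (x + e)[.
    by apply: rat_in_itvoo; rewrite ltrDl.
  by rewrite !in_itv /= => ? ?; exists (a, b).
exists [ffun i => q i].
  move=> w /= bw; apply: eU => i; have := bw i; rewrite !mxE !ffunE.
  move=> /andP[h1 h2]; have [/andP[q1 _] /andP[_ q2]] := qP i.
  by rewrite ltr_distl (lt_le_trans q1 h1) (le_lt_trans h2 q2).
move=> i; rewrite !mxE !ffunE.
by have [/andP[_ /ltW ->] /andP[/ltW -> _]] := qP i.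
Qed.

Lemma borel_boxE :
  @measurable _ (borel E) = <<s [set B | exists a b, B = box a b] >>.
Proof.
apply/seteqP; split; last first.
  apply: smallest_sub; first exact: sigma_algebra_measurable.
  by move=> _ [a [b ->]]; exact: measurable_box.
apply: smallest_sub; first exact: smallest_sigma_algebra.
move=> U oU; rewrite (open_bigcup_qbox oU).
rewrite bigcup_mkcond.
apply: (@countable_bigcupT_measurable _ (g_sigma_algebraType [set B | exists a b : E, B = box a b])) => // q.
case: ifP => _; last exact: measurable0.
by apply: sub_sigma_algebra; do 2 eexists; reflexivity.
Qed.

Lemma measure_eq_box (m1 m2 : {measure set (borel E) -> \bar R}) :
  (forall a b, m1 (box a b) = m2 (box a b)) ->
  (forall a b, m1 (box a b) < +oo)%E ->
  forall B : set (borel E), measurable B -> m1 B = m2 B.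
Proof.
move=> m12 m1oo B mB.
apply: (@measure_unique _ _ (borel E) [set B : set (borel E) | exists a b, B = box a b]
  (fun n => cube 0 n%:R)) => //.
- exact: borel_boxE.
- by move=> _ _ [a [b ->]] [c [d ->]]; rewrite box_setI; do 2 eexists; reflexivity.
- by move=> n; do 2 eexists; reflexivity.
- exact: bigcup_cube.
- by move=> _ [a [b ->]].
- by move=> n; exact: m1oo.
Qed.

Lemma lebesgue_rV_sigma_finite : sigma_finite [set: borel E] lam.
Proof.
exists (fun n => cube 0 n%:R); first by rewrite bigcup_cube.
by move=> n; split; [exact: measurable_box|exact: lebesgue_box_lty].
Qed.

End boxes.

(** * Lebesgue measure and linear maps *)

(** Sigma-finiteness is a mere property of the measures below, while Fubini's
    theorem expects it bundled. *)
Lemma sigma_finite_measure_ex (R : realType) d (T : measurableType d)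
    (m : {measure set T -> \bar R}) : sigma_finite setT m ->
  exists m' : {sigma_finite_measure set T -> \bar R}, m' = m :> (set T -> \bar R).
Proof.
move=> sf.
pose m' : {sigma_finite_measure set T -> \bar R} := HB.pack (Measure.sort m)
  (isSFinite.Build _ _ _ (Measure.sort m) (sfinite_measure_sigma_finite sf))
  (isSigmaFinite.Build _ _ _ (Measure.sort m) sf).
by exists m'.
Qed.

Section translation_invariant_measures.
Context {R : realType} {k : nat}.
Local Notation E := 'rV[R]_k.

Definition translation_invariant (m : set (borel E) -> \bar R) :=
  forall (v : E) (B : set (borel E)), measurable B ->
    m [set x : E | B (x + v)] = m B.

Lemma measurable_translate (v : E) (B : set (borel E)) : measurable B ->
  measurable ([set x : E | B (x + v)] : set (borel E)).
Proof.
move=> mB; rewrite -[X in measurable X]setTI.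
apply: (continuous_borel (f := fun x : E => x + v)) => //.
by move=> x; apply: (@cvgD _ _ _ (nbhs x)); [exact: cvg_id|exact: cvg_cst].
Qed.

Lemma measurable_addv : measurable_fun setT
  (fun p : borel E * borel E => ((p.1 : E) + (p.2 : E)) : borel E).
Proof.
apply: measurable_borel_rV => i.
rewrite (_ : (fun _ => _) = fun p : borel E * borel E =>
  (p.1 : E) ord0 i + (p.2 : E) ord0 i); last by apply/funext => p; rewrite mxE.
apply: measurable_funD.
  exact: (measurableT_comp (measurable_coord_rV i) measurable_fst).
exact: (measurableT_comp (measurable_coord_rV i) measurable_snd).
Qed.

Lemma measurable_subv : measurable_fun setT
  (fun p : borel E * borel E => ((p.2 : E) - (p.1 : E)) : borel E).
Proof.
apply: measurable_borel_rV => i.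
rewrite (_ : (fun _ => _) = fun p : borel E * borel E =>
  (p.2 : E) ord0 i - (p.1 : E) ord0 i); last by apply/funext => p; rewrite !mxE.
apply: measurable_funB.
  exact: (measurableT_comp (measurable_coord_rV i) measurable_snd).
exact: (measurableT_comp (measurable_coord_rV i) measurable_fst).
Qed.

Section uniqueness.
Variables m1 m2 : {sigma_finite_measure set (borel E) -> \bar R}.

Lemma sections_fubini (S : set (borel E * borel E)) : measurable S ->
  (\int[m1]_x m2 (xsection S x) = \int[m2]_y m1 (ysection S y))%E.
Proof.
move=> mS.
have := indic_fubini_tonelli m1 m2 mS.
by rewrite (indic_fubini_tonelli_FE _ mS) (indic_fubini_tonelli_GE _ mS).
Qed.

(** The classical proof that a translation invariant measure is unique up to a
    factor, the formula for a fixed [B].  Both sides are, by Fubini's theorem, the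
    measure of the set of the pairs [(x, y)] with [x + y] in [A] and [y] in [B]:
    its sections at a fixed [y] are translates of [A]; its sections at a fixed [x]
    are translates of those of the sheared set [S2], in which the roles of
    the two coordinates are exchanged. *)
Lemma translation_invariant_prod : translation_invariant m1 ->
  translation_invariant m2 ->
  forall A B : set (borel E), measurable A -> measurable B ->
  (m1 A * m2 B = m2 A * m1 [set x : E | B (- x)%R])%E.
Proof.
move=> t1 t2 A B mA mB.
pose S1 : set (borel E * borel E) := [set p | A ((p.1 : E) + (p.2 : E)) /\ B p.2].
pose S2 : set (borel E * borel E) := [set p | A p.2 /\ B ((p.2 : E) - (p.1 : E))].
have mS1 : measurable S1.
  apply: measurableI; rewrite -[X in measurable X]setTI.
    exact: measurable_addv.
  exact: measurable_snd.
have mS2 : measurable S2.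
  apply: measurableI; rewrite -[X in measurable X]setTI.
    exact: measurable_snd.
  exact: measurable_subv.
have mNB : measurable ([set x : E | B (- x)] : set (borel E)).
  rewrite -[X in measurable X]setTI.
  apply: (continuous_borel (f := fun x : E => - x)) => //.
  by move=> x; apply: (@cvgN _ _ _ (nbhs x)); exact: cvg_id.
have cstE (m : {sigma_finite_measure set (borel E) -> \bar R})
    (C : set (borel E)) (c : \bar R) : (0 <= c)%E -> measurable C ->
    (\int[m]_y (c * (\1_C y)%:E) = c * m C)%E.
  move=> c0 mC; rewrite ge0_integralZl//; first by rewrite integral_indic ?setIT.
  exact: measurableT_comp.
transitivity (\int[m2]_y m1 (ysection S1 y))%E.
  rewrite -(cstE m2 B (m1 A))//; apply: eq_integral => y _.
  rewrite indicE; have [yB|yB] := boolP (y \in B).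
    rewrite mule1 -(t1 (y : E) _ mA); congr (m1 _); apply/seteqP; split => x.
      by move=> xA; rewrite /ysection/= inE; split => //; rewrite -inE.
    by rewrite /ysection/= inE => -[].
  rewrite mule0 [ysection _ _](_ : _ = set0) ?measure0//.
  by apply/seteqP; split => // x; rewrite /ysection/= inE => -[_]/= /mem_set; exact/negP.
rewrite -sections_fubini//.
transitivity (\int[m1]_x m2 (xsection S2 x))%E.
  apply: eq_integral => x _; rewrite -(t2 (- (x : E)) _ (measurable_xsection x mS1)).
  congr (m2 _); apply/seteqP; split => y; rewrite /xsection/= !inE => -[]/=.
    by rewrite addrC subrK.
  by move=> h1 h2; split => //=; rewrite addrC subrK.
rewrite sections_fubini// muleC -(cstE m2 A)//; apply: eq_integral => y _.
rewrite indicE; have [yA|yA] := boolP (y \in A).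
  rewrite mule1 -(t1 (- (y : E)) _ mNB); congr (m1 _); apply/seteqP; split => x.
    by rewrite /ysection/= inE /S2/= opprB => -[].
  by rewrite /ysection/= inE /S2/= opprB => ?; split => //; rewrite -inE.
rewrite mule0 [ysection _ _](_ : _ = set0) ?measure0//.
by apply/seteqP; split => // x; rewrite /ysection/= inE => -[]/= /mem_set /(negP yA).
Qed.

End uniqueness.
End translation_invariant_measures.

Section lebesgue_linear.
Context {R : realType} {k : nat}.
Local Notation E := 'rV[R]_k.
Local Notation lam := (lebesgue_rV k : {measure set (borel 'rV[R]_k) -> \bar R}).

Lemma lebesgue_translation : translation_invariant lam.
Proof.
move=> v B mB.
have mt : measurable_fun [set: borel E] (fun x : borel E => ((x : E) + v) : borel E).
  by move=> _ C mC; rewrite setTI; exact: measurable_translate.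
have -> : lam [set x : E | B (x + v)] = pushforward lam (fun x : borel E => ((x : E) + v) : borel E) B by [].
have boxE a b : pushforward lam (fun x : borel E => ((x : E) + v) : borel E) (box a b)
    = lam (box (a - v) (b - v)).
  rewrite /pushforward; congr (lam _); apply/seteqP; split => x h i; have := h i;
  by rewrite !mxE lerBlDr lerBrDr.
pose m1 := measure_function_pushforward__canonical__measure_function_Measure lam mt.
apply: (@measure_eq_box R k m1 lam) => //=; last first.
  by move=> a b; rewrite boxE; exact: lebesgue_box_lty.
move=> a b; rewrite boxE.
have [ab|/existsNP[i /negP]] := pselect (forall i, a ord0 i <= b ord0 i).
  rewrite !lebesgue_rV_box//; last by move=> i; rewrite !mxE lerD2r.
  by congr (_ %:E); apply: eq_bigr => i _; rewrite !mxE; lra.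
rewrite -ltNge => ba; rewrite [box a b](_ : _ = set0); last first.
  by apply/seteqP; split => // x /(_ i) /andP[h1 h2]; have := lt_le_trans ba (le_trans h1 h2); rewrite ltxx.
rewrite [box _ _](_ : _ = set0)//.
apply/seteqP; split => // x /(_ i) /andP[]; rewrite !mxE => h1 h2; have := le_trans h1 h2; lra.
Qed.

Lemma mulmx_norm_le n (x : E) (M : 'M[R]_(k, n)) : `|x *m M| <= k%:R * `|M| * `|x|.
Proof.
apply/rV_norm_le; first by rewrite !mulr_ge0.
move=> j; rewrite mxE (le_trans (ler_norm_sum _ _ _))//.
rewrite -mulrA -[k in k%:R]card_ord mulr_natl -sumr_const ler_sum// => i _.
rewrite normrM mulrC ler_pM//; last by move/rV_norm_le : (lexx `|x|) => ->.
rewrite [leRHS]mx_normrE.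
exact: (le_bigmax _ (fun ij => `|M ij.1 ij.2|) (i, j)).
Qed.

Lemma mulmx_continuous n (M : 'M[R]_(k, n)) : continuous (fun x : E => x *m M).
Proof.
move=> x; apply/(@cvgrPdist_le _ _ _ (nbhs x)) => e e0.
pose C := k%:R * `|M| + 1; have C0 : 0 < C by rewrite ltr_wpDl// mulr_ge0.
near=> y; rewrite -mulmxBl (le_trans (mulmx_norm_le _ _))//.
apply: (@le_trans _ _ (C * `|x - y|)); first by rewrite ler_wpM2r// lerDl.
rewrite mulrC -ler_pdivlMr//; near: y.
by apply: cvgr_dist_le; [exact: cvg_id|exact: divr_gt0].
Unshelve. all: by end_near. Qed.

Lemma measurable_mulmx (M : 'M[R]_k) :
  measurable_fun setT (fun x : borel E => ((x : E) *m M) : borel E).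
Proof. exact: continuous_borel (@mulmx_continuous k M). Qed.

Lemma measurable_preimage_mulmx (M : 'M[R]_k) (B : set (borel E)) :
  measurable B -> measurable ([set x : E | B (x *m M)] : set (borel E)).
Proof.
by move=> mB; rewrite -[X in measurable X]setTI; exact: (measurable_mulmx M).
Qed.

(** For invertible [M] this is the inverse of the absolute value of the
    determinant of [M], introduced as the factor in [lebesgue_mulmx]. *)
Definition vol_factor (M : 'M[R]_k) : R :=
  fine (lam [set x : E | cube 0 1 (x *m M)]) / 2 ^+ k.

Lemma preimage_mulmx_sub_cube (M : 'M[R]_k) (r : R) : M \in unitmx -> 0 <= r ->
  [set x : E | cube 0 r (x *m M)] `<=` cube 0 (k%:R * `|invmx M| * r).
Proof.
move=> uM r0 x /=; rewrite !cube_norm ?subr0//; last by rewrite !mulr_ge0.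
move=> xr; rewrite -[x](mulmxK uM) (le_trans (mulmx_norm_le _ _))//.
by rewrite ler_wpM2l// mulr_ge0.
Qed.

Lemma lebesgue_preimage_lty (M : 'M[R]_k) (r : R) : M \in unitmx -> 0 <= r ->
  (lam [set x : E | cube 0 r (x *m M)] < +oo)%E.
Proof.
move=> uM r0; apply: le_lt_trans (lebesgue_box_lty _ _).
apply: le_measure; last exact: (preimage_mulmx_sub_cube uM r0).
  by rewrite inE; apply: measurable_preimage_mulmx; exact: measurable_box.
by rewrite inE; exact: measurable_box.
Qed.

(** Both sides are translation invariant measures in [B], hence proportional;
    the unit cube determines the factor. *)
Lemma lebesgue_mulmx (M : 'M[R]_k) (B : set (borel E)) : M \in unitmx ->
  measurable B -> (lam [set x : E | B (x *m M)] = (vol_factor M)%:E * lam B)%E.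
Proof.
move=> uM mB.
pose m1 := measure_function_pushforward__canonical__measure_function_Measure
  lam (measurable_mulmx M).
have sf1 : sigma_finite setT m1.
  exists (fun n => cube 0 n%:R); first by rewrite bigcup_cube.
  move=> n; split; first exact: measurable_box.
  exact: lebesgue_preimage_lty.
have [m1s m1sE] := sigma_finite_measure_ex sf1.
have [lams lamsE] := sigma_finite_measure_ex (@lebesgue_rV_sigma_finite R k).
have t1 : translation_invariant m1.
  move=> v C mC; rewrite -[RHS](lebesgue_translation (v *m invmx M)).
    congr (lam _); apply/seteqP; split => x /=; rewrite /preimage/=.
      by rewrite mulmxDl mulmxKV.
    by rewrite mulmxDl mulmxKV.
  exact: measurable_preimage_mulmx.
have := @translation_invariant_prod R k m1s lams.
rewrite m1sE lamsE => /(_ t1 lebesgue_translation B (cube 0 1) mB (measurable_box _ _)).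
rewrite [X in (_ = _ * X)%E](_ : _ = m1 (cube 0 1)); last first.
  congr (m1 _); apply/seteqP; split => x /=; rewrite !cubeE => h i; have := h i;
  by rewrite !mxE !subr0 normrN.
rewrite lebesgue_cube// -[RHS]muleC.
have -> : m1 (cube 0 1) = (vol_factor M * 2 ^+ k)%:E.
  rewrite /vol_factor divfK ?expf_neq0// fineK// ge0_fin_numE//.
  exact: lebesgue_preimage_lty.
rewrite EFinM -muleA [(_ * lam B)%E]muleC muleA => h.
have : (m1 B * (2 ^+ k)%:E * ((2 ^+ k)^-1)%:E =
  (vol_factor M)%:E * lam B * (2 ^+ k)%:E * ((2 ^+ k)^-1)%:E)%E by rewrite h.
by rewrite -!muleA -!EFinM divff ?expf_neq0// !mule1.
Qed.

End lebesgue_linear.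

Section vol_factor_theory.
Context {R : realType} {k : nat}.
Local Notation E := 'rV[R]_k.
Local Notation lam := (lebesgue_rV k : {measure set (borel 'rV[R]_k) -> \bar R}).
Implicit Types M N : 'M[R]_k.

Lemma vol_factorE M : M \in unitmx ->
  lam [set x : E | cube 0 1 (x *m M)] = (vol_factor M * 2 ^+ k)%:E.
Proof.
move=> uM; rewrite lebesgue_mulmx//; last exact: measurable_box.
by rewrite lebesgue_cube.
Qed.

Lemma vol_factor_mulmx M N : M \in unitmx -> N \in unitmx ->
  vol_factor (M *m N) = vol_factor M * vol_factor N.
Proof.
move=> uM uN; have uMN : M *m N \in unitmx by rewrite unitmx_mul uM.
have := vol_factorE uMN.
rewrite (_ : [set x : E | _] = [set x : E | [set y : E | cube 0 1 (y *m N)] (x *m M)]);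
  last by apply/seteqP; split => x /=; rewrite mulmxA.
rewrite lebesgue_mulmx//; last by apply: measurable_preimage_mulmx; exact: measurable_box.
rewrite vol_factorE// -EFinM => -[].
by rewrite mulrA => /(mulIf _) ->//; rewrite expf_neq0.
Qed.

(** If [M] is within [e] of the identity, the preimage of the unit cube lies
    between two concentric cubes. *)
Lemma vol_factor_bounds M (e : R) : M \in unitmx -> 0 <= e < 1 ->
  (forall x : E, `|x *m M - x| <= e * `|x|) ->
  ((1 + e) ^+ k)^-1 <= vol_factor M <= ((1 - e) ^+ k)^-1.
Proof.
move=> uM /andP[e0 e1] Me.
have e1' : 0 < 1 - e by lra.
have e1'' : 0 < 1 + e by lra.
have pow2 (c : R) : (c^-1 *+ 2) ^+ k = (c ^+ k)^-1 * 2 ^+ k.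
  have -> : c^-1 *+ 2 = c^-1 * 2 by rewrite mulr_natr.
  by rewrite exprMn exprVn.
have mM : measurable ([set x : E | cube 0 1 (x *m M)] : set (borel E)).
  by apply: measurable_preimage_mulmx; exact: measurable_box.
apply/andP; split.
  rewrite -(ler_pM2r (exprn_gt0 k (ltr0Sn R 1))) -lee_fin -vol_factorE//.
  rewrite -pow2 -(lebesgue_cube 0); last by rewrite invr_ge0 ltW.
  apply: le_measure; rewrite ?inE//; first exact: measurable_box.
  move=> x /=; rewrite !cube_norm ?subr0//; last by rewrite invr_ge0 ltW.
  move=> xe; rewrite -[x *m M](subrK x) (le_trans (ler_normD _ _))//.
  rewrite (@le_trans _ _ ((1 + e) * `|x|))//; first by have := Me x; lra.
  by rewrite -ler_pdivlMl ?mulr1.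
rewrite -(ler_pM2r (exprn_gt0 k (ltr0Sn R 1))) -lee_fin -vol_factorE//.
rewrite -pow2 -(lebesgue_cube 0); last by rewrite invr_ge0 ltW.
apply: le_measure; rewrite ?inE//; first exact: measurable_box.
move=> x /=; rewrite !cube_norm ?subr0//; last by rewrite invr_ge0 ltW.
move=> xM; rewrite -[(1 - e)^-1]mulr1 ler_pdivlMl//.
have := Me x; have := ler_distD 0 (x *m M) x; have := lerB_dist x (x *m M).
rewrite distrC; lra.
Qed.

Lemma vol_factor1 : vol_factor (1%:M : 'M[R]_k) = 1.
Proof.
have := @vol_factor_bounds 1%:M 0 (unitmx1 _ _); rewrite lexx ltr01 => /(_ isT).
rewrite addr0 subr0 expr1n invr1 => h; apply/eqP; rewrite eq_le andbC; apply: h.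
by move=> x; rewrite mulmx1 subrr normr0 mul0r.
Qed.

Lemma vol_factor_gt0 M : M \in unitmx -> 0 < vol_factor M.
Proof.
move=> uM; have h0 N : 0 <= vol_factor N.
  by rewrite divr_ge0 ?exprn_ge0// fine_ge0// measure_ge0.
rewrite lt_neqAle h0 andbT eq_sym; apply/eqP => M0.
have := vol_factor_mulmx uM (_ : invmx M \in unitmx).
rewrite unitmx_inv mulmxV// vol_factor1 M0 mul0r => /(_ uM) /eqP.
by rewrite oner_eq0.
Qed.

(** Multiplicativity reduces continuity at [M] to continuity at the identity,
    which is [vol_factor_bounds]. *)
Lemma vol_factor_continuous M (e : R) : M \in unitmx -> 0 < e ->
  exists2 d : R, 0 < d & forall N, N \in unitmx -> `|N - M| <= d ->
    `|vol_factor N - vol_factor M| <= e.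
Proof.
move=> uM e0; have cM := vol_factor_gt0 uM.
pose g (t : R) := ((1 + t) ^+ k)^-1.
have g0 : {for 0, continuous g}.
  apply: continuousV; first by rewrite addr0 expr1n oner_eq0.
  have -> : (fun t : R => (1 + t) ^+ k) = (@GRing.exp R ^~ k) \o (fun t => 1 + t) by [].
  apply: continuous_comp; last exact: exprn_continuous.
  by apply: (@cvgD _ _ _ (nbhs 0)); [exact: cvg_cst|exact: cvg_id].
have /cvgrPdist_le/(_ (e / vol_factor M)) := g0.
rewrite divr_gt0// => /(_ isT) /nbhs_ballP[d d0 dg].
pose D := Num.min (d / 2) (1 / 2).
have [D0 Dd D1] : [/\ 0 < D, D < d & D < 1].
  split; first by rewrite lt_min !divr_gt0.
    by rewrite gt_min ltr_pdivrMr// ltr_pMr// ltr1n.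
  by rewrite gt_min orbC ltr_pdivrMr// mul1r ltr1n.
exists (D / (k%:R * k%:R * `|invmx M| + 1)).
  by rewrite divr_gt0// ltr_wpDl// !mulr_ge0.
move=> N uN NM.
pose P := invmx M *m N.
have uP : P \in unitmx by rewrite unitmx_mul unitmx_inv uM.
have PE : N = M *m P by rewrite /P mulKVmx.
have Pb (x : E) : `|x *m P - x| <= D * `|x|.
  rewrite -{2}[x](mulmxKV uM) /P mulmxA -mulmxBr.
  rewrite (le_trans (mulmx_norm_le _ _))//.
  rewrite (@le_trans _ _ (k%:R * `|N - M| * (k%:R * `|invmx M| * `|x|)))//.
    by rewrite ler_wpM2l ?mulmx_norm_le// mulr_ge0.
  rewrite mulrA ler_wpM2r// (_ : _ * _ = (k%:R * k%:R * `|invmx M|) * `|N - M|); last by ring.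
  rewrite (le_trans (ler_wpM2l _ NM)) ?mulr_ge0//.
  rewrite mulrA ler_pdivrMr ?ltr_wpDl ?mulr_ge0// mulrC ler_wpM2l ?(ltW D0)//.
  by rewrite lerDl.
have := vol_factor_bounds uP _ Pb; rewrite D1 ltW// => /(_ isT) /andP[b1 b2].
rewrite PE vol_factor_mulmx// -{2}[vol_factor M]mulr1 -mulrBr normrM gtr0_norm//.
rewrite -ler_pdivlMl// mulrC.
have g00 : g 0 = 1 by rewrite /g addr0 expr1n invr1.
have := dg D; have := dg (- D); rewrite g00 /ball/= sub0r !normrN gtr0_norm//.
rewrite sub0r normrN (gtr0_norm D0) => /(_ Dd) h1 /(_ Dd) h2.
move: h1 h2; rewrite !ler_norml /g => /andP[h1 _] /andP[_ h2].
by apply/andP; split; lra.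
Qed.

End vol_factor_theory.

(** * Regularity of Borel measures *)

Section small_sets.
Context d (T : measurableType d) (R : realType).
Variable mu : {measure set T -> \bar R}.

(** Continuity from above of the finite measure that [mu] induces on [A]. *)
Lemma bigcup_tail_small (A : set T) (F : (set T)^nat) (e : R) :
  measurable A -> (mu A < +oo)%E -> (forall n, measurable (F n)) -> 0 < e ->
  exists N, (mu (A `&` (\bigcup_n F n `\` \bigcup_(i < N) F i)) <= e%:E)%E.
Proof.
move=> mA Aoo mF e0.
pose G N := A `&` (\bigcup_n F n `\` \bigcup_(i < N) F i).
have mG N : measurable (G N).
  apply: measurableI => //; apply: measurableD; first exact: bigcupT_measurable.
  exact: bigcup_measurable.
have G0 : \bigcap_n G n = set0.
  apply/seteqP; split => // x Gx.
  have [_ [[n _ Fnx] _]] := Gx 0%N I.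
  by have [_ [_]] := Gx n.+1 I; apply; exists n => //=.
have : mu \o G @ \oo --> mu (\bigcap_n G n).
  apply: nonincreasing_cvg_mu => //.
  - apply: le_lt_trans Aoo; apply: le_measure; rewrite ?inE//.
    by move=> x [].
  - by rewrite G0.
  - move=> m n mn; apply/subsetPset => x [Ax [Fx nFx]]; split => //; split => //.
    by move=> [i /= im Fix]; apply: nFx; exists i => //=; exact: leq_trans im mn.
rewrite G0 measure0 => /fine_cvgP[[N _ Nfin]] /cvgrPdist_le/(_ e e0)[M _ Me].
exists (maxn N M); rewrite -/(G _).
have := Me (maxn N M) (leq_maxr _ _); rewrite /= sub0r normrN.
have Gfin := Nfin (maxn N M) (leq_maxl _ _).
rewrite -lee_fin ger0_norm ?fine_ge0 ?measure_ge0// fineK//.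
Qed.

Lemma sigma_subadditive_eps (X : set T) (A : (set T)^nat) (e : R) :
  0 <= e -> (forall n, measurable (A n)) -> measurable X ->
  X `<=` \bigcup_n A n ->
  (forall n, mu (A n) <= (e / (2 ^ n.+1)%:R)%:E)%E -> (mu X <= e%:E)%E.
Proof.
move=> e0 mA mX XA Ae.
apply: le_trans (measure_sigma_subadditive mu mA mX XA) _.
apply: le_trans; last exact: (@epsilon_trick0 R e xpredT e0).
exact: lee_nneseries.
Qed.

End small_sets.

Section regularity.
Context {R : realType} {T : ptopologicalType}.
Variable mu : {measure set (borel T) -> \bar R}.
Hypothesis hT : hausdorff_space T.
Hypothesis open_sigma_compact : forall U : set T, open U ->
  exists2 K : nat -> set T, forall n, compact (K n) & U = \bigcup_n K n.

Let compactB (K : set T) : compact K -> measurable (K : set (borel T)).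
Proof. by move=> cK; apply: closed_borel; exact: compact_closed. Qed.

Let squeezed (O : set T) (B : set (borel T)) := forall e : R, 0 < e ->
  exists U C : set T, [/\ open U, closed C, C `<=` B, B `<=` U &
    (mu (O `&` (U `\` C)) <= e%:E)%E].

Let mUC (O U C : set T) : open O -> open U -> closed C ->
  measurable (O `&` (U `\` C) : set (borel T)).
Proof.
move=> oO oU cC; apply: open_borel; apply: openI => //.
by rewrite setDE; apply: openI => //; exact: closed_openC.
Qed.

Let compact_bigcup_ord (K : nat -> set T) N :
  (forall n, compact (K n)) -> compact (\bigcup_(i < N) K i).
Proof.
move=> cK; rewrite bigcup_mkord; elim: N => [|N IH]; first by rewrite big_ord0; exact: compact0.
by rewrite big_ord_recr/=; exact: compactU.
Qed.

(** Inside an open set of finite measure, the sets that can be squeezed between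
    a closed and an open set up to measure [e] form a sigma-algebra; it contains
    the open sets, because these are countable unions of compact sets. *)
Lemma finite_borel_squeezed (O : set T) : open O -> (mu O < +oo)%E ->
  forall B : set (borel T), measurable B -> squeezed O B.
Proof.
move=> oO Ooo B mB.
suff : measurable `<=` [set B : set (borel T) | measurable B /\ squeezed O B].
  by move=> /(_ B mB) [].
apply: smallest_sub; last first.
  move=> U /= oU; split; first exact: open_borel.
  move=> e e0; have [K cK KU] := open_sigma_compact oU.
  have mK n : measurable (K n : set (borel T)) by exact: compactB.
  have [N KN] := bigcup_tail_small (open_borel oO) Ooo mK e0.
  exists U, (\bigcup_(i < N) K i); split => //.
  - by apply: compact_closed => //; exact: compact_bigcup_ord.
  - by rewrite KU => x [i _ Kix]; exists i.
  - by rewrite {1}KU.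
split.
- split => // e e0; exists set0, set0; split => //.
    exact: open0. exact: closed0.
  by rewrite set0D setI0 measure0 lee_fin ltW.
- move=> A [mA sA]; rewrite setTD; split; first exact: measurableC.
  move=> e e0; have [U [C [oU cC CA AU UCe]]] := sA e e0.
  exists (~` C), (~` U); split.
  + exact: closed_openC.
  + exact: open_closedC.
  + exact: subsetC.
  + exact: subsetC.
  + by have -> : ~` C `\` ~` U = U `\` C by rewrite [LHS]setDE setCK setIC.
- move=> A hA; have mA n : measurable (A n : set (borel T)) by have [] := hA n.
  split; first exact: (@bigcupT_measurable _ (borel T)).
  move=> e e0.
  have e20 : 0 < e / 2 by rewrite divr_gt0.
  have /choice[UC hUC] : forall n, exists UC : set T * set T,
      [/\ open UC.1, closed UC.2, UC.2 `<=` A n, A n `<=` UC.1 &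
      (mu (O `&` (UC.1 `\` UC.2)) <= (e / 2 / (2 ^ n.+1)%:R)%:E)%E].
    move=> n; have [_ /(_ (e / 2 / (2 ^ n.+1)%:R))] := hA n.
    by rewrite divr_gt0// => /(_ isT)[U [C ?]]; exists (U, C).
  have oU n : open (UC n).1 by have [] := hUC n.
  have cC n : closed (UC n).2 by have [] := hUC n.
  have mC n : measurable ((UC n).2 : set (borel T)) by exact: closed_borel.
  have [N CN] := bigcup_tail_small (open_borel oO) Ooo mC e20.
  have cCN : closed (\bigcup_(i < N) (UC i).2).
    rewrite bigcup_mkord; elim: (N) => [|M IH]; first by rewrite big_ord0; exact: closed0.
    by rewrite big_ord_recr/=; exact: closedU.
  have oUU : open (\bigcup_n (UC n).1) by exact: bigcup_open.
  exists (\bigcup_n (UC n).1), (\bigcup_(i < N) (UC i).2); split => //.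
  + by move=> x [i _ ix]; exists i => //; have [_ _ + _ _] := hUC i; exact.
  + by move=> x [i _ ix]; exists i => //; have [_ _ _ + _] := hUC i; exact.
  + have m1 : measurable (O `&` (\bigcup_n (UC n).1 `\` \bigcup_n (UC n).2) : set (borel T)).
      apply: measurableI; first exact: open_borel.
      by apply: measurableD; [exact: open_borel|exact: bigcupT_measurable].
    have m2 : measurable (O `&` (\bigcup_n (UC n).2 `\` \bigcup_(i < N) (UC i).2) : set (borel T)).
      apply: measurableI; first exact: open_borel.
      by apply: measurableD; [exact: bigcupT_measurable|exact: closed_borel].
    apply: (@le_trans _ _ (mu (O `&` (\bigcup_n (UC n).1 `\` \bigcup_n (UC n).2)) +
       mu (O `&` (\bigcup_n (UC n).2 `\` \bigcup_(i < N) (UC i).2)))%E).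
      apply: le_trans (measureU2 _ _ _) => //.
      apply: le_measure; rewrite ?inE; [exact: mUC|exact: measurableU|].
      move=> x [Ox [Ux nCx]]; have [Cx|Cx] := pselect ((\bigcup_n (UC n).2) x).
        by right.
      by left.
    rewrite [e in leRHS](splitr e) EFinD leeD//.
    apply: (@sigma_subadditive_eps _ (borel T) R mu _ (fun n => O `&` ((UC n).1 `\` (UC n).2))) => //.
    * exact: ltW.
    * by move=> n; apply: mUC.
    * move=> x [Ox [[n _ Unx] nCx]]; exists n => //; split => //; split => //.
      by move=> Cx; apply: nCx; exists n.
    * by move=> n; have [] := hUC n.
Qed.

Variable O : nat -> set T.
Hypothesis oO : forall n, open (O n).
Hypothesis O_cover : \bigcup_n O n = setT.
Hypothesis O_fin : forall n, (mu (O n) < +oo)%E.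

Lemma borel_outer_approx (B : set (borel T)) (e : R) : measurable B -> 0 < e ->
  exists2 U : set T, open U /\ B `<=` U & (mu (U `\` B) <= e%:E)%E.
Proof.
move=> mB e0.
have /choice[U hU] : forall n, exists U : set T,
    [/\ open U, B `<=` U & (mu (O n `&` (U `\` B)) <= (e / (2 ^ n.+1)%:R)%:E)%E].
  move=> n; have e20 : 0 < e / (2 ^ n.+1)%:R by rewrite divr_gt0.
  have [U [C [oU cC CB BU UCe]]] := finite_borel_squeezed (oO n) (O_fin n) mB e20.
  exists U; split => //; apply: le_trans UCe.
  apply: le_measure; rewrite ?inE; last by apply: setIS; exact: setDS.
    apply: measurableI; first exact: open_borel.
    by apply: measurableD => //; exact: open_borel.
  exact: mUC.
have oU n : open (U n) by have [] := hU n.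
exists (\bigcup_n (U n `&` O n)).
  split; first by apply: bigcup_open => n _; apply: openI.
  move=> x Bx; have : setT x by []; rewrite -O_cover => -[n _ Onx].
  by exists n => //; split => //; have [_ + _] := hU n; exact.
apply: (@sigma_subadditive_eps _ (borel T) R mu _ (fun n => O n `&` (U n `\` B))).
- exact: ltW.
- move=> n; apply: measurableI; first exact: open_borel.
  by apply: measurableD => //; exact: open_borel.
- apply: measurableD => //; apply: open_borel.
  by apply: bigcup_open => n _; apply: openI.
- by move=> x [[n _ [Ux Ox]] nBx]; exists n.
- by move=> n; have [] := hU n.
Qed.

Lemma borel_inner_approx (B : set (borel T)) n (e : R) : measurable B -> 0 < e ->
  exists2 K : set T, compact K /\ K `<=` B &
    (mu (B `&` O n) <= mu K + e%:E)%E.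
Proof.
move=> mB e0; have e20 : 0 < e / 2 by rewrite divr_gt0.
have [U [C [oU cC CB BU UCe]]] := finite_borel_squeezed (oO n) (O_fin n) mB e20.
have [K cK KT] := open_sigma_compact openT.
have mK i : measurable (K i : set (borel T)) by exact: compactB.
have [N KN] := bigcup_tail_small (open_borel (oO n)) (O_fin n) mK e20.
have cKN : compact (\bigcup_(i < N) K i) by exact: compact_bigcup_ord.
have cCK : compact (C `&` \bigcup_(i < N) K i).
  apply: (subclosed_compact _ cKN); last by move=> x [].
  by apply: closedI => //; exact: compact_closed.
exists (C `&` \bigcup_(i < N) K i); first by split => // x [/CB].
have m2 : measurable (O n `&` (\bigcup_n K n `\` \bigcup_(i < N) K i) : set (borel T)).
  by rewrite -KT; apply: mUC; [|exact: openT|exact: compact_closed].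
rewrite (splitr e) EFinD.
apply: (@le_trans _ _ (mu ((C `&` \bigcup_(i < N) K i) `|` ((O n `&` (U `\` C)) `|`
    (O n `&` (\bigcup_n K n `\` \bigcup_(i < N) K i)))))).
  apply: le_measure; rewrite ?inE.
  - by apply: measurableI => //; exact: open_borel.
  - apply: measurableU; first exact: compactB.
    by apply: measurableU => //; exact: mUC.
  - move=> x [Bx Ox]; have [Cx|nCx] := pselect (C x); last first.
      by right; left; split => //; split => //; exact: BU.
    have [Kx|nKx] := pselect ((\bigcup_(i < N) K i) x); first by left.
    by right; right; split => //; split => //; rewrite -KT.
apply: le_trans (measureU2 _ _ _) _; first exact: compactB.
  by apply: measurableU => //; exact: mUC.
rewrite leeD2l//; apply: le_trans (measureU2 _ _ _) _ => //; first exact: mUC.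
by rewrite leeD.
Qed.

(** The two approximation lemmas combine the finite case over the sets [O n]:
    for outer regularity with errors [e / 2 ^ n.+1], for inner regularity by
    continuity from below, which is why the [O n] increase. *)
Lemma regular_borel_of_open_cover :
  (forall K : set T, compact K -> (mu K < +oo)%E) ->
  nondecreasing_seq O -> regular_borel mu.
Proof.
move=> Kfin ndO; split => //.
  move=> B mB; apply/eqP; rewrite eq_le; apply/andP; split.
    apply: le_ereal_inf_tmp => _ [U [oU BU] <-].
    by apply: le_measure; rewrite ?inE//; exact: open_borel.
  apply/lee_addgt0Pr => e e0.
  have [U [oU BU] Ue] := borel_outer_approx mB e0.
  apply: (@le_trans _ _ (mu U)); first by apply: ereal_inf_lbound; exists U.
  rewrite -[U in leLHS](setDUK BU).
  apply: le_trans (measureU2 _ _ _) _ => //.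
    by apply: measurableD => //; exact: open_borel.
  exact: leeD2l.
move=> B mB; apply/eqP; rewrite eq_le; apply/andP; split; last first.
  apply: ge_ereal_sup => _ [K [cK KB] <-].
  by apply: le_measure; rewrite ?inE//; exact: compactB.
have mBO n : measurable (B `&` O n).
  by apply: measurableI => //; exact: open_borel.
have BE : B = \bigcup_n (B `&` O n) by rewrite -setI_bigcupr O_cover setIT.
have /cvg_lim <- // : mu \o (fun n => B `&` O n) @ \oo --> mu B.
  rewrite {2}BE; apply: nondecreasing_cvg_mu => //.
    exact: bigcupT_measurable.
  by move=> m n mn; apply/subsetPset; apply: setIS; apply/subsetPset; exact: ndO.
apply: lime_le.
  apply: ereal_nondecreasing_is_cvgn => m n mn /=.
  apply: le_measure; rewrite ?inE//; by apply: setIS; apply/subsetPset; exact: ndO.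
apply: nearW => n /=; apply/lee_addgt0Pr => e e0.
have [K [cK KB] Ke] := borel_inner_approx n mB e0.
apply: le_trans Ke _; rewrite leeD2r//.
by apply: ereal_sup_ubound; exists K.
Qed.

End regularity.

(** * Measures with a density *)

Section density_measure.
Context d (T : measurableType d) (R : realType).
Variable mu : {measure set T -> \bar R}.

Definition density (w : T -> R) (_ : forall x, 0 <= w x)
  (_ : measurable_fun setT w) (B : set T) : \bar R :=
  (\int[mu]_(x in B) (w x)%:E)%E.

Variables (w : T -> R) (w0 : forall x, 0 <= w x) (mw : measurable_fun setT w).

Let density0 : density w0 mw set0 = 0%E.
Proof. exact: integral_set0. Qed.

Let density_ge0 B : (0 <= density w0 mw B)%E.
Proof. by apply: integral_ge0 => x _; rewrite lee_fin. Qed.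

Let density_sigma_additive : semi_sigma_additive (density w0 mw).
Proof.
move=> F mF tF mUF; rewrite /density ge0_integral_bigcup//; last 2 first.
- by apply: measurable_funTS; exact/measurable_EFinP.
- by move=> x _; rewrite lee_fin.
by apply: is_cvg_nneseries => n _ _; exact: density_ge0.
Qed.

HB.instance Definition _ := isMeasure.Build _ _ _ (density w0 mw)
  density0 density_ge0 density_sigma_additive.

Import HBNNSimple.

(** By monotone convergence it is enough to consider simple functions. *)
Lemma ge0_integral_density (f : T -> \bar R) :
  (forall x, 0 <= f x)%E -> measurable_fun setT f ->
  (\int[density w0 mw]_x f x = \int[mu]_x (f x * (w x)%:E))%E.
Proof.
move=> f0 mf; pose h := nnsfun_approx measurableT mf.
have mwE : measurable_fun setT (EFin \o w) by exact/measurable_EFinP.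
have -> : (\int[density w0 mw]_x f x =
    lim (\int[density w0 mw]_x (EFin \o h n) x @[n --> \oo]))%E.
  have fE x : f x = lim ((EFin \o h n) x @[n --> \oo]).
    by apply/esym/cvg_lim => //; apply: cvg_nnsfun_approx.
  under eq_integral => x _ do rewrite fE.
  apply: monotone_convergence => //.
  - by move=> n; exact/measurable_EFinP.
  - by move=> n x _ //=; rewrite lee_fin.
  - by move=> x _ a b ab; rewrite lee_fin; exact/lefP/nd_nnsfun_approx.
have -> : (\int[mu]_x (f x * (w x)%:E) =
    lim (\int[mu]_x ((EFin \o h n) x * (w x)%:E) @[n --> \oo]))%E.
  have fg x : (f x * (w x)%:E = lim (((EFin \o h n) x * (w x)%:E) @[n --> \oo]))%E.
    apply/esym/cvg_lim => //; apply: cvgeZr => //.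
    by apply: cvg_nnsfun_approx.
  under eq_integral => x _ do rewrite fg.
  apply: monotone_convergence => //.
  - by move=> n; apply/emeasurable_funM => //; exact/measurable_EFinP.
  - by move=> n x Ex /=; rewrite mule_ge0 ?lee_fin.
  - by move=> x Ex a b ab/=; rewrite lee_wpmul2r ?lee_fin//; exact/lefP/nd_nnsfun_approx.
suff suf n : (\int[mu]_x ((EFin \o h n) x * (w x)%:E) =
    \int[density w0 mw]_x (EFin \o h n) x)%E.
  by apply/esym; under eq_fun do rewrite suf.
transitivity (\int[density w0 mw]_x
   (\sum_(y \in range (h n)) (y * \1_(h n @^-1` [set y]) x)%:E))%E; last first.
  by apply: eq_integral => t tE; rewrite /= fimfunE -fsumEFin.
have indich m r : measurable_fun setT (fun x => (r * \1_(h m @^-1` [set r]) x)%:E).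
  by apply: (measurable_comp measurableT) => //; exact: measurable_funM.
rewrite ge0_integral_fsum//; last by move=> m y Ey; exact: nnfun_muleindic_ge0.
transitivity (\int[mu]_x (\sum_(y \in range (h n))
    (y * \1_(h n @^-1` [set y]) x)%:E * (w x)%:E))%E.
  apply: eq_integral => x xE.
  rewrite -ge0_mule_fsuml => [|y]; last exact: nnfun_muleindic_ge0.
  by rewrite fsumEFin // -(fimfunE _ x).
rewrite ge0_integral_fsum//; last 2 first.
  - by move=> y; apply: emeasurable_funM.
  - by move=> m y Ey; apply: mule_ge0; [exact: nnfun_muleindic_ge0|rewrite lee_fin].
apply: eq_fsbigr => r rhn.
under [RHS]eq_integral do rewrite EFinM.
rewrite integralZl_indic_nnsfun => //.
under eq_integral do rewrite EFinM -muleA.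
rewrite ge0_integralZl//.
- congr (_ * _)%E; rewrite integral_indic// setIT /density.
  rewrite [RHS]integral_mkcond; apply: eq_integral => x _.
  by rewrite epatch_indic/= muleC.
- by apply: emeasurable_funM => //; exact/measurable_EFinP.
- by move=> t Et; rewrite mule_ge0 ?lee_fin.
- by move: rhn; rewrite inE => -[t _ <-]; rewrite lee_fin.
Qed.

End density_measure.

Section comparison.
Context {R : realType} {k : nat}.
Local Notation E := 'rV[R]_k.

Definition seq_of_family (I : countType) T (F : I -> set T) (n : nat) : set T :=
  if @pickle_inv I n is Some i then F i else set0.

Lemma bigcup_seq_of_family (I : countType) T (F : I -> set T) :
  \bigcup_n seq_of_family F n = \bigcup_i F i.
Proof.
apply/seteqP; split => [x [n _]|x [i _ Fix]].
  by rewrite /seq_of_family; case: pickle_inv => // i; exists i.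
by exists (pickle i) => //; rewrite /seq_of_family pickleK_inv.
Qed.

Lemma trivIset_seq_of_family (I : countType) T (F : I -> set T) :
  trivIset setT F -> trivIset setT (seq_of_family F).
Proof.
move=> tF m n _ _; rewrite /seq_of_family.
have := @pickle_invK I m; have := @pickle_invK I n.
case: pickle_inv => [j|]; last by rewrite setI0 => _ _ /set0P/eqP.
case: pickle_inv => [i|]; last by rewrite set0I => _ _ /set0P/eqP.
by move=> /= <- <- ne; congr pickle; exact: tF ne.
Qed.

(** Countably many boxes [qbox q] on which the inequality holds cover [V]; [B] is the
    disjoint union of its parts in the successive differences of these boxes. *)
Lemma local_measure_le (m1 m2 : {measure set (borel E) -> \bar R}) (V : set E) :
  open V -> (forall a, V a -> exists2 N : set E, open N /\ N a &
    forall B : set (borel E), measurable B -> B `<=` N `&` V -> (m1 B <= m2 B)%E) ->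
  forall B : set (borel E), measurable B -> B `<=` V -> (m1 B <= m2 B)%E.
Proof.
move=> oV loc B mB BV.
pose Q : set {ffun 'I_k -> rat * rat} := [set q | forall C : set (borel E),
  measurable C -> C `<=` qbox q `&` V -> (m1 C <= m2 C)%E].
pose F : nat -> set (borel E) := seq_of_family (fun q => if `[< Q q >] then qbox q else set0).
have mF n : measurable (F n).
  rewrite /F /seq_of_family; case: pickle_inv => // q; case: ifP => // _.
  exact: measurable_box.
have FV n C : measurable C -> C `<=` F n `&` V -> (m1 C <= m2 C)%E.
  rewrite /F /seq_of_family; case: pickle_inv => [q|] mC; last first.
    by rewrite set0I subset0 => ->; rewrite !measure0.
  case: ifPn => [/asboolP|_]; first exact.
  by rewrite set0I subset0 => ->; rewrite !measure0.
have VF : V `<=` \bigcup_n F n.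
  rewrite bigcup_seq_of_family => a Va.
  have [N [oN Na] hN] := loc a Va.
  move: Na; rewrite {1}(open_bigcup_qbox oN) => -[q /= qN qa].
  exists q => //; case: ifPn => // /asboolP; apply => C mC CQ.
  by apply: hN => //; apply: subset_trans CQ _; exact: setSI.
pose D n := B `&` seqDU F n.
have mDU n : measurable (seqDU F n).
  apply: measurableD => //; exact: bigsetU_measurable.
have mD n : measurable (D n) by exact: measurableI.
have BD : B = \bigcup_n D n.
  rewrite /D -setI_bigcupr -seqDU_bigcup_eq; apply/esym/setIidl.
  exact: subset_trans BV VF.
have tD : trivIset setT D by apply: trivIset_setIl; exact: trivIset_seqDU.
rewrite BD !measure_semi_bigcup//; [|exact: bigcupT_measurable..].
apply: lee_nneseries => [n _ _//|n _]; apply: (FV n) => //.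
by move=> x [Bx Fx]; split; [exact: subset_seqDU Fx|exact: BV].
Qed.

End comparison.

(** * Dyadic cubes *)

Section dyadic_cubes.
Context {R : realType} {k : nat}.
Local Notation E := 'rV[R]_k.
Local Notation lam := (lebesgue_rV k : {measure set (borel 'rV[R]_k) -> \bar R}).
Implicit Types (n : nat) (q : {ffun 'I_k -> int}).

(** Half-open cubes: those of a given size form a partition, and each one is
    contained in a single cube of the next larger size. *)
Definition dcube n q : set (borel E) := [set x : E | forall i,
  (q i)%:~R <= 2 ^+ n * x ord0 i < (q i + 1)%:~R].

Lemma dcube_floor n q (x : E) :
  dcube n q x <-> q = [ffun i => Num.floor (2 ^+ n * x ord0 i)].
Proof.
split => [xq|-> i]; last by rewrite ffunE; exact: floor_itv.
by apply/ffunP => i; rewrite ffunE; apply/esym/floor_def.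
Qed.

Lemma trivIset_dcube n : trivIset setT (dcube n).
Proof. by move=> p q _ _ [x [/dcube_floor -> /dcube_floor ->]]. Qed.

Lemma dcube_double n (p q : {ffun 'I_k -> int}) (x : E) :
  dcube n q x -> dcube n.+1 p x -> dcube n.+1 p `<=` dcube n q.
Proof.
move=> xq xp y yp i; have /andP[x1 x2] := xq i; have /andP[x3 x4] := xp i.
have /andP[y1 y2] := yp i.
move: x3 x4 y1 y2; rewrite exprS -!mulrA => x3 x4 y1 y2.
have qp : (q i)%:~R * 2 <= (p i)%:~R :> R.
  rewrite -(intrM _ _ 2) ler_int -ltzD1 -(ltr_int R) intrM mulrC.
  by apply: le_lt_trans x4; rewrite ler_pM2l.
have pq : (p i + 1)%:~R <= (q i + 1)%:~R * 2 :> R.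
  rewrite -(intrM _ _ 2) ler_int lezD1 -(ltr_int R) intrM mulrC.
  by apply: le_lt_trans x3 _; rewrite ltr_pM2l.
apply/andP; split; last first.
  by rewrite -(ltr_pM2l (ltr0Sn R 1)) (lt_le_trans y2)// mulrC.
by rewrite -(ler_pM2l (ltr0Sn R 1)) (le_trans _ y1)// mulrC.
Qed.

Lemma measurable_dcube n q : measurable (dcube n q).
Proof.
have -> : dcube n q = \big[setI/setT]_(i < k) ((fun v : borel E => 2 ^+ n * (v : E) ord0 i) @^-1`
      `[(q i)%:~R, (q i + 1)%:~R[%classic).
  apply/seteqP; split => t /=.
    move=> bt; elim/big_ind : _ => // i _ /=; rewrite in_itv/=; exact: bt.
  by move=> + i; rewrite (bigD1 i)//= => -[]; rewrite in_itv.
apply: (@big_ind _ (fun A : set (borel E) => measurable A)) => //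
    [A C mA mC|i _]; first exact: measurableI.
rewrite -[X in measurable X]setTI; apply: (measurable_funM (measurable_cst _) (measurable_coord_rV i)) => //.
Qed.

Definition dcenter n q : E := \row_i (((q i)%:~R + 2^-1) / 2 ^+ n).

Lemma dcube_sub n q : dcube n q `<=` cube (dcenter n q) (2^-1 / 2 ^+ n).
Proof.
move=> x xq; apply/cubeE => i; rewrite mxE.
have p0 : 0 < 2 ^+ n :> R by rewrite exprn_gt0.
have /andP[] := xq i; rewrite intrD => h1 h2.
rewrite -(ler_pM2l p0) -{1}(gtr0_norm p0) -normrM mulrBr.
rewrite [2 ^+ n * (_ / _)]mulrC [2 ^+ n * (_ / _)]mulrC !divfK ?gt_eqF//.
by rewrite ler_norml; apply/andP; split; lra.
Qed.

Lemma sub_dcube n q (r : R) : r < 2^-1 / 2 ^+ n ->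
  cube (dcenter n q) r `<=` dcube n q.
Proof.
move=> rn x /cubeE xq i.
have p0 : 0 < 2 ^+ n :> R by rewrite exprn_gt0.
have := le_lt_trans (xq i) rn; rewrite mxE.
rewrite -(ltr_pM2l p0) -{1}(gtr0_norm p0) -normrM mulrBr.
rewrite [2 ^+ n * (_ / _)]mulrC [2 ^+ n * (_ / _)]mulrC !divfK ?gt_eqF//.
by rewrite ltr_norml intrD => /andP[h1 h2]; apply/andP; split; lra.
Qed.

Lemma dcenter_in n q : dcube n q (dcenter n q).
Proof.
apply: (@sub_dcube n q 0); first by rewrite divr_gt0// exprn_gt0.
by apply/cubeE => i; rewrite subrr normr0.
Qed.

(** The cubes of side [2 ^- n] inside [U]; [U] is the increasing union of these
    sets when it is open. *)
Definition dunion n (U : set E) : set (borel E) :=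
  \bigcup_(q in [set q | dcube n q `<=` U]) dcube n q.

Lemma dunionE n (U : set E) :
  dunion n U = \bigcup_n0 seq_of_family (fun q => if `[< dcube n q `<=` U >] then dcube n q else set0) n0.
Proof.
rewrite bigcup_seq_of_family /dunion bigcup_mkcond; apply: eq_bigcupr => q _.
case: asboolP => h; case: ifPn => //; first by rewrite notin_setE.
by rewrite inE.
Qed.

Lemma nondecreasing_dunion (U : set E) : nondecreasing_seq (dunion ^~ U).
Proof.
apply/nondecreasing_seqP => n; apply/subsetPset => x [q /= qU xq].
exists [ffun i => Num.floor (2 ^+ n.+1 * x ord0 i)]; last exact/dcube_floor.
by apply: subset_trans qU; apply: dcube_double xq _; exact/dcube_floor.
Qed.

Lemma bigcup_dunion (U : set E) : open U -> \bigcup_n dunion n U = U.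
Proof.
move=> oU; apply/seteqP; split => [x [n _ [q /= qU xq]]|x Ux]; first exact: qU.
have [e e0 eU] := rV_nbhsE (open_nbhs_nbhs (conj oU Ux)).
have [n nE] : exists n : nat, e^-1 < 2 ^+ n.
  exists (Num.truncn e^-1).+1; apply: lt_le_trans (truncnS_gt _) _.
  by rewrite -natrX ler_nat ltnW// ltn_expl.
have p0 : 0 < 2 ^+ n :> R by rewrite exprn_gt0.
exists n => //; exists [ffun i => Num.floor (2 ^+ n * x ord0 i)]; last exact/dcube_floor.
move=> y yq; apply: eU => i; have := yq i; rewrite ffunE => /andP[y1 y2].
have /andP[x1 x2] := floor_itv (2 ^+ n * x ord0 i).
move: y2 x2; rewrite !intrD => y2 x2.
rewrite -(ltr_pM2l p0) -{1}(gtr0_norm p0) -normrM mulrBr.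
have ne : 1 < 2 ^+ n * e by rewrite -ltr_pdivrMr// mul1r.
by rewrite ltr_norml; apply/andP; split; lra.
Qed.

(** Each [dunion n U] is a countable disjoint union of cubes, and the measures
    are continuous from below. *)
Lemma measure_le_dcube (m1 m2 : {measure set (borel E) -> \bar R}) (U : set E) :
  open U -> (forall n q, dcube n q `<=` U -> (m1 (dcube n q) <= m2 (dcube n q))%E) ->
  (m1 U <= m2 U)%E.
Proof.
move=> oU m12.
pose F n q : set (borel E) := if `[< dcube n q `<=` U >] then dcube n q else set0.
have mF n q : measurable (F n q) by rewrite /F; case: asboolP => // _; exact: measurable_dcube.
have mS n j : measurable (seq_of_family (F n) j).
  by rewrite /seq_of_family; case: pickle_inv.
have tF n : trivIset setT (F n).
  move=> p q _ _ [x []]; rewrite /F; case: asboolP => // _ xp; case: asboolP => // _ xq.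
  by apply: (trivIset_dcube (n := n)) => //; exists x.
have mU n : measurable (dunion n U) by rewrite dunionE; apply: bigcupT_measurable => j; exact: mS.
have le_n n : (m1 (dunion n U) <= m2 (dunion n U))%E.
  have tS := trivIset_seq_of_family (tF n).
  have mSU : measurable (\bigcup_j seq_of_family (F n) j).
    by apply: bigcupT_measurable => j; exact: mS.
  rewrite !dunionE !measure_semi_bigcup//; [|exact: mS..].
  apply: lee_nneseries => [j _ _|j _]; first exact: measure_ge0.
  rewrite /seq_of_family; case: pickle_inv => [q|]; last by rewrite !measure0.
  by case: asboolP => [h|_]; [exact: m12|rewrite !measure0].
have cv (m : {measure set (borel E) -> \bar R}) : m \o (dunion ^~ U) @ \oo --> m U.
  rewrite -{2}(bigcup_dunion oU); apply: nondecreasing_cvg_mu => //.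
    exact: bigcupT_measurable.
  exact: nondecreasing_dunion.
suff : (limn (m1 \o dunion ^~ U) <= limn (m2 \o dunion ^~ U))%E.
  by rewrite (cvg_lim _ (cv m1))// (cvg_lim _ (cv m2)).
apply: lee_lim; [by apply/cvg_ex; eexists; exact: cv|by apply/cvg_ex; eexists; exact: cv|].
by apply: nearW => n; exact: le_n.
Qed.

Lemma rV_sigma_compact (U : set E) : open U ->
  exists2 K : nat -> set E, forall n, compact (K n) & U = \bigcup_n K n.
Proof.
move=> oU; pose F (q : {ffun 'I_k -> rat * rat}) : set E := if `[< @qbox R k q `<=` U >] then qbox q else set0.
exists (seq_of_family F); last first.
  rewrite bigcup_seq_of_family {1}(open_bigcup_qbox oU) bigcup_mkcond.
  apply: eq_bigcupr => q _; rewrite /F; case: asboolP => h; case: ifPn => //.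
    by rewrite notin_setE.
  by rewrite inE.
move=> n; rewrite /seq_of_family; case: pickle_inv => [q|]; last exact: compact0.
rewrite /F; case: asboolP => _; [exact: compact_box|exact: compact0].
Qed.

Lemma lebesgue_outer (B : set (borel E)) (e : R) : measurable B -> 0 < e ->
  exists2 U : set E, open U /\ B `<=` U & (lam (U `\` B) <= e%:E)%E.
Proof.
apply: (@borel_outer_approx R _ lam _ _ (fun n => ball (0 : E) n.+1%:R)).
- exact: norm_hausdorff.
- exact: rV_sigma_compact.
- by move=> n; exact: ball_open.
- apply/seteqP; split => // v _; exists (Num.truncn `|v|) => //.
  by rewrite -ball_normE /= sub0r normrN truncnS_gt.
- move=> n; apply: le_lt_trans (lebesgue_box_lty (0 - const_mx n.+1%:R) (0 + const_mx n.+1%:R)).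
  apply: le_measure; rewrite ?inE; [|exact: measurable_box|].
    by apply: open_borel; exact: ball_open.
  by move=> v; rewrite -ball_normE /= sub0r normrN => /ltW vn; apply/cube_norm; rewrite ?subr0.
Qed.

End dyadic_cubes.

(** * Lipschitz maps *)

(** Here [g] is only relevant on [W]; the image of [mu] restricted to [W] is taken
    under the extension of [g] by a constant. *)
Lemma restricted_image_measure d1 d2 (T1 : measurableType d1)
    (T2 : measurableType d2) (R : realType) (mu : {measure set T1 -> \bar R})
    (W : set T1) (g : T1 -> T2) : measurable W -> measurable_fun W g ->
  exists m : {measure set T2 -> \bar R}, forall B, m B = mu (W `&` g @^-1` B).
Proof.
move=> mW mg.
have mg' : measurable_fun setT (g \_ W) by apply/measurable_restrict => //; rewrite setTI.
exists (measure_function_pushforward__canonical__measure_function_Measure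
  (measure_function_mrestr__canonical__measure_function_Measure mu mW) mg') => B.
rewrite /= /pushforward /mrestr setIC; congr (mu _); apply/seteqP.
by split => x [Wx]; rewrite /preimage/= patchE mem_set.
Qed.

Section lipschitz.
Context {R : realType} {k : nat}.
Local Notation E := 'rV[R]_k.
Local Notation lam := (lebesgue_rV k : {measure set (borel 'rV[R]_k) -> \bar R}).

(** The map [phi] sends a cube of half-side [h] into a cube of half-side [c * h], for
    the maximum norm.  This gives the inequality for dyadic cubes, hence for open
    sets, and for Borel sets by outer regularity.  A half-open dyadic cube
    contains no closed cube of the same size with the same center, but all the
    smaller ones: hence the two constants [c < c']. *)
Lemma lebesgue_lipschitz (V W : set E) (phi g : E -> E) (c c' : R) :
  open V -> open W -> {within W, continuous g} ->
  (forall y, W y -> V (g y)) -> (forall y, W y -> phi (g y) = y) ->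
  0 < c < c' -> (forall x y, V x -> V y -> `|phi x - phi y| <= c * `|x - y|) ->
  forall B : set (borel E), measurable B -> B `<=` V ->
  (lam (W `&` g @^-1` B) <= (c' ^+ k)%:E * lam B)%E.
Proof.
move=> oV oW cg gV phig /andP[c0 cc'] lip.
have c'0 : 0 < c' by exact: lt_trans cc'.
have mW := open_borel oW.
have [m mE] := restricted_image_measure lam mW (within_continuous_borel oW cg).
pose c'n : {nonneg R} := NngNum (exprn_ge0 k (ltW c'0)).
pose m2 := measure_function_mscale__canonical__measure_function_Measure c'n lam.
have m2E B : m2 B = ((c' ^+ k)%:E * lam B)%E by [].
have open_le (U : set E) : open U -> U `<=` V -> (m U <= m2 U)%E.
  move=> oU UV; apply: measure_le_dcube => // n q qU.
  pose h : R := 2^-1 / 2 ^+ n.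
  have h0 : 0 < h by rewrite divr_gt0// exprn_gt0.
  pose t := c / c'.
  have t1 : t < 1 by rewrite ltr_pdivrMr// mul1r.
  have t0 : 0 < t by rewrite divr_gt0.
  have mg : measurable (W `&` g @^-1` dcube n q : set (borel E)).
    by apply: (within_continuous_borel oW cg) => //; exact: measurable_dcube.
  rewrite mE m2E (@le_trans _ _ (lam (cube (phi (dcenter n q)) (c * h))))//.
    apply: le_measure; rewrite ?inE//; first exact: measurable_box.
    move=> y [Wy qy]; apply/cube_norm; first by rewrite mulr_ge0// ltW.
    rewrite -{1}(phig _ Wy) (le_trans (lip _ _ _ _))//.
    - exact: gV.
    - by apply/UV/qU; exact: dcenter_in.
    - rewrite ler_pM2l//; apply/cube_norm; first exact: ltW.
      exact: dcube_sub.
  rewrite lebesgue_cube; last by rewrite mulr_ge0// ltW.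
  rewrite (@le_trans _ _ ((c' ^+ k)%:E * lam (cube (dcenter n q) (t * h)))%E)//.
    rewrite lebesgue_cube; last by rewrite mulr_ge0// ltW.
    have -> : c * h = c' * (t * h) by rewrite [RHS]mulrA [c' * t]mulrC divfK ?gt_eqF.
    by rewrite -EFinM -exprMn mulrnAr.
  rewrite lee_pmul2l ?lte_fin ?exprn_gt0//.
  apply: le_measure; rewrite ?inE; [exact: measurable_box|exact: measurable_dcube|].
  by apply: sub_dcube; rewrite -/h gtr_pMl.
move=> B mB BV; rewrite -mE; apply/lee_addgt0Pr => e e0.
have [] := lebesgue_outer mB (_ : 0 < e / c' ^+ k); first by rewrite divr_gt0// exprn_gt0.
move=> U [oU BU] Ue.
have BUV : B `<=` U `&` V by move=> x Bx; split; [exact: BU|exact: BV].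
have mUV : measurable (U `&` V : set (borel E)) by apply: open_borel; exact: openI.
apply: (@le_trans _ _ (m (U `&` V))); first by apply: le_measure; rewrite ?inE.
apply: le_trans (open_le _ _ _) _; [exact: openI|by move=> x []|].
rewrite m2E (@le_trans _ _ ((c' ^+ k)%:E * (lam B + (e / c' ^+ k)%:E))%E)//.
  rewrite lee_pmul2l ?lte_fin ?exprn_gt0// -(setDUK BUV).
  apply: le_trans (measureU2 _ _ _) _ => //; first exact: measurableD.
  rewrite leeD2l//; apply: le_trans Ue; apply: le_measure; rewrite ?inE.
  - exact: measurableD.
  - by apply: measurableD => //; exact: open_borel.
  - by move=> x [[Ux _] nBx].
rewrite ge0_muleDr//; last by rewrite lee_fin divr_ge0 ?exprn_ge0 ?ltW.
by rewrite -EFinM mulrC divfK// expf_neq0// gt_eqF.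
Qed.

End lipschitz.

(** * Strict differentiability *)

Section strict_differentiability.
Context {R : realType} {k : nat}.
Local Notation E := 'rV[R]_k.
Implicit Types (a b x y v : E) (A B M : 'M[R]_k) (phi psi : E -> E).

(** Matrices act on the right, on row vectors: [A] is the transpose of the usual
    Jacobian matrix. *)
Definition strict_diff phi a A := forall e : R, 0 < e -> exists2 d : R, 0 < d &
  forall x y, `|x - a| < d -> `|y - a| < d ->
    `|phi y - phi x - (y - x) *m A| <= e * `|y - x|.

(** Strict differentiability of the maps near [F t0], with the derivative of
    [F t0] and a neighborhood of [a] that are common to all of them.  It implies that
    derivatives are jointly continuous at [(t0, a)], which is [strict_diff_near]. *)
Definition strict_diff_family (T : topologicalType) (F : T -> E -> E)
    (t0 : T) a A := forall e : R, 0 < e -> exists2 d : R, 0 < d &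
  \forall t \near t0, forall x y, `|x - a| < d -> `|y - a| < d ->
    `|F t y - F t x - (y - x) *m A| <= e * `|y - x|.

Lemma strict_diff_cst (T : topologicalType) (t0 : T) phi a A :
  strict_diff_family (fun=> phi) t0 a A <-> strict_diff phi a A.
Proof.
split => h e /h[d d0 hd]; exists d => //; first exact: nbhs_singleton hd.
exact: nearW.
Qed.

Lemma strict_diff_of_family (T : topologicalType) (F : T -> E -> E) t0 a A :
  strict_diff_family F t0 a A -> strict_diff (F t0) a A.
Proof. by move=> h e /h[d d0 hd]; exists d => //; exact: nbhs_singleton hd. Qed.

(** The norm of a matrix is that of its largest coefficient, so it is enough to
    test the vectors of the canonical basis, scaled to be short. *)
Lemma mx_norm_small M (e : R) : 0 <= e ->
  (exists2 d : R, 0 < d & forall v, `|v| < d -> `|v *m M| <= e * `|v|) ->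
  `|M| <= e.
Proof.
move=> e0 [d d0 hd]; rewrite [leLHS]mx_normrE; apply: bigmax_le => // -[i j] _ /=.
pose v : E := (d / 2) *: delta_mx 0 i.
have d20 : 0 < d / 2 by rewrite divr_gt0.
have nd : `|delta_mx 0 i : E| <= 1.
  apply/rV_norm_le => // l; rewrite mxE; case: andP => _; first by rewrite normr1.
  by rewrite normr0.
have vd2 : `|v| <= d / 2.
  by rewrite normrZ gtr0_norm// ler_piMr// ltW.
have vd : `|v| < d by apply: le_lt_trans vd2 _; rewrite ltr_pdivrMr// ltr_pMr// ltr1n.
have := hd v vd; rewrite -scalemxAl -rowE => h.
have := le_trans h (ler_wpM2l e0 vd2).
rewrite normrZ gtr0_norm// mulrC ler_pM2r// => /rV_norm_le -/(_ e0) /(_ j).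
by rewrite mxE.
Qed.

Lemma strict_diff_near (T : topologicalType) (F : T -> E -> E) t0 a A (e : R) :
  strict_diff_family F t0 a A -> 0 < e -> exists2 d : R, 0 < d &
    \forall t \near t0, forall b B, `|b - a| < d -> strict_diff (F t) b B ->
      `|B - A| <= e.
Proof.
move=> FA e0; have e20 : 0 < e / 2 by rewrite divr_gt0.
have [d d0 hd] := FA _ e20; exists (d / 2); first by rewrite divr_gt0.
near=> t; move=> b B bd FB.
have [d' d'0 hd'] := FB _ e20.
apply: mx_norm_small; first exact: ltW.
exists (Num.min (d / 2) d') => [|v]; first by rewrite lt_min d'0 divr_gt0.
rewrite lt_min => /andP[vd vd'].
have h1 : `|F t (b + v) - F t b - v *m A| <= e / 2 * `|v|.
  have : forall x y : E, `|x - a| < d -> `|y - a| < d ->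
    `|F t y - F t x - (y - x) *m A| <= e / 2 * `|y - x| by near: t.
  move=> /(_ b (b + v)); rewrite [b + v - b]addrAC subrr add0r; apply.
    by apply: lt_trans bd _; rewrite ltr_pdivrMr// ltr_pMr// ltr1n.
  rewrite addrAC (le_lt_trans (ler_normD _ _))// [ltRHS]splitr.
  exact: ltrD.
have h2 : `|F t (b + v) - F t b - v *m B| <= e / 2 * `|v|.
  have := hd' b (b + v); rewrite [b + v - b]addrAC subrr add0r normr0; exact.
rewrite mulmxBr [e in e * _]splitr mulrDl.
have -> : v *m B - v *m A = (F t (b + v) - F t b - v *m A) - (F t (b + v) - F t b - v *m B).
  by rewrite opprB [RHS]addrC addrA subrK.
by apply: le_trans (ler_normB _ _) _; exact: lerD.
Unshelve. all: by end_near. Qed.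

Lemma strict_diff_unique phi a A B :
  strict_diff phi a A -> strict_diff phi a B -> A = B.
Proof.
move=> hA hB; apply/eqP; rewrite eq_sym -subr_eq0 -normr_eq0 eq_le normr_ge0 andbT.
apply/ler_addgt0Pr => e e0; rewrite add0r.
have [d d0 /nbhs_singleton] := strict_diff_near ((strict_diff_cst (0 : R) phi a A).2 hA) e0.
by move=> /(_ a B); rewrite subrr normr0; exact.
Qed.

Lemma strict_diff_lipschitz phi a A : strict_diff phi a A ->
  exists2 d : R, 0 < d & forall x y, `|x - a| < d -> `|y - a| < d ->
    `|phi y - phi x| <= (k%:R * `|A| + 1) * `|y - x|.
Proof.
move=> h; have [d d0 hd] := h 1 ltr01; exists d => // x y xd yd.
rewrite -[phi y - phi x](subrK ((y - x) *m A)) (le_trans (ler_normD _ _))//.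
by rewrite mulrDl addrC lerD// ?mulmx_norm_le// hd.
Qed.

Lemma strict_diff_comp (T : topologicalType) (F G : T -> E -> E) t0 a A B :
  strict_diff_family F t0 a A -> strict_diff_family G t0 (F t0 a) B ->
  (forall e : R, 0 < e -> exists2 d : R, 0 < d &
    \forall t \near t0, forall x, `|x - a| < d -> `|F t x - F t0 a| < e) ->
  strict_diff_family (fun t x => G t (F t x)) t0 a (A *m B).
Proof.
move=> hF hG cF e e0.
pose CA := k%:R * `|A| + 1; pose CB := k%:R * `|B| + 1.
have CA0 : 0 < CA by rewrite ltr_wpDl// mulr_ge0.
have CB0 : 0 < CB by rewrite ltr_wpDl// mulr_ge0.
have e20 : 0 < e / 2 by rewrite divr_gt0.
have [dG dG0 hG'] := hG _ (divr_gt0 e20 CA0).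
have [dc dc0 hc] := cF _ dG0.
have m0 : 0 < Num.min 1 (e / 2 / CB) by rewrite lt_min ltr01 !divr_gt0.
have [dF dF0 hF'] := hF _ m0.
exists (Num.min dc dF); first by rewrite lt_min dc0.
near=> t; move=> x y; rewrite !lt_min => /andP[xc xF] /andP[yc yF].
have tF : `|F t y - F t x - (y - x) *m A| <= Num.min 1 (e / 2 / CB) * `|y - x|.
  by move: x y xF yF {xc yc}; near: t.
have tx : `|F t x - F t0 a| < dG by move: x xc {xF yF yc tF}; near: t.
have ty : `|F t y - F t0 a| < dG by move: y yc {yF tF}; near: t.
have tG : `|G t (F t y) - G t (F t x) - (F t y - F t x) *m B| <=
    e / 2 / CA * `|F t y - F t x|.
  by move: (F t x) (F t y) tx ty; near: t.
have tF1 : `|F t y - F t x| <= CA * `|y - x|.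
  rewrite -[F t y - F t x](subrK ((y - x) *m A)) (le_trans (ler_normD _ _))//.
  rewrite mulrDl addrC lerD// ?mulmx_norm_le//.
  by apply: le_trans tF _; rewrite ler_wpM2r// ge_min lexx.
have -> : G t (F t y) - G t (F t x) - (y - x) *m (A *m B) =
    (G t (F t y) - G t (F t x) - (F t y - F t x) *m B) +
    (F t y - F t x - (y - x) *m A) *m B.
  by rewrite [(_ - _ *m A) *m B]mulmxBl mulmxA addrA subrK.
rewrite (le_trans (ler_normD _ _))// [e in leRHS]splitr mulrDl lerD//.
  apply: le_trans tG _; apply: le_trans (ler_wpM2l _ tF1) _.
    by rewrite ltW// divr_gt0.
  by rewrite mulrA divfK// gt_eqF.
apply: le_trans (mulmx_norm_le _ _) _.
apply: (@le_trans _ _ (CB * (e / 2 / CB * `|y - x|))); last first.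
  by rewrite mulrCA mulrA divfK ?gt_eqF// mulrC.
apply: ler_pM => //.
  by rewrite /CB lerDl.
by apply: le_trans tF _; rewrite ler_wpM2r// ge_min lexx orbT.
Unshelve. all: by end_near. Qed.

Lemma strict_diff_eq (T : topologicalType) (F G : T -> E -> E) t0 a A :
  (exists2 d : R, 0 < d &
    \forall t \near t0, forall x, `|x - a| < d -> F t x = G t x) ->
  strict_diff_family F t0 a A -> strict_diff_family G t0 a A.
Proof.
move=> [d d0 FG] hF e /hF[d' d'0 hd']; exists (Num.min d d').
  by rewrite lt_min d0.
near=> t; move=> x y; rewrite !lt_min => /andP[xd xd'] /andP[yd yd'].
have FGt : forall x, `|x - a| < d -> F t x = G t x by near: t.
rewrite -!FGt//; move: x y xd' yd' {xd yd}; near: t.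
exact: hd'.
Unshelve. all: by end_near. Qed.

Lemma strict_diff_id a : strict_diff id a 1%:M.
Proof.
move=> e e0; exists 1 => // x y _ _.
by rewrite mulmx1 subrr normr0 mulr_ge0// ltW.
Qed.

Lemma strict_diff_continuous phi a A : strict_diff phi a A -> {for a, continuous phi}.
Proof.
move=> /strict_diff_lipschitz[d d0 hd].
apply/(@cvgrPdist_le _ _ _ (nbhs a)) => e e0.
pose C := k%:R * `|A| + 1; have C0 : 0 < C by rewrite ltr_wpDl// mulr_ge0.
near=> y; have yd : `|y - a| < d.
  by near: y; apply/nbhs_ballP; exists d => // y; rewrite -ball_normE/= distrC.
rewrite (le_trans (hd y a _ _))//; first by rewrite subrr normr0.
rewrite mulrC -ler_pdivlMr//; near: y; apply: cvgr_dist_le; [exact: cvg_id|exact: divr_gt0].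
Unshelve. all: by end_near. Qed.

Lemma strict_diff_inverse phi psi a A B :
  strict_diff phi a A -> strict_diff psi (phi a) B ->
  (exists2 d : R, 0 < d & forall x, `|x - a| < d -> psi (phi x) = x) ->
  A *m B = 1%:M.
Proof.
move=> hA hB [d d0 psiphi].
apply: (@strict_diff_unique id a); last exact: strict_diff_id.
apply/(strict_diff_cst (0 : R)).
refine (@strict_diff_eq _ (fun=> psi \o phi) (fun=> id) (0 : R) a _ _ _).
  by exists d => //; apply: (@filterE _ (nbhs (0 : R))) => _; exact: psiphi.
refine (@strict_diff_comp _ (fun=> phi) (fun=> psi) (0 : R) a A B _ _ _).
- exact/strict_diff_cst.
- exact/strict_diff_cst.
- move=> e e0; have /cvgrPdist_lt/(_ e e0)/nbhs_ballP[d' d'0 hd'] := strict_diff_continuous hA.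
  exists d' => //; apply: (@filterE _ (nbhs (0 : R))) => _ x xa; rewrite distrC; apply: hd'.
  by rewrite -ball_normE/= distrC.
Qed.

End strict_differentiability.

(** * Change of variables *)

(** Local comparisons are made up to factors close to [1]; this lets the factor
    tend to [1]. *)
Lemma le_expr_factor (R : realType) (n : nat) (x y : \bar R) : (0 <= y)%E ->
  (forall q : R, 1 < q -> (x <= (q ^+ n)%:E * y)%E) -> (x <= y)%E.
Proof.
move=> y0 xy; case: y y0 xy => [r| |]//= r0 xy; last by rewrite leey.
rewrite lee_fin in r0; apply/lee_addgt0Pr => e e0.
(* The constant [3 ^ n] is crude, but does not depend on [t]. *)
have bern (t : R) : 0 <= t <= 1 -> (1 + t) ^+ n <= 1 + 3 ^+ n * t.
  move=> /andP[t0 t1]; elim: n {xy} => [|n IH]; first by rewrite !expr0; lra.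
  rewrite exprS (le_trans (ler_wpM2l _ IH))//; first lra.
  have p1 : 1 <= 3 ^+ n :> R by rewrite exprn_ege1// ler1n.
  have : t * t * 3 ^+ n <= t * 3 ^+ n by rewrite ler_wpM2r ?(le_trans _ p1)// ler_piMr.
  have : t <= t * 3 ^+ n by rewrite ler_peMr.
  by rewrite exprS; lra.
have p0 : 0 < 3 ^+ n :> R by rewrite exprn_gt0.
have r1 : 0 < r + 1 by rewrite ltr_wpDl.
pose t := Num.min 1 (e / (3 ^+ n * (r + 1))).
have t0 : 0 < t by rewrite lt_min ltr01 divr_gt0// mulr_gt0.
have := xy (1 + t); rewrite ltrDl => /(_ t0) /le_trans; apply.
rewrite -EFinM -EFinD lee_fin.
have t1 : t <= 1 by rewrite ge_min lexx.
apply: (@le_trans _ _ ((1 + 3 ^+ n * t) * r)).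
  by rewrite ler_wpM2r// bern// (ltW t0).
rewrite mulrDl mul1r lerD2l.
apply: (@le_trans _ _ (3 ^+ n * t * (r + 1))).
  by rewrite ler_wpM2l ?lerDl// mulr_ge0// ltW.
rewrite mulrAC -ler_pdivlMl ?mulr_gt0// mulrC.
by rewrite ge_min lexx orbT.
Qed.

Section open_subspaces.
Context {T U : topologicalType}.

Lemma open_within_continuousP (A : set T) (f : T -> U) : open A ->
  {within A, continuous f} <-> (forall x, A x -> {for x, continuous f}).
Proof.
move=> oA; rewrite continuous_open_subspace//; split => h x.
  by move=> Ax; apply: h; rewrite inE.
by rewrite inE; exact: h.
Qed.

Lemma open_setI_preimage (A : set T) (f : T -> U) (B : set U) :
  open A -> {within A, continuous f} -> open B -> open (A `&` f @^-1` B).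
Proof.
by move=> oA /continuousP cf /cf; rewrite open_setSI.
Qed.

End open_subspaces.

(** The real line is endowed with the sigma-algebra generated by intervals
    here, so that this is not an instance of [within_continuous_borel]. *)
Lemma within_continuous_measurable {T : ptopologicalType} {R : realType}
    (A : set T) (f : T -> R) : open A -> {within A, continuous f} ->
  measurable_fun (A : set (borel T)) (f : borel T -> R).
Proof.
move=> oA cf; apply: (measurability _ (measurable_realfun.RGenOpens.measurableE R)).
move=> _ [_ [a [b ->] <-]]; apply: open_borel.
by apply: open_setI_preimage => //; exact: interval_open.
Qed.

Section change_of_variables.
Context {R : realType} {k : nat}.
Local Notation E := 'rV[R]_k.
Local Notation lam := (lebesgue_rV k : {measure set (borel 'rV[R]_k) -> \bar R}).
Variables (V W : set E) (phi g : E -> E) (A : E -> 'M[R]_k).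
Hypotheses (oV : open V) (oW : open W).
Hypothesis phiV : forall x, V x -> W (phi x).
Hypothesis gW : forall y, W y -> V (g y).
Hypothesis phiK : forall x, V x -> g (phi x) = x.
Hypothesis gK : forall y, W y -> phi (g y) = y.
Hypothesis cg : {within W, continuous g}.
Hypothesis diffA : forall x, V x -> strict_diff phi x (A x).
Hypothesis unitA : forall x, V x -> A x \in unitmx.

Let J x := (vol_factor (A x))^-1.

Let J0 x : V x -> 0 < J x.
Proof. by move=> Vx; rewrite invr_gt0 vol_factor_gt0// unitA. Qed.

Let J_near a (q : R) : V a -> 1 < q -> exists2 d : R, 0 < d &
  forall x, V x -> `|x - a| < d -> J x <= q * J a /\ J a <= q * J x.
Proof.
move=> Va q1; have va := vol_factor_gt0 (unitA Va).
have q0 : 0 < q by apply: lt_trans q1.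
have e0 : 0 < vol_factor (A a) * (1 - q^-1).
  by rewrite mulr_gt0// subr_gt0 invf_lt1.
have [d d0 hd] := vol_factor_continuous (unitA Va) e0.
have [d' d'0 /nbhs_singleton hd'] :=
  strict_diff_near ((strict_diff_cst (0 : R) phi a (A a)).2 (diffA Va)) d0.
exists d' => // x Vx xa.
have := hd _ (unitA Vx) (hd' x (A x) xa (diffA Vx)).
rewrite ler_distl mulrBr mulr1 => /andP[h1 h2].
have vx := vol_factor_gt0 (unitA Vx); rewrite /J.
have h3 : vol_factor (A a) <= q * vol_factor (A x).
  by rewrite -ler_pdivrMl// mulrC; lra.
have h4 : vol_factor (A x) <= q * vol_factor (A a).
  have hq : 2 - q^-1 <= q.
    have : 0 <= (q - 1) * (1 - q^-1).
      by rewrite mulr_ge0 ?subr_ge0 ?ltW// invf_lt1.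
    by rewrite mulrBl mulrBr mulr1 mul1r divff ?gt_eqF//; lra.
  by apply: (le_trans h2); have := ler_wpM2l (ltW va) hq; lra.
by split; rewrite -ler_pdivrMr ?invr_gt0// invrK ler_pdivrMl// mulrC.
Qed.

Let J_continuous : {within V, continuous J}.
Proof.
apply/(open_within_continuousP _ oV) => a Va.
apply/(@cvgrPdist_le _ _ _ (nbhs a)) => e e0.
pose q := 1 + e / (J a + e).
have je : 0 < J a + e by rewrite addr_gt0// J0.
have q1 : 1 < q by rewrite ltrDl divr_gt0.
have [d d0 hd] := J_near Va q1.
near=> x.
have Vx : V x by near: x; apply: open_nbhs_nbhs.
have xa : `|x - a| < d.
  by near: x; apply/nbhs_ballP; exists d => // y; rewrite -ball_normE/= distrC.
have [h1 h2] := hd x Vx xa.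
have qe : (q - 1) * (J a + e) = e by rewrite /q addrC addKr divfK ?gt_eqF.
have Ja := J0 Va; have Jx := J0 Vx.
have q10 : 0 < q - 1 by rewrite subr_gt0.
have h3 : (q - 1) * J a <= e by rewrite -[leRHS]qe ler_wpM2l ?ltW// ltrDl.
have h4 : J x <= J a + e by lra.
have h5 : (q - 1) * J x <= e by rewrite -[leRHS]qe ler_wpM2l// ltW.
by rewrite ler_norml; apply/andP; split; lra.
Unshelve. all: by end_near. Qed.

Let Jext x := if x \in V then J x else 0.

Let Jext_ge0 x : 0 <= Jext x.
Proof. by rewrite /Jext; case: ifPn => // /set_mem Vx; exact/ltW/J0. Qed.

Let JextE x : V x -> Jext x = J x.
Proof. by move=> Vx; rewrite /Jext mem_set. Qed.

Let measurable_Jext : measurable_fun setT (Jext : borel E -> R).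
Proof.
have mV := open_borel oV.
have -> : Jext = J \_ V by apply/funext => x; rewrite /Jext patchE.
apply/(@measurable_restrict _ _ (borel E)) => //; rewrite setTI.
exact: within_continuous_measurable.
Qed.

Let nu := density lam Jext_ge0 measurable_Jext.

Let local_estimate (m : {measure set (borel E) -> \bar R}) :
  (forall B, m B = lam (W `&` g @^-1` B)) ->
  forall (q : R) a, 1 < q -> V a -> exists2 N : set E, open N /\ N a &
  forall B : set (borel E), measurable B -> B `<=` N `&` V ->
    (m B <= (q ^+ k.+1)%:E * nu B)%E /\ (nu B <= (q ^+ k.+1)%:E * m B)%E.
Proof.
move=> mE q a q1 Va.
have q0 : 0 < q by apply: lt_trans q1.
have qV0 : 0 < q^-1 by rewrite invr_gt0.
pose M := A a; pose M' := invmx M.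
have uM : M \in unitmx := unitA Va.
have [d2 d20 hJ] := J_near Va q1.
(* With this [eta], both [1 + eta] and [(1 - eta)^-1] are less than [q]. *)
pose eta := (1 - q^-1) / 2.
have [eta0 eta1] : 0 < eta /\ eta < 1 - q^-1.
  have h : 0 < 1 - q^-1 by rewrite subr_gt0 invf_lt1.
  by rewrite /eta; split; [rewrite divr_gt0|rewrite ltr_pdivrMr// ltr_pMr// ltr1n].
have C0 : 0 < k%:R * `|M'| + 1 by rewrite ltr_wpDl// mulr_ge0.
have [d1 d10 hphi] := diffA Va (divr_gt0 eta0 C0).
(* Normalized to have the derivative [1] at [a]. *)
pose phi' x := phi x *m M'.
pose N := ball a (Num.min d1 d2) `&` V.
have oN : open N by apply: openI => //; exact: ball_open.
have Nd1 x : N x -> `|x - a| < d1.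
  by move=> [+ _]; rewrite -ball_normE/= distrC lt_min => /andP[].
have Nd2 x : N x -> `|x - a| < d2.
  by move=> [+ _]; rewrite -ball_normE/= distrC lt_min => /andP[].
have NV x : N x -> V x by case.
have phi'E x y : N x -> N y -> `|phi' y - phi' x - (y - x)| <= eta * `|y - x|.
  move=> Nx Ny.
  have -> : phi' y - phi' x - (y - x) = (phi y - phi x - (y - x) *m M) *m M'.
    by rewrite [RHS]mulmxBl (mulmxK uM) mulmxBl.
  apply: le_trans (mulmx_norm_le _ _) _.
  apply: (@le_trans _ _ ((k%:R * `|M'| + 1) * (eta / (k%:R * `|M'| + 1) * `|y - x|))).
    apply: ler_pM => //; first by rewrite lerDl.
    by apply: hphi; exact: Nd1.
  by rewrite mulrA mulrCA mulfV ?gt_eqF// mulr1.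
have lip1 x y : N x -> N y -> `|phi' x - phi' y| <= (1 + eta) * `|x - y|.
  move=> Nx Ny; rewrite -[phi' x - phi' y](subrK (x - y)).
  rewrite (le_trans (ler_normD _ _))// mulrDl mul1r addrC lerD2l.
  exact: phi'E.
have lip2 x y : N x -> N y -> `|x - y| <= (1 - eta)^-1 * `|phi' x - phi' y|.
  move=> Nx Ny; rewrite ler_pdivlMl; last by lra.
  have := phi'E y x Ny Nx; have := lerB_dist (x - y) (phi' x - phi' y).
  rewrite [`|x - y - _|]distrC; lra.
pose W' : set E := [set y | (W `&` g @^-1` N) (y *m M)].
have oWN : open (W `&` g @^-1` N) by exact: open_setI_preimage.
have oW' : open W' by apply: open_comp => // y _; exact: mulmx_continuous.
pose g' y := g (y *m M).
have cg' : {within W', continuous g'}.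
  apply/(open_within_continuousP _ oW') => y [Wy _].
  apply: (@continuous_comp _ _ _ (fun z : E => z *m M) g y); first exact: mulmx_continuous.
  exact: ((open_within_continuousP g oW).1 cg).
have cphi' : {within N, continuous phi'}.
  apply/(open_within_continuousP _ oN) => y /NV Vy.
  apply: (@continuous_comp _ _ _ phi (fun z : E => z *m M') y); last exact: mulmx_continuous.
  exact: strict_diff_continuous (diffA Vy).
have g'N y : W' y -> N (g' y) by case.
have phi'W x : N x -> W' (phi' x).
  move=> Nx; rewrite /W'/= /phi' mulmxKV//; split; first exact/phiV/NV.
  by rewrite /preimage/= phiK//; exact: NV.
have phi'K x : N x -> g' (phi' x) = x.
  by move=> Nx; rewrite /g' /phi' mulmxKV// phiK//; exact: NV.
have g'K y : W' y -> phi' (g' y) = y.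
  by move=> [Wy _]; rewrite /phi' /g' gK// mulmxK.
exists N; first by split => //; split => //; apply: ballxx; rewrite lt_min d10.
move=> B mB BNV.
have BN : B `<=` N by move=> x /BNV[].
have mpre : measurable (W `&` g @^-1` B : set (borel E)).
  by apply: (within_continuous_borel oW cg) => //; exact: open_borel.
have mB' : measurable (W' `&` g' @^-1` B : set (borel E)).
  by apply: (within_continuous_borel oW' cg') => //; exact: open_borel.
have lamB' : lam (W' `&` g' @^-1` B) = ((vol_factor M)%:E * m B)%E.
  rewrite mE -lebesgue_mulmx//; congr (lam _); apply/seteqP; split => y.
    by move=> [[Wy _] By].
  by move=> [Wy By]; split => //; split => //; exact: BN.
have vM := vol_factor_gt0 uM.
have le1 : ((vol_factor M)%:E * m B <= (q ^+ k)%:E * lam B)%E.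
  rewrite -lamB'; apply: (lebesgue_lipschitz (phi := phi') (c := 1 + eta) oN oW' cg') => //.
  rewrite addr_gt0//=.
  have h : 2 - q^-1 <= q.
    have : 0 <= (q - 1) * (1 - q^-1).
      by rewrite mulr_ge0 ?subr_ge0 ?ltW// invf_lt1.
    by rewrite mulrBl mulrBr mulr1 mul1r divff ?gt_eqF//; lra.
  lra.
have le2 : (lam B <= (q ^+ k)%:E * ((vol_factor M)%:E * m B))%E.
  rewrite -lamB'.
  have -> : lam B = lam (N `&` phi' @^-1` (W' `&` g' @^-1` B)).
    congr (lam _); apply/seteqP; split => x.
      move=> Bx; have Nx := BN _ Bx; split => //; split; first exact: phi'W.
      by rewrite /preimage/= phi'K.
    by move=> [Nx [_]]; rewrite /preimage/= phi'K.
  apply: (lebesgue_lipschitz (phi := g') (c := (1 - eta)^-1) oW' oN cphi') => //.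
  - have h : 0 < 1 - eta by lra.
    rewrite invr_gt0 h/= -[q]invrK ltf_pV2 ?posrE ?invr_gt0//; lra.
  - move=> x y Wx Wy; rewrite -{2}(g'K _ Wx) -{2}(g'K _ Wy).
    by apply: lip2; exact: g'N.
have mJ : measurable_fun B (EFin \o (Jext : borel E -> R)).
  by apply/measurable_EFinP; exact: measurable_funTS.
have Ja := J0 Va.
have nuE : nu B = (\int[lam]_(x in B) (Jext x)%:E)%E by [].
have le3 : (nu B <= (q * J a)%:E * lam B)%E.
  rewrite nuE -integral_cst//; apply: ge0_le_integral => //.
  - by move=> x _; rewrite lee_fin.
  - by move=> x Bx; rewrite lee_fin (JextE (NV _ (BN _ Bx))); have [] := hJ x (NV _ (BN _ Bx)) (Nd2 _ (BN _ Bx)).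
have le4 : ((J a)%:E * lam B <= q%:E * nu B)%E.
  rewrite nuE -ge0_integralZl//; last 2 first.
  - by move=> x _; rewrite lee_fin.
  - by rewrite lee_fin ltW.
  rewrite -integral_cst//; apply: ge0_le_integral => //.
  - by move=> x _; rewrite lee_fin ltW.
  - exact: measurable_funeM.
  - by move=> x Bx; rewrite -EFinM lee_fin (JextE (NV _ (BN _ Bx))); have [] := hJ x (NV _ (BN _ Bx)) (Nd2 _ (BN _ Bx)).
have mBE : (m B = (J a)%:E * ((vol_factor M)%:E * m B))%E.
  by rewrite muleA -EFinM mulVf ?mul1e// gt_eqF.
have qk0 : 0 <= q ^+ k by rewrite exprn_ge0// ltW.
split.
  rewrite mBE; apply: le_trans (lee_wpmul2l _ le1) _; first by rewrite lee_fin ltW.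
  rewrite muleCA exprSr EFinM -muleA.
  by apply: lee_wpmul2l => //; rewrite lee_fin.
apply: (le_trans le3); apply: le_trans (lee_wpmul2l _ le2) _.
  by rewrite lee_fin mulr_ge0// ltW.
rewrite [X in (_ <= _ * X)%E]mBE !muleA -!EFinM exprSr.
by rewrite (_ : q * J a * q ^+ k = q ^+ k * q * J a); [|ring].
Qed.

(** The set on the left is the image of [B] by [phi].  By [local_estimate] the two
    measures agree locally up to any factor [q > 1]; by [local_measure_le] they
    do so globally. *)
Lemma lebesgue_image (B : set (borel E)) : measurable B -> B `<=` V ->
  lam (W `&` g @^-1` B) = (\int[lam]_(x in B) (vol_factor (A x))^-1%:E)%E.
Proof.
move=> mB BV.
have [m mE] := restricted_image_measure lam (open_borel oW) (within_continuous_borel oW cg).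
have -> : (\int[lam]_(x in B) (vol_factor (A x))^-1%:E)%E = nu B.
  by apply: eq_integral => x /set_mem /BV Vx; rewrite JextE.
rewrite -mE; apply/eqP; rewrite eq_le; apply/andP; split.
  apply: (@le_expr_factor _ k.+1) => // q q1.
  have q0 : 0 <= q ^+ k.+1 by rewrite exprn_ge0// (le_trans _ (ltW q1)).
  pose m2 := measure_function_mscale__canonical__measure_function_Measure (NngNum q0) nu.
  apply: (@local_measure_le _ _ m m2 V) => // a Va.
  by have [N ? h] := local_estimate mE q1 Va; exists N => // C mC /(h C mC)[].
apply: (@le_expr_factor _ k.+1) => // q q1.
have q0 : 0 <= q ^+ k.+1 by rewrite exprn_ge0// (le_trans _ (ltW q1)).
pose m2 := measure_function_mscale__canonical__measure_function_Measure (NngNum q0) m.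
apply: (@local_measure_le _ _ nu m2 V) => // a Va.
by have [N ? h] := local_estimate mE q1 Va; exists N => // C mC /(h C mC)[].
Qed.

(** [lebesgue_image] says that the image under [g] of Lebesgue measure on [W] has
    a density; the formula is the integration of [F \o phi] against both forms
    of this measure. *)
Lemma change_of_variables (F : E -> \bar R) :
  (forall x, 0 <= F x)%E -> measurable_fun setT (F : borel E -> \bar R) ->
  (\int[lam]_(y in W) F y =
   \int[lam]_(x in V) (F (phi x) * (vol_factor (A x))^-1%:E))%E.
Proof.
move=> F0 mF.
have mW := open_borel oW; have mV := open_borel oV.
have cphi : {within V, continuous phi}.
  apply/(open_within_continuousP _ oV) => y Vy.
  exact: strict_diff_continuous (diffA Vy).
have mphi := within_continuous_borel oV cphi.
have mg := within_continuous_borel oW cg.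
pose Fp := (F \o phi) \_ V.
have mFp : measurable_fun setT (Fp : borel E -> \bar R).
  apply/measurable_restrict => //; rewrite setTI.
  exact: (measurableT_comp mF mphi).
have Fp0 x : (0 <= Fp x)%E by rewrite /Fp patchE; case: ifPn => //= _; exact: F0.
have mgW : measurable_fun setT (g \_ W : borel E -> borel E).
  by apply/(@measurable_restrict _ _ (borel E) (borel E)) => //; rewrite setTI.
have indW0 (x : borel E) : 0 <= \1_W x :> R by rewrite indicE.
have mindW : measurable_fun setT (\1_W : borel E -> R) by exact: measurable_indic.
pose m' := measure_function_pushforward__canonical__measure_function_Measure
  (density lam indW0 mindW) mgW.
have m'nu B : measurable B -> m' B = nu B.
  move=> mB; have mBV : measurable (B `&` V) by exact: measurableI.
  have mpre : measurable ((g \_ W) @^-1` B : set (borel E)).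
    by rewrite -[X in measurable X]setTI; exact (mgW measurableT _ mB).
  transitivity (lam (W `&` g @^-1` (B `&` V))).
    rewrite /m' /= /pushforward /density integral_indic//; congr (lam _).
    apply/seteqP; split => x [Wx].
      by rewrite /preimage/= patchE mem_set// => gB; split => //; split => //; exact: gW.
    by move=> [gBx _]; split => //; rewrite /preimage/= patchE mem_set.
  rewrite lebesgue_image//.
  rewrite /nu /density integral_mkcondr; apply: eq_integral => x _.
  by rewrite patchE /Jext; case: ifPn.
transitivity (\int[m']_x Fp x)%E.
  have := ge0_integral_pushforward mgW (density lam indW0 mindW) measurableT mFp
    (fun y _ => Fp0 y).
  rewrite preimage_setT ge0_integral_density; [|by move=> x; exact: Fp0|exact: (measurableT_comp mFp mgW)].
  move=> step; rewrite [RHS]step.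
  rewrite [LHS]integral_mkcond; apply: eq_integral => y _.
  rewrite patchE indicE; case: ifPn => yW; last by rewrite mule0.
  rewrite mule1 /= patchE yW /Fp patchE mem_set; last by apply: gW; rewrite -inE.
  by rewrite /= gK//; rewrite -inE.
transitivity (\int[density lam Jext_ge0 measurable_Jext]_x Fp x)%E.
  by apply: eq_measure_integral => B mB _; exact: m'nu.
rewrite ge0_integral_density// [RHS]integral_mkcond; apply: eq_integral => x _.
by rewrite patchE /Fp patchE /Jext; case: ifPn => // _; rewrite mul0e.
Qed.

End change_of_variables.

(** * Continuous families of smooth maps *)

Section strict_differentiability_of_C1_maps.
Context {R : realType} {k : nat}.
Local Notation E := 'rV[R]_k.
Local Notation e_ i := (delta_mx ord0 i : E).

(** The mean value theorem for [g - al * id], between [0] and [t], whatever the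
    sign of [t]. *)
Lemma MVT_bound (g dg : R -> R) (t al ep : R) :
  (forall c, `|c| <= `|t| -> 0 <= c * t -> is_derive c 1 g (dg c) /\ `|dg c - al| <= ep) ->
  `|g t - g 0 - t * al| <= ep * `|t|.
Proof.
move=> h; have [t0|t0|->] := ltgtP t 0; last first.
- by rewrite subrr mul0r subrr !normr0 mulr0.
- have hin c : c \in `[0, t] -> is_derive c 1 g (dg c) /\ `|dg c - al| <= ep.
    rewrite in_itv/= => /andP[c0 ct]; apply: h.
      by rewrite !ger0_norm// ltW.
    by rewrite mulr_ge0// ltW.
  have [||c ct ->] := @MVT R g dg 0 t t0.
    by move=> x /(subset_itv_oo_cc) /hin[].
    by apply: derivable_within_continuous => x /hin[[]].
  have [_ hc] := hin c (subset_itv_oo_cc ct).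
  by rewrite subr0 [t * al]mulrC -mulrBl normrM ler_wpM2r.
- have hin c : c \in `[t, 0] -> is_derive c 1 g (dg c) /\ `|dg c - al| <= ep.
    rewrite in_itv/= => /andP[tc c0]; apply: h.
      by rewrite !ler0_norm// ?lerN2// ltW.
    by rewrite mulr_le0// ltW.
  have [||c ct gE] := @MVT R g dg t 0 t0.
    by move=> x /(subset_itv_oo_cc) /hin[].
    by apply: derivable_within_continuous => x /hin[[]].
  have [_ hc] := hin c (subset_itv_oo_cc ct).
  have -> : g t - g 0 = dg c * t by rewrite -opprB gE sub0r mulrN opprK.
  by rewrite [t * al]mulrC -mulrBl normrM ler_wpM2r.
Qed.

Lemma derive_line (phi : E -> E) (p : E) (i j : 'I_k) (c : R) :
  derivable phi (p + c *: e_ i) (e_ i) ->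
  is_derive c 1 (fun t : R => phi (p + t *: e_ i) ord0 j)
    (('D_(e_ i) phi (p + c *: e_ i)) ord0 j).
Proof.
move=> dphi.
have cq : (fun h : R => h^-1 *: (phi (p + (h *: 1 + c) *: e_ i) ord0 j - phi (p + c *: e_ i) ord0 j))
    @ 0^' --> ('D_(e_ i) phi (p + c *: e_ i)) ord0 j.
  have := @cvg_comp _ _ _ _ (fun v : E => v ord0 j) (0^' : set_system R) _ _ dphi
    (@coord_continuous R 1 k ord0 j _).
  apply: cvg_trans; apply: near_eq_cvg; near=> h => /=.
  rewrite !mxE; congr (_ * (phi _ ord0 j - _)).
  by rewrite scalerDl [h *: 1]mulr1 addrCA.
by apply: DeriveDef; [apply/cvg_ex; eexists; exact: cq|exact: cvg_lim].
Unshelve. all: by end_near. Qed.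

(** Going from [x] to [y] along the coordinate axes, one coordinate at a time,
    stays in a ball for the maximum norm; each step is a one-dimensional mean
    value estimate. *)
Lemma partials_bound (phi : E -> E) (a : E) (r ep : R) (A : 'M[R]_k) :
  0 < r -> 0 <= ep ->
  (forall x, `|x - a| < r -> forall i, derivable phi x (e_ i)) ->
  (forall x, `|x - a| < r -> forall i, `|'D_(e_ i) phi x - row i A| <= ep) ->
  forall x y, `|x - a| < r -> `|y - a| < r ->
  `|phi y - phi x - (y - x) *m A| <= k%:R * ep * `|y - x|.
Proof.
move=> r0 ep0 dphi bphi x y xr yr.
(* The path from [x] to [y]: the first [m] coordinates have been changed. *)
pose h m : E := \row_i (if (i < m)%N then y ord0 i else x ord0 i).
have hin (m : 'I_k) (c : R) : `|c| <= `|y ord0 m - x ord0 m| ->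
    0 <= c * (y ord0 m - x ord0 m) -> `|h m + c *: e_ m - a| < r.
  move=> cm cs; apply/rV_norm_lt => // i.
  have := (rV_norm_lt (x - a) r0).1 xr i; have := (rV_norm_lt (y - a) r0).1 yr i.
  rewrite !mxE eqxx/=; have [->|im] := eqVneq i m; last first.
    by rewrite mulr0 addr0; case: ifP.
  rewrite ltnn mulr1; move: cm cs.
  move: (y ord0 m) (x ord0 m) (a ord0 m) => u v w cm cs h1 h2.
  have [uv|uv|uv] := ltgtP u v.
  - have c0 : c <= 0.
      by rewrite leNgt; apply/negP => c0; move: cs; rewrite pmulr_rge0// subr_ge0 leNgt uv.
    move: cm; rewrite ler0_norm// ltr0_norm ?subr_lt0// => cm.
    by move: h1 h2; rewrite !ltr_norml => /andP[? ?] /andP[? ?]; apply/andP; split; lra.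
  - have c0 : 0 <= c.
      by move: cs; rewrite pmulr_lge0// subr_gt0.
    move: cm; rewrite ger0_norm// gtr0_norm ?subr_gt0// => cm.
    by move: h1 h2; rewrite !ltr_norml => /andP[? ?] /andP[? ?]; apply/andP; split; lra.
  - by move: cm; rewrite uv subrr normr0 normr_le0 => /eqP ->; rewrite addr0.
have hS (m : 'I_k) : h m.+1 = h m + (y ord0 m - x ord0 m) *: e_ m.
  apply/rowP => i; rewrite !mxE eqxx/= ltnS leq_eqVlt.
  have [/val_inj ->|im] := eqVneq (i : nat) m; first by rewrite ?eqxx ltnn mulr1 addrC subrK.
  have -> : (i == m) = false by apply/eqP => im'; rewrite im' eqxx in im.
  by rewrite mulr0 addr0.
have h0 : h 0%N = x by apply/rowP => i; rewrite mxE.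
have hk : h k = y by apply/rowP => i; rewrite mxE ltn_ord.
have step (m : 'I_k) : `|phi (h m.+1) - phi (h m) - (y ord0 m - x ord0 m) *: row m A|
    <= ep * `|y - x|.
  have yxm : `|y ord0 m - x ord0 m| <= `|y - x|.
    by have := (rV_norm_le (y - x) (normr_ge0 _)).1 (lexx _) m; rewrite !mxE.
  apply: (@le_trans _ _ (ep * `|y ord0 m - x ord0 m|)); last by rewrite ler_wpM2l.
  apply/rV_norm_le; first by rewrite mulr_ge0.
  move=> j; rewrite !mxE hS.
  pose g t := phi (h m + t *: e_ m) ord0 j.
  have -> : phi (h m) ord0 j = g 0 by rewrite /g scale0r addr0.
  apply: (@MVT_bound g (fun c => ('D_(e_ m) phi (h m + c *: e_ m)) ord0 j)) => c cm cs.
  have hc := hin m c cm cs; split; first by apply: derive_line; exact: dphi.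
  have := (rV_norm_le _ ep0).1 (bphi _ hc m) j.
  by rewrite !mxE.
have -> : phi y - phi x - (y - x) *m A =
    \sum_(m < k) (phi (h m.+1) - phi (h m) - (y ord0 m - x ord0 m) *: row m A).
  rewrite sumrB mulmx_sum_row; congr (_ - _); last first.
    by apply: eq_bigr => i _; rewrite !mxE.
  by rewrite -(big_mkord xpredT (fun m => phi (h m.+1) - phi (h m))) telescope_sumr// h0 hk.
apply: le_trans (ler_norm_sum _ _ _) _.
rewrite -mulrA -[k in k%:R]card_ord mulr_natl -sumr_const ler_sum//.
Qed.

(** By [partials_bound], control on the first partial derivatives near [a] is
    enough.  For [F t0] it comes from their continuity, and for [t] near [t0] from
    uniform convergence on a compact cube. *)
Lemma continuous_into_Cinf_strict_diff (Y : topologicalType) (U : set Y)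
    (V1 V2 : set E) (F : Y -> E -> E) t0 a :
  open U -> open V1 -> continuous_into_Cinf U V1 V2 F -> U t0 -> V1 a ->
  exists A, strict_diff_family F t0 a A.
Proof.
move=> oU oV1 [smF cF] Ut0 V1a.
pose A : 'M[R]_k := \matrix_(i, j) ('D_(e_ i) (F t0) a) ord0 j.
have rowA i : row i A = 'D_(e_ i) (F t0) a by apply/rowP => j; rewrite !mxE.
exists A => e e0.
have k0 : 0 < k%:R + 1 :> R by rewrite ltr_wpDl.
pose ep := e / (k%:R + 1).
have ep0 : 0 < ep by rewrite divr_gt0.
have ep20 : 0 < ep / 2 by rewrite divr_gt0.
have [d1 d10 hd1] : exists2 d : R, 0 < d & cube a d `<=` V1.
  have [d d0 hd] := rV_nbhsE (open_nbhs_nbhs (conj oV1 V1a)).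
  exists (d / 2); first by rewrite divr_gt0.
  move=> x /cubeE xd; apply: hd => i; apply: le_lt_trans (xd i) _.
  by rewrite ltr_pdivrMr// ltr_pMr// ltr1n.
have [d2 d20 hd2] : exists2 d : R, 0 < d & forall x, `|x - a| < d ->
    forall i, `|'D_(e_ i) (F t0) x - row i A| <= ep / 2.
  have : \forall x \near a, forall i, `|'D_(e_ i) (F t0) a - 'D_(e_ i) (F t0) x| <= ep / 2.
    apply: (@filter_forall _ _ _ (nbhs a)) => i.
    have [/(_ [:: i] a V1a)[/= ci _] _] := smF t0 Ut0.
    by have /cvgrPdist_le/(_ _ ep20) := ci.
  move=> /nbhs_ballP[d d0 hd]; exists d => // x xa i.
  by rewrite rowA distrC; apply: hd; rewrite -ball_normE/= distrC.
have cK : compact (cube a d1 : set E) by exact: compact_box.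
have hunif : \forall t \near t0, U t /\ forall i x, cube a d1 x ->
    `|'D_(e_ i) (F t0) x - 'D_(e_ i) (F t) x| <= ep / 2.
  apply: filterI; first exact: open_nbhs_nbhs.
  apply: filter_forall => i.
  have ct : {for t0, continuous (F : Y -> initial_topology (jet V1))}.
    by move: cF; rewrite continuous_open_subspace// => /(_ t0); apply; rewrite inE.
  pose FK : topologicalType := {family [set K | compact K /\ K `<=` V1], E -> E}.
  pose P := prod_topology (fun _ : seq 'I_k =>
    {family [set K | compact K /\ K `<=` V1], E -> E}).
  have c1 : {for t0, continuous ((fun t => jet V1 (F t)) : Y -> P)}.
    apply: (@continuous_comp Y (initial_topology (jet V1)) P F (jet V1) t0 ct).
    exact: initial_continuous.
  have c2 := @continuous_comp Y P FK (fun t => jet V1 (F t))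
    (@proj _ (fun=> FK) ([:: i] : seq 'I_k)) t0 c1 (@proj_continuous _ (fun=> FK) [:: i] _).
  have entE : entourage [set xy : E * E | ball xy.1 (ep / 2) xy.2].
    exact: entourage_ball (PosNum ep20).
  have famK : [set K : set E | compact K /\ K `<=` V1] (cube a d1) by [].
  have := c2 _ (@fam_nbhs _ _ _ _ _ ('D_(e_ i) (F t0)) entE famK).
  apply: (@filterS _ (nbhs t0) _) => t ht x Kx; have := ht x Kx.
  by rewrite /= -ball_normE/= => /ltW.
exists (Num.min d1 d2); first by rewrite lt_min d10.
near=> t.
have [Ut ht] : U t /\ forall i x, cube a d1 x ->
    `|'D_(e_ i) (F t0) x - 'D_(e_ i) (F t) x| <= ep / 2 by near: t.
move=> x y xd yd.
have in1 z : `|z - a| < Num.min d1 d2 -> cube a d1 z.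
  by rewrite lt_min => /andP[/ltW zd _]; apply/cube_norm => //; exact: ltW.
apply: (@le_trans _ _ (k%:R * ep * `|y - x|)).
  apply: (@partials_bound (F t) a (Num.min d1 d2)) => //.
  - by rewrite lt_min d10.
  - exact: ltW.
  - move=> z zd i; have [/(_ [::] z (hd1 _ (in1 _ zd)))[_ h] _] := smF t Ut.
    exact: h.
  - move=> z zd i; move: (zd); rewrite lt_min => /andP[_ zd2].
    rewrite -['D_(e_ i) (F t) z](subrK ('D_(e_ i) (F t0) z)) -addrA.
    rewrite (le_trans (ler_normD _ _))// [leRHS]splitr lerD//.
      by rewrite distrC; apply: ht; exact: in1.
    exact: hd2.
rewrite ler_wpM2r// /ep mulrA ler_pdivrMr// mulrC ler_wpM2l ?(ltW e0)//.
by rewrite lerDl.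
Unshelve. all: by end_near. Qed.

End strict_differentiability_of_C1_maps.

(** * Groupoids and charts *)

Section subtypes.
Context {T : topologicalType} (A : set T).

Lemma set_val_continuous : continuous (fun a : A => \val a).
Proof. exact: (@initial_continuous A T set_val). Qed.

Lemma nbhs_subtype (a : A) (Q : set A) :
  nbhs a Q <-> exists2 O : set T, open O /\ O (\val a) & (fun a : A => \val a) @^-1` O `<=` Q.
Proof.
split.
  rewrite nbhsE => -[B [[Q1 oQ <-] Qa] BQ]; exists Q1 => //; split => //.
move=> [Q1 [oQ Qa] OQ]; apply: filterS OQ _.
by apply: set_val_continuous; exact: open_nbhs_nbhs.
Qed.

Lemma continuous_to_subtype {S : topologicalType} (f : S -> A) (s : S) :
  {for s, continuous (fun x => \val (f x))} -> {for s, continuous f}.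
Proof.
move=> cf Q /nbhs_subtype[Q1 [oQ Qfs] OQ].
have : nbhs s ((fun x => \val (f x)) @^-1` Q1) by apply: cf; exact: open_nbhs_nbhs.
by apply: filterS => x /= ?; exact: OQ.
Qed.

End subtypes.

Section groupoid_algebra.
Variable G : groupoid.
Implicit Types x y z : G.

Lemma ginvK : involutive (@ginv G). Proof. exact: law_invK (glaw G). Qed.

Lemma gmulA x y z : gsource x = grange y -> gsource y = grange z ->
  gmul x (gmul y z) = gmul (gmul x y) z.
Proof. exact: law_mulA (glaw G) _ _ _. Qed.

Lemma grange_mul x y : gsource x = grange y -> grange (gmul x y) = grange x.
Proof. exact: law_range_mul (glaw G) _ _. Qed.

Lemma gsource_mul x y : gsource x = grange y -> gsource (gmul x y) = gsource y.
Proof. exact: law_source_mul (glaw G) _ _. Qed.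

Lemma gmul_range x : gmul (grange x) x = x. Proof. exact: law_unitl (glaw G) _. Qed.

Lemma gmul_source x : gmul x (gsource x) = x. Proof. exact: law_unitr (glaw G) _. Qed.

Lemma gsource_inv x : gsource (ginv x) = grange x.
Proof. by rewrite /gsource ginvK. Qed.

Lemma grange_range x : grange (grange x) = grange x.
Proof. by apply: grange_unit; exists x. Qed.

Lemma grange_source x : grange (gsource x) = gsource x.
Proof. by apply: grange_unit; exact: units_source. Qed.

Lemma gsource_range x : gsource (grange x) = grange x.
Proof.
by rewrite {1}/grange gsource_mul ?grange_inv// gsource_inv.
Qed.

Lemma gmulKV x z : gsource x = grange z -> gmul (ginv x) (gmul x z) = z.
Proof.
by move=> xz; rewrite gmulA ?gsource_inv// -/(gsource x) xz gmul_range.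
Qed.

Lemma val_rmap x : \val (rmap x) = grange x. Proof. by []. Qed.
Lemma val_smap x : \val (smap x) = gsource x. Proof. by []. Qed.

Lemma comp_pair_subproof x y : composable G
  (if pselect (gsource x = grange y) is left _ then (x, y) else (x, gsource x)).
Proof.
by case: pselect => //= _; rewrite /composable/= grange_source.
Qed.

(** The composable pair [(x, y)]; the junk value [(x, s x)] has the right
    first component, so that fibers over [x] are respected in all cases. *)
Definition comp_pair x y : composable G := SigSub (mem_set (comp_pair_subproof x y)).

Lemma comp_pairE x y : gsource x = grange y -> \val (comp_pair x y) = (x, y).
Proof. by move=> xy; rewrite /=; case: pselect. Qed.

Lemma composableP (p : composable G) : gsource (\val p).1 = grange (\val p).2.
Proof. by have := set_valP p. Qed.

Lemma comp_pair_val (p : composable G) : comp_pair (\val p).1 (\val p).2 = p.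
Proof.
apply: val_inj; rewrite comp_pairE ?composableP//.
by case: (\val p).
Qed.

Lemma gmult_comp_pair x y : gsource x = grange y -> gmult (comp_pair x y) = gmul x y.
Proof. by move=> xy; rewrite /gmult comp_pairE. Qed.

End groupoid_algebra.

Section charts.
Context {R : realType} {k : nat} {X Y : topologicalType} (p : X -> Y).
Local Notation E := 'rV[R]_k.
Implicit Types c : chart R k X Y.

Lemma chart_inv_in c a : is_chart p c -> cimg c a ->
  cdom c (cinv c a) /\ cmap c (cinv c a) = a.
Proof. by move=> hc [x cx <-]; rewrite (chart_cancel hc). Qed.

Lemma chart_mapE c x : is_chart p c -> cdom c x -> cmap c x = (p x, (cmap c x).2).
Proof. by move=> hc cx; rewrite -(chart_base hc cx) -surjective_pairing. Qed.

Lemma chart_base_inv c a : is_chart p c -> cimg c a -> p (cinv c a) = a.1.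
Proof.
by move=> hc /(chart_inv_in hc)[h1 h2]; rewrite -(chart_base hc h1) h2.
Qed.

Lemma cmap_continuous c x : is_chart p c -> cdom c x -> {for x, continuous (cmap c)}.
Proof.
move=> hc; have /open_within_continuousP := chart_continuous hc.
by move=> /(_ (chart_open_dom hc)); exact.
Qed.

Lemma cinv_continuous c a : is_chart p c -> cimg c a -> {for a, continuous (cinv c)}.
Proof.
move=> hc; have /open_within_continuousP := chart_continuous_inv hc.
by move=> /(_ (chart_open_img hc)); exact.
Qed.

Lemma chart_open_image c (O : set X) : is_chart p c -> open O ->
  open (cmap c @` (cdom c `&` O)).
Proof.
move=> hc oO.
have -> : cmap c @` (cdom c `&` O) = cimg c `&` cinv c @^-1` O.
  apply/seteqP; split => [_ [x [cx Ox] <-]|a [[x cx <-]]].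
    split; first by exists x.
    by rewrite /preimage/= (chart_cancel hc).
  by rewrite /preimage/= (chart_cancel hc)// => Ox; exists x.
apply: (open_setI_preimage (chart_open_img hc)) => //.
exact: (chart_continuous_inv hc).
Qed.

Definition chart_restr c (O : set X) : chart R k X Y := Chart (cdom c `&` O) (cmap c) (cinv c).

Lemma chart_restrT c : chart_restr c setT = c.
Proof. by case: c => d f g; rewrite /chart_restr/= setIT. Qed.

Lemma is_chart_chart_restr c O : is_chart p c -> open O -> is_chart p (chart_restr c O).
Proof.
move=> hc oO; split => /=.
- by apply: openI => //; exact: (chart_open_dom hc).
- exact: chart_open_image.
- by apply: continuous_subspaceW (chart_continuous hc) => x [].
- by move=> x [cx _]; exact: (chart_cancel hc).
- by apply: continuous_subspaceW (chart_continuous_inv hc) => _ [x [cx _] <-]; exists x.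
- by move=> x [cx _]; exact: (chart_base hc).
Qed.

(** The sets [U1 * V1] to be tested for the smaller sets are among those tested
    for the larger ones. *)
Lemma C0inf_restr (A1 A2 B1 B2 : set (Y * E)) (f : Y * E -> Y * E) :
  C0inf A1 A2 f -> B1 `<=` A1 -> B2 `<=` A2 -> (forall a, B1 a -> B2 (f a)) ->
  C0inf B1 B2 f.
Proof.
move=> [cf fp hf] B1A B2A fB; split.
- exact: continuous_subspaceW cf.
- by move=> a Ba; split; [exact: fB|have [] := fp a (B1A _ Ba)].
- move=> U1 U2 V1 V2 o1 o2 o3 o4 h1 h2; apply: hf => //.
    exact: subset_trans B1A.
  exact: subset_trans B2A.
Qed.

Lemma compatible_chart_restr c c' O O' : is_chart p c -> is_chart p c' ->
  compatible c c' -> compatible (chart_restr c O) (chart_restr c' O').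
Proof.
move=> hc hc' [fC [g [gC gf fg]]].
pose D := cdom c `&` cdom c'; pose D' := (cdom c `&` O) `&` (cdom c' `&` O').
have D'D : D' `<=` D by move=> x [[? _] [? _]].
rewrite /compatible /chart_restr/= -/D'.
have S1 : cmap c @` D' `<=` cmap c @` D by apply: image_subset.
have S2 : cmap c' @` D' `<=` cmap c' @` D by apply: image_subset.
have fE x : D x -> (cmap c' \o cinv c) (cmap c x) = cmap c' x.
  by move=> [cx _]; rewrite /= (chart_cancel hc).
split.
  apply: (C0inf_restr fC S1 S2) => _ [x D'x <-]; exists x => //.
  by rewrite fE//; exact: D'D.
exists g; split.
- apply: (C0inf_restr gC S2 S1) => _ [x D'x <-]; exists x => //.
  by rewrite -fE ?gf//; [exists x => //|]; exact: D'D.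
- by move=> a /S1; exact: gf.
- by move=> a /S2; exact: fg.
Qed.

(** The restrictions to open sets of the charts of an atlas are again an atlas, and a
    larger one; by maximality they were there from the start. *)
Lemma maximal_chart_restr (A : set (chart R k X Y)) c O :
  continuous_family p A -> A c -> open O -> A (chart_restr c O).
Proof.
move=> [_ hA maxA] Ac oO.
apply: (maxA [set c' | exists c0 Q0, [/\ A c0, open Q0 & c' = chart_restr c0 Q0]]).
- split.
  + move=> _ [c0 [Q0 [Ac0 oQ0 ->]]]; apply: is_chart_chart_restr => //.
    exact: (atlas_chart hA).
  + move=> x; have [c0 Ac0 c0x] := atlas_cover hA x.
    by exists c0 => //; exists c0, setT; split; [|exact: openT|rewrite chart_restrT].
  + move=> _ _ [c0 [Q0 [Ac0 oQ0 ->]]] [c1 [Q1 [Ac1 oQ1 ->]]].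
    by apply: compatible_chart_restr; [exact: (atlas_chart hA)..|exact: (atlas_compatible hA)].
- by move=> c0 Ac0; exists c0, setT; split; [|exact: openT|rewrite chart_restrT].
- by exists c, O.
Qed.

Lemma open_setX {S T : topologicalType} (U : set S) (V : set T) :
  open U -> open V -> open (U `*` V).
Proof.
rewrite !openE => oU oV [x y] [/= Ux Vy].
by exists (U, V) => //=; split; [exact: oU|exact: oV].
Qed.

Lemma open_prod_box {S T : topologicalType} (O : set (S * T)) s t :
  open O -> O (s, t) -> exists U V, [/\ open U, open V, U s, V t & U `*` V `<=` O].
Proof.
move=> oO Ost; have [[P Q] [/= Ps Qt] PQ] : nbhs (s, t) O by exact: open_nbhs_nbhs.
exists P°, Q°; split => //; [exact: open_interior..|].
by move=> [x y] [/= /interior_subset Px /interior_subset Qy]; exact: PQ.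
Qed.

(** The definition of a morphism only speaks of charts onto products; this
    provides such charts around every point. *)
Lemma product_chart_chart_restr (A : set (chart R k X Y)) c x :
  continuous_family p A -> A c -> cdom c x ->
  exists O W, [/\ open O, A (chart_restr c O), product_chart p (chart_restr c O) W & O x].
Proof.
move=> hA Ac cx; have [_ /atlas_chart/(_ c Ac) hc _] := hA.
have ci : cimg c (p x, (cmap c x).2) by rewrite -chart_mapE//; exists x.
have [U [W [oU oW Ux Wx UW]]] := open_prod_box (chart_open_img hc) ci.
pose O := cdom c `&` cmap c @^-1` (U `*` W).
have oO : open O.
  apply: (open_setI_preimage (chart_open_dom hc) (chart_continuous hc)).
  exact: open_setX.
exists O, W; split => //; first exact: (maximal_chart_restr hA Ac oO).
  split => //; apply/seteqP; split => [_ [z [cz [_ [Uz Wz]]] <-]|[y w] /=].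
    split; last exact: Wz.
    exists z; first by split => //; split => //; split.
    by rewrite (chart_base hc).
  move=> [[z [cz [_ [Uz Wz]]] <-] Ww].
  have Uw : (U `*` W) (p z, w) by split => //=; rewrite -(chart_base hc).
  have [h1 h2] := chart_inv_in hc (UW _ Uw).
  exists (cinv c (p z, w)) => //; split => //; split => //.
  by rewrite /preimage/= h2.
split => //; split; last exact: Wx.
by rewrite (chart_base hc).
Qed.

End charts.

(** * Left translations in charts *)

Lemma continuous_pair (S T1 T2 : topologicalType) (f : S -> T1) (g : S -> T2) s :
  {for s, continuous f} -> {for s, continuous g} ->
  {for s, continuous (fun x => (f x, g x))}.
Proof. by move=> cf cg; exact: (cvg_pair cf cg). Qed.

Lemma continuous_fst (S T : topologicalType) : continuous (@fst S T).
Proof. by move=> x; exact: cvg_fst. Qed.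

Lemma continuous_snd (S T : topologicalType) : continuous (@snd S T).
Proof. by move=> x; exact: cvg_snd. Qed.

Section translations_in_charts.
Context {R : realType} {k : nat} (G : groupoid).
Local Notation E := 'rV[R]_k.
Variables As Ar : set (chart R k G (units G)).
Hypothesis hG : continuous_family_groupoid As Ar.
Implicit Types (b c : chart R k G (units G)) (x y z : G) (w : E).

Lemma range_chart c : Ar c -> is_chart (@rmap G) c.
Proof. by case: (cfg_range hG) => _ /atlas_chart h _; exact: h. Qed.

Lemma rmap_continuous : continuous (@rmap G).
Proof. by case: (cfg_range hG) => /fs_continuous. Qed.

Lemma smap_continuous : continuous (@smap G).
Proof. by case: (cfg_source hG) => /fs_continuous. Qed.

Lemma grange_continuous : continuous (@grange G).
Proof.
move=> x; apply: (@continuous_comp _ _ _ (@rmap G) (fun u => \val u)); first exact: rmap_continuous.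
exact: set_val_continuous.
Qed.

Lemma gsource_continuous : continuous (@gsource G).
Proof.
move=> x; apply: (@continuous_comp _ _ _ (@smap G) (fun u => \val u)); first exact: smap_continuous.
exact: set_val_continuous.
Qed.

Lemma gmult_continuous : continuous (@gmult G).
Proof. by case: (cfg_locally_compact hG). Qed.

(** The multiplication is continuous as a map on composable pairs.  This lemma
    allows to use it on pairs that are known to be composable only nearby. *)
Lemma comp_pair_continuous (T : topologicalType) (f h : T -> G) t :
  {for t, continuous f} -> {for t, continuous h} ->
  (\forall u \near t, gsource (f u) = grange (h u)) ->
  {for t, continuous (fun u => comp_pair (f u) (h u))}.
Proof.
move=> cf ch fh; apply: continuous_to_subtype.
have cp : (fun u => (f u, h u)) @ t --> (f t, h t) by exact: cvg_pair.
rewrite /prop_for /continuous_at comp_pairE; last exact: nbhs_singleton fh.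
apply: cvg_trans cp; apply: near_eq_cvg; apply: filterS fh => u fhu.
by rewrite comp_pairE.
Qed.

(** Left translation by [x], read in the charts [b] and [c]; for a unit [x]
    this is the change of charts on a fiber. *)
Definition trans b c x w : E := (cmap c (gmul x (cinv b (smap x, w)))).2.

Definition trans_dom b c : set (G * E) := [set a | cimg b (smap a.1, a.2) /\
  cdom c (gmul a.1 (cinv b (smap a.1, a.2)))].

Let base_inv b x w : Ar b -> cimg b (smap x, w) ->
  gsource x = grange (cinv b (smap x, w)).
Proof.
by move=> Ab bw; have := chart_base_inv (range_chart Ab) bw => /(congr1 val).
Qed.

Lemma cinv_cmap b x y : Ar b -> cdom b y -> gsource x = grange y ->
  cinv b (smap x, (cmap b y).2) = y.
Proof.
move=> Ab hy xy; have -> : (smap x, (cmap b y).2) = cmap b y.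
  by rewrite [RHS](chart_mapE (range_chart Ab) hy); congr (_, _); exact: val_inj.
exact: (chart_cancel (range_chart Ab)).
Qed.

Lemma cimg_cmap b x y : Ar b -> cdom b y -> gsource x = grange y ->
  cimg b (smap x, (cmap b y).2).
Proof.
move=> Ab hy xy; exists y => //; rewrite (chart_mapE (range_chart Ab) hy).
by congr (_, _); exact: val_inj.
Qed.

Lemma transE b c x y : Ar b -> cdom b y -> gsource x = grange y ->
  trans b c x (cmap b y).2 = (cmap c (gmul x y)).2.
Proof. by move=> Ab hy xy; rewrite /trans cinv_cmap. Qed.

Lemma trans_domE b c x y : Ar b -> cdom b y -> gsource x = grange y ->
  cdom c (gmul x y) -> trans_dom b c (x, (cmap b y).2).
Proof.
by move=> Ab hy xy hc; split => /=; [exact: cimg_cmap|rewrite cinv_cmap].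
Qed.

Lemma trans_domP b c x w : Ar b -> trans_dom b c (x, w) ->
  exists y, [/\ cdom b y, gsource x = grange y, w = (cmap b y).2 & cdom c (gmul x y)].
Proof.
move=> Ab [/= bw cw]; have [h1 h2] := chart_inv_in (range_chart Ab) bw.
by exists (cinv b (smap x, w)); split => //; [exact: base_inv|rewrite h2].
Qed.

Let lift_continuous b x w : Ar b -> cimg b (smap x, w) ->
  {for (x, w), continuous (fun a : G * E => cinv b (smap a.1, a.2))}.
Proof.
move=> Ab bw.
apply: (@continuous_comp _ _ _ (fun a : G * E => (smap a.1, a.2)) (cinv b)).
  apply: continuous_pair; last exact: continuous_snd.
  apply: (@continuous_comp _ _ _ fst (@smap G)); last exact: smap_continuous.
  exact: continuous_fst.
exact: cinv_continuous (range_chart Ab) bw.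
Qed.

Let near_cimg b x w : Ar b -> cimg b (smap x, w) ->
  \forall a \near (x, w), cimg b (smap a.1, a.2).
Proof.
move=> Ab bw.
have cs : {for (x, w), continuous (fun a : G * E => (smap a.1, a.2))}.
  apply: continuous_pair; last exact: continuous_snd.
  apply: (@continuous_comp _ _ _ fst (@smap G)); last exact: smap_continuous.
  exact: continuous_fst.
by apply: cs; apply: open_nbhs_nbhs; split => //; exact: chart_open_img (range_chart Ab).
Qed.

Let pair_continuous b x w : Ar b -> cimg b (smap x, w) ->
  {for (x, w), continuous (fun a : G * E => comp_pair a.1 (cinv b (smap a.1, a.2)))}.
Proof.
move=> Ab bw; apply: comp_pair_continuous.
- exact: continuous_fst.
- exact: lift_continuous.
- by apply: filterS (near_cimg Ab bw) => -[x' w'] /= bw'; exact: base_inv.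
Qed.

Lemma mul_lift_continuous b x w : Ar b -> cimg b (smap x, w) ->
  {for (x, w), continuous (fun a : G * E => gmul a.1 (cinv b (smap a.1, a.2)))}.
Proof.
move=> Ab bw.
have cm : {for (x, w), continuous (fun a : G * E =>
    gmult (comp_pair a.1 (cinv b (smap a.1, a.2))))}.
  apply: (@continuous_comp _ _ _ (fun a : G * E => comp_pair a.1 (cinv b (smap a.1, a.2))) (@gmult G)).
    exact: pair_continuous.
  exact: gmult_continuous.
move: cm; rewrite /prop_for /continuous_at gmult_comp_pair; last exact: base_inv.
apply: cvg_trans; apply: near_eq_cvg.
apply: filterS (near_cimg Ab bw) => -[x' w'] /= bw'.
by rewrite gmult_comp_pair//; exact: base_inv.
Qed.

Lemma trans_dom_open b c : Ar b -> Ar c -> open (trans_dom b c).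
Proof.
move=> Ab Ac; rewrite openE => -[x w] [/= bw cw].
apply: filterI; first exact: near_cimg.
apply: (mul_lift_continuous Ab bw); apply: open_nbhs_nbhs; split => //.
exact: chart_open_dom (range_chart Ac).
Qed.

(** The charts that generate the atlas of the space of composable pairs, with
    an explicit inverse. *)
Definition comp_chart b : chart R k (composable G) G := Chart
  [set p : composable G | cdom b (\val p).2]
  (fun p : composable G => ((\val p).1, (cmap b (\val p).2).2))
  (fun a => comp_pair a.1 (cinv b (smap a.1, a.2))).

Let comp_chart_cancel b (p : composable G) : Ar b -> cdom b (\val p).2 ->
  comp_pair (\val p).1 (cinv b (smap (\val p).1, (cmap b (\val p).2).2)) = p.
Proof.
by move=> Ab hp; rewrite cinv_cmap ?composableP// comp_pair_val.
Qed.

Lemma cimg_comp_chart b : Ar b -> cimg (comp_chart b) = [set a | cimg b (smap a.1, a.2)].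
Proof.
move=> Ab; apply/seteqP; split => [_ [p /= hp <-]/=|[x w] /= bw].
  by apply: cimg_cmap => //; exact: composableP.
have [h1 h2] := chart_inv_in (range_chart Ab) bw; have xy := base_inv Ab bw.
have e := comp_pairE xy; exists (comp_pair x (cinv b (smap x, w))).
  by change (cdom b (\val (comp_pair x (cinv b (smap x, w)))).2); rewrite e.
change (((\val (comp_pair x (cinv b (smap x, w)))).1,
  (cmap b (\val (comp_pair x (cinv b (smap x, w)))).2).2) = (x, w)).
by rewrite e/= h2.
Qed.

Lemma is_chart_comp_chart b : Ar b -> is_chart (@t1 G) (comp_chart b).
Proof.
move=> Ab.
have c2 : continuous (fun p : composable G => (\val p).2).
  move=> p; apply: (@continuous_comp _ _ _ (fun p : composable G => \val p) snd); last exact: continuous_snd.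
  exact: set_val_continuous.
have c1 : continuous (fun p : composable G => (\val p).1).
  move=> p; apply: (@continuous_comp _ _ _ (fun p : composable G => \val p) fst); last exact: continuous_fst.
  exact: set_val_continuous.
have oD : open (cdom (comp_chart b)).
  by apply: open_comp => [p _|]; [exact: c2|exact: chart_open_dom (range_chart Ab)].
have oI : open (cimg (comp_chart b)).
  by rewrite cimg_comp_chart// openE => -[x w] /= bw; exact: near_cimg.
split => //.
- apply/(open_within_continuousP _ oD) => p hp.
  apply: continuous_pair; first exact: c1.
  apply: (@continuous_comp _ _ _ (fun p : composable G => (\val p).2) (fun z => (cmap b z).2)); first exact: c2.
  apply: (@continuous_comp _ _ _ (cmap b) snd); last exact: continuous_snd.
  exact: cmap_continuous (range_chart Ab) hp.
- by move=> p hp; exact: comp_chart_cancel.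
- apply/(open_within_continuousP _ oI) => -[x w].
  by rewrite cimg_comp_chart// => bw; exact: pair_continuous.
Qed.

End translations_in_charts.

Section smoothness_of_translations.
Context {R : realType} {k : nat} (G : groupoid).
Local Notation E := 'rV[R]_k.
Variables As Ar : set (chart R k G (units G)).
Hypothesis hG : continuous_family_groupoid As Ar.
Implicit Types (b c : chart R k G (units G)) (x y z : G) (w : E).

Local Notation gchart := (range_chart hG).

(** Membership in [C0inf] is tested on products of open sets, and these form a
    basis of neighborhoods. *)
Lemma C0inf_strict_diff (Y : topologicalType) (A1 A2 : set (Y * E))
    (f : Y * E -> Y * E) t w :
  open A1 -> open A2 -> C0inf A1 A2 f -> A1 (t, w) ->
  exists A, strict_diff_family (fun t w => (f (t, w)).2) t w A.
Proof.
move=> oA1 oA2 [cf fp hf] Atw.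
have [A2f ft] := fp _ Atw.
rewrite (surjective_pairing (f (t, w))) ft in A2f.
have [U2 [V2 [oU2 oV2 U2t V2w UV2]]] := open_prod_box oA2 A2f.
have oP : open (A1 `&` f @^-1` (U2 `*` V2)).
  by apply: open_setI_preimage => //; exact: open_setX.
have Ptw : (A1 `&` f @^-1` (U2 `*` V2)) (t, w).
  by split => //; split => //=; rewrite ft.
have [U1 [V1 [oU1 oV1 U1t V1w UV1]]] := open_prod_box oP Ptw.
have hC : continuous_into_Cinf U1 V1 V2 (fun t w => (f (t, w)).2).
  apply: (hf U1 U2 V1 V2) => //.
    by move=> a /UV1[].
  by move=> _ [a /UV1[_ fa] <-].
exact: continuous_into_Cinf_strict_diff oU1 oV1 hC U1t V1w.
Qed.

Lemma near_prod_strict (Y : topologicalType) (t : Y) w (P : Y * E -> Prop) :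
  (\forall a \near (t, w), P a) -> exists2 d : R, 0 < d &
  \forall s \near t, forall v, `|v - w| < d -> P (s, v).
Proof.
move=> [[U V] [/= Ut /nbhs_ballP[d d0 dV]] UV]; exists d => //.
apply: filterS Ut => s Us v vw; apply: UV; split => //; apply: dV.
by rewrite -ball_normE/= distrC.
Qed.

Lemma near_prod_continuous (Y : topologicalType) (t : Y) w (f : Y -> E -> E) :
  {for (t, w), continuous (fun a : Y * E => f a.1 a.2)} ->
  forall e : R, 0 < e -> exists2 d : R, 0 < d &
  \forall s \near t, forall v, `|v - w| < d -> `|f s v - f t w| < e.
Proof.
move=> cf e e0; apply: (near_prod_strict (P := fun a => `|f a.1 a.2 - f t w| < e)).
have /cvgrPdist_lt/(_ e e0) := cf.
by apply: filterS => a; rewrite distrC.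
Qed.

(** The morphism property of the multiplication describes it in some chart [c1]
    of the maximal atlas of the composable pairs.  The chart [comp_chart b] is
    compatible with [c1], so that [trans b c] is the composition of a change of
    charts of class [C0inf] and of the local form of the multiplication in [c1]. *)
Lemma trans_strict_diff b c x w : Ar b -> Ar c -> trans_dom b c (x, w) ->
  exists A, strict_diff_family (trans b c) x w A.
Proof.
move=> Ab Ac bcxw.
have [y [hy xy wE hz]] := trans_domP hG Ab bcxw.
have [Q [W2 [oQ Ac' pc' Qz]]] := product_chart_chart_restr (cfg_range hG) Ac hz.
pose c' := chart_restr c Q; pose p := comp_pair x y.
have pE : \val p = (x, y) by exact: comp_pairE.
have c'p : cdom c' (gmult p) by rewrite /p gmult_comp_pair.
have [c1 [W1 [Ac1 [oW1 pc1] c1p im1 hC1]]] := mor_local (cfg_mul hG) Ac' pc' c'p.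
have [hc1 comp1] := Ac1.
have hb := is_chart_comp_chart hG Ab.
have := comp1 (comp_chart b) (conj hb (ex_intro _ b (And3 Ab erefl (fun _ _ => erefl)))).
set D := cdom c1 `&` cdom (comp_chart b).
have Dp : D p by split => //; change (cdom b (\val p).2); rewrite pE.
have oD1 : open (cmap c1 @` D) by apply: chart_open_image hc1 _; exact: chart_open_dom hb.
have oDb : open (cmap (comp_chart b) @` D).
  by rewrite /D setIC; apply: chart_open_image hb _; exact: chart_open_dom hc1.
move=> [_ [g [gC gf _]]].
have gE q : D q -> g (cmap (comp_chart b) q) = cmap c1 q.
  move=> Dq; have [c1q _] := Dq.
  by have := gf (cmap c1 q); rewrite /= (chart_cancel hc1)//; apply; exists q.
have cbp : cmap (comp_chart b) p = (x, w).
  by change (((\val p).1, (cmap b (\val p).2).2) = (x, w)); rewrite pE wE.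
have Dxw : (cmap (comp_chart b) @` D) (x, w) by exists p.
have [B gB] := C0inf_strict_diff oDb oD1 gC Dxw.
pose v := (cmap c1 p).2.
have c1pE : cmap c1 p = (x, v).
  by rewrite (chart_mapE hc1 c1p) /t1 pE.
have gxw : g (x, w) = (x, v) by rewrite -cbp gE.
have W1v : W1 v.
  have : cimg c1 (x, v) by exists p.
  by rewrite pc1 => -[].
have oU1 : open (@t1 G @` cdom c1).
  have oI := chart_open_img hc1.
  rewrite openE => _ [q c1q <-].
  have cq : cimg c1 (t1 q, (cmap c1 q).2) by rewrite -(chart_mapE hc1)//; exists q.
  have [U [V [oU oV Uq Vq UV]]] := open_prod_box oI cq.
  apply: (@filterS _ _ _ U); last exact: open_nbhs_nbhs.
  move=> u Uu; have : cimg c1 (u, (cmap c1 q).2) by apply: UV.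
  by rewrite pc1 => -[].
have U1x : (@t1 G @` cdom c1) x by exists p => //; rewrite /t1 pE.
have [A hA] := continuous_into_Cinf_strict_diff oU1 oW1 hC1 U1x W1v.
exists (B *m A).
have hcomp : strict_diff_family (fun x w => local_rep c1 c' (@gmult G) x (g (x, w)).2) x w (B *m A).
  apply: (strict_diff_comp gB); first by rewrite gxw.
  apply: (@near_prod_continuous G x w (fun x w => (g (x, w)).2)).
  case: gC => cg _ _.
  apply: (@continuous_comp _ _ _ (fun a : G * E => g (a.1, a.2)) snd); last exact: continuous_snd.
  have /(open_within_continuousP _ oDb)/(_ _ Dxw) := cg.
  rewrite (_ : (fun a : G * E => g (a.1, a.2)) = g)//.
  by apply/funext => -[].
apply: strict_diff_eq hcomp.
apply: (near_prod_strict (P := fun a => local_rep c1 c' (@gmult G) a.1 (g (a.1, a.2)).2 = trans b c a.1 a.2)).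
apply: (@filterS _ (nbhs (x, w)) _ (cmap (comp_chart b) @` D)); last exact: open_nbhs_nbhs.
move=> _ [q Dq <-]; rewrite -surjective_pairing gE//.
have [c1q bq] := Dq.
rewrite /local_rep (_ : ((cmap (comp_chart b) q).1, (cmap c1 q).2) = cmap c1 q); last first.
  by rewrite [RHS](chart_mapE hc1 c1q).
rewrite (chart_cancel hc1)//=.
by rewrite (transE hG)//; exact: composableP.
Qed.

End smoothness_of_translations.

(** * Jacobians of left translations *)

Section jacobians.
Context {R : realType} {k : nat} (G : groupoid).
Local Notation E := 'rV[R]_k.
Local Notation lam := (lebesgue_rV k : {measure set (borel 'rV[R]_k) -> \bar R}).
Variables As Ar : set (chart R k G (units G)).
Hypothesis hG : continuous_family_groupoid As Ar.
Implicit Types (b c d : chart R k G (units G)) (x y z : G) (w : E).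

(** By [strict_diff_unique] there is at most one derivative to choose from. *)
Definition jac b c x w : 'M[R]_k := xget 0 [set A | strict_diff (trans b c x) w A].

(** The inverse of the absolute value of the Jacobian determinant of a left
    translation read in charts. *)
Definition inv_jacobian b c x w : R := vol_factor (jac b c x w).

Lemma jacE b c x w A : strict_diff (trans b c x) w A -> jac b c x w = A.
Proof.
move=> hA; apply: (strict_diff_unique _ hA).
by apply: (@xgetPex _ 0 [set A | strict_diff (trans b c x) w A]); exists A.
Qed.

Lemma jacP b c x w : Ar b -> Ar c -> trans_dom b c (x, w) ->
  strict_diff_family (trans b c) x w (jac b c x w).
Proof.
move=> Ab Ac h; have [A hA] := trans_strict_diff hG Ab Ac h.
by rewrite (jacE (strict_diff_of_family hA)).
Qed.

Lemma jac_strict_diff b c x w : Ar b -> Ar c -> trans_dom b c (x, w) ->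
  strict_diff (trans b c x) w (jac b c x w).
Proof. by move=> Ab Ac h; exact: strict_diff_of_family (jacP Ab Ac h). Qed.

Lemma trans_inv b c x w : Ar b -> Ar c -> trans_dom b c (x, w) ->
  trans_dom c b (ginv x, trans b c x w) /\ trans c b (ginv x) (trans b c x w) = w.
Proof.
move=> Ab Ac h; have [y [hy xy -> hz]] := trans_domP hG Ab h.
have rz : gsource (ginv x) = grange (gmul x y).
  by rewrite gsource_inv grange_mul.
rewrite (transE hG)//; split.
  by apply: (trans_domE hG) => //; rewrite gmulKV.
by rewrite (transE hG)// gmulKV.
Qed.

Lemma trans_section_open b c x : Ar b -> Ar c -> open [set w | trans_dom b c (x, w)].
Proof.
move=> Ab Ac; apply: (open_comp _ (trans_dom_open hG Ab Ac)) => w _.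
exact: (@continuous_pair _ _ _ (fun=> x) (fun v : E => v) w (@cst_continuous _ _ x w) (fun Q h => h)).
Qed.

Lemma open_rV_ball (U : set E) w : open U -> U w ->
  exists2 e : R, 0 < e & forall v : E, `|v - w| < e -> U v.
Proof.
move=> oU Uw; have /nbhs_ballP[e e0 eU] : nbhs w U by exact: open_nbhs_nbhs.
by exists e => // v vw; apply: eU; rewrite -ball_normE/= distrC.
Qed.

(** The inverse of a left translation is a left translation, hence strictly
    differentiable. *)
Lemma jac_unit b c x w : Ar b -> Ar c -> trans_dom b c (x, w) ->
  jac b c x w \in unitmx.
Proof.
move=> Ab Ac h; have [h' _] := trans_inv Ab Ac h.
have [] // := @mulmx1_unit _ _ (jac b c x w) (jac c b (ginv x) (trans b c x w)).
apply: (strict_diff_inverse (jac_strict_diff Ab Ac h) (jac_strict_diff Ac Ab h')).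
have [e e0 he] := open_rV_ball (trans_section_open (x := x) Ab Ac) h.
by exists e => // v /he hv; have [] := trans_inv Ab Ac hv.
Qed.

Lemma inv_jacobian_gt0 b c x w : Ar b -> Ar c -> trans_dom b c (x, w) -> 0 < inv_jacobian b c x w.
Proof. by move=> Ab Ac h; apply: vol_factor_gt0; exact: jac_unit. Qed.

Lemma trans_comp b c d x y w : Ar b -> Ar c -> Ar d -> gsource x = grange y ->
  trans_dom b c (y, w) -> trans_dom c d (x, trans b c y w) ->
  trans_dom b d (gmul x y, w) /\ trans b d (gmul x y) w = trans c d x (trans b c y w).
Proof.
move=> Ab Ac Ad xy h; have [z [hz yz -> hyz]] := trans_domP hG Ab h.
rewrite (transE hG)// => h'.
have xyz : gsource x = grange (gmul y z) by rewrite grange_mul.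
have hxyz : cdom d (gmul x (gmul y z)).
  by have [_] := h'; rewrite /= (cinv_cmap hG).
rewrite gmulA// in hxyz.
have sxy : gsource (gmul x y) = grange z by rewrite gsource_mul.
split; first exact: (trans_domE hG).
by rewrite !(transE hG)// gmulA.
Qed.

(** The chain rule for the composition of two left translations. *)
Lemma inv_jacobian_comp b c d x y w : Ar b -> Ar c -> Ar d -> gsource x = grange y ->
  trans_dom b c (y, w) -> trans_dom c d (x, trans b c y w) ->
  inv_jacobian b d (gmul x y) w = inv_jacobian b c y w * inv_jacobian c d x (trans b c y w).
Proof.
move=> Ab Ac Ad xy h h'; rewrite -vol_factor_mulmx; [|exact: jac_unit..].
congr vol_factor; apply: jacE; apply/(strict_diff_cst (0 : R)).
have sd1 := jac_strict_diff Ab Ac h.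
have cb : {for w, continuous (trans b c y)} := strict_diff_continuous sd1.
apply: (@strict_diff_eq _ _ _ (fun=> trans c d x \o trans b c y)); last first.
  apply: (@strict_diff_comp _ _ _ (fun=> trans b c y) (fun=> trans c d x)).
  - exact/strict_diff_cst.
  - by apply/strict_diff_cst; exact: jac_strict_diff.
  - move=> e e0; have /cvgrPdist_lt/(_ e e0)/nbhs_ballP[r r0 hr] := cb.
    exists r => //; apply: (@filterE _ (nbhs (0 : R))) => _ v vw; rewrite distrC; apply: hr.
    by rewrite -ball_normE/= distrC.
have near1 : \forall v \near w, trans_dom b c (y, v).
  by apply: (open_nbhs_nbhs (conj (trans_section_open (x := y) Ab Ac) h)).
have near2 : \forall v \near w, trans_dom c d (x, trans b c y v).
  by apply: (cb [set v | trans_dom c d (x, v)]); exact: (open_nbhs_nbhs (conj (trans_section_open (x := x) Ac Ad) h')).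
have /nbhs_ballP[e e0 he] : nbhs w [set v | trans_dom b c (y, v) /\ trans_dom c d (x, trans b c y v)].
  exact: filterI near1 near2.
exists e => //; apply: (@filterE _ (nbhs (0 : R))) => _ v vw.
have [h1 h2] : trans_dom b c (y, v) /\ trans_dom c d (x, trans b c y v).
  by apply: he; rewrite -ball_normE/= distrC.
by have [_ ->] := trans_comp Ab Ac Ad xy h1 h2.
Qed.

Lemma inv_jacobian_continuous b c x w : Ar b -> Ar c -> trans_dom b c (x, w) ->
  {for (x, w), continuous (fun a : G * E => inv_jacobian b c a.1 a.2)}.
Proof.
move=> Ab Ac h; apply/(@cvgrPdist_le _ _ _ (nbhs (x, w))) => e e0.
have [r r0 hr] := vol_factor_continuous (jac_unit Ab Ac h) e0.
have [r' r'0 hr'] := strict_diff_near (jacP Ab Ac h) r0.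
have hd : \forall a \near (x, w), trans_dom b c a.
  exact: (open_nbhs_nbhs (conj (trans_dom_open hG Ab Ac) h)).
have h1 : \forall a \near (x, w), forall B, strict_diff (trans b c a.1) a.2 B -> `|B - jac b c x w| <= r.
  exists ([set t | forall (b0 : E) (B : 'M[R]_k), `|b0 - w| < r' -> strict_diff (trans b c t) b0 B -> `|B - jac b c x w| <= r], ball w r').
    by split => //=; exact: nbhsx_ballx.
  move=> [t v] [/= ht]; rewrite -ball_normE/= distrC => hv B.
  exact: ht.
apply: filterS (filterI hd h1) => -[t v] [/= tv ht].
rewrite distrC; apply: hr; first exact: jac_unit.
by apply: ht; exact: jac_strict_diff.
Qed.

Lemma trans_change_of_variables b c x (F : E -> \bar R) : Ar b -> Ar c ->
  (forall w, 0 <= F w)%E -> measurable_fun setT (F : borel E -> \bar R) ->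
  (\int[lam]_(v in [set v | trans_dom c b (ginv x, v)]) F v =
   \int[lam]_(w in [set w | trans_dom b c (x, w)])
     (F (trans b c x w) * ((inv_jacobian b c x w)^-1)%:E))%E.
Proof.
move=> Ab Ac F0 mF.
have hinv v : trans_dom c b (ginv x, v) ->
    trans_dom b c (x, trans c b (ginv x) v) /\ trans b c x (trans c b (ginv x) v) = v.
  by move=> h; have := trans_inv Ac Ab h; rewrite ginvK.
apply: (@change_of_variables _ _ _ _ (trans b c x) (trans c b (ginv x)) (jac b c x)) => //.
- exact: trans_section_open.
- exact: trans_section_open.
- by move=> w h; have [] := trans_inv Ab Ac h.
- by move=> v /hinv[].
- by move=> w h; have [] := trans_inv Ab Ac h.
- by move=> v /hinv[].
- apply/(open_within_continuousP _ (trans_section_open (x := _) Ac Ab)) => v h.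
  exact: strict_diff_continuous (jac_strict_diff Ac Ab h).
- by move=> w h; exact: jac_strict_diff.
- by move=> w h; exact: jac_unit.
Qed.

End jacobians.

(** * Bump functions and partitions of unity *)

Section bump_functions.
Context {R : realType} {T : topologicalType}.
Hypothesis lcT : locally_compact [set: T].
Hypothesis hT : hausdorff_space T.

Lemma nbhs_compact (x : T) : exists2 K : set T, nbhs x K & compact K /\ closed K.
Proof. by have [K] := lcT I (x := x); rewrite withinET; exists K. Qed.

Record bump_function (O : set T) (f : T -> R) : Prop := Bump {
  bump_continuous : continuous f;
  bump_ge0 : forall x, 0 <= f x;
  bump_le1 : forall x, f x <= 1;
  bump_compact : compact (closure [set x | f x != 0]);
  bump_sub : closure [set x | f x != 0] `<=` O }.

(** Locally compact Hausdorff spaces are completely regular; a cut-off of a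
    separating function is [1] near [x], and not only at [x]. *)
Lemma bump_exists (O : set T) (x : T) : open O -> O x ->
  exists f, bump_function O f /\ \forall y \near x, f y = 1.
Proof.
move=> oO Ox; have [K xK [cK clK]] := nbhs_compact x.
pose O1 := O `&` K°.
have oO1 : open O1 by apply: openI => //; exact: open_interior.
have O1x : O1 x by split.
have crs := @locally_compact_completely_regular T R lcT hT x (~` O1)
  (open_closedC oO1) (fun h => h O1x).
have /(uniform_separatorP (R := R))[g [cg g01 gx0 gO1]] := crs.
have g0 : g x = 0 by apply: gx0; exists x.
have gr y : 0 <= g y <= 1 by have := g01 (g y) (ex_intro2 _ _ y I erefl); rewrite /= in_itv.
(* This is [1] where [g] is at most [1 / 4], and [0] where it is at least [1 / 2]. *)
pose f y := Num.min 1 (Num.max 0 (2 - 4 * g y)).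
have fne y : f y != 0 -> g y <= 2^-1.
  apply: contra_neqT; rewrite -ltNge /f => gy.
  by rewrite max_l ?min_r//; lra.
have clf : closed [set y | g y <= 2^-1].
  apply: (@closed_comp _ _ g [set t : R | t <= 2^-1]); last exact: closed_le.
  by move=> y _; exact: cg.
have sub1 : closure [set y | f y != 0] `<=` [set y | g y <= 2^-1].
  by rewrite [X in _ `<=` X](closure_id _).1//; apply: closureS => y; exact: fne.
have sub2 : [set y | g y <= 2^-1] `<=` O1.
  move=> y /= gy; apply: contrapT => nO1y.
  have : g y = 1 by apply: gO1; exists y.
  lra.
have cf : continuous f.
  move=> y; apply: (@continuous_comp _ _ _ g (fun t : R => Num.min 1 (Num.max 0 (2 - 4 * t)))).
    exact: cg.
  apply: (@continuous_min _ _ (fun=> 1)); first exact: cst_continuous.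
  apply: (@continuous_max _ _ (fun=> 0)); first exact: cst_continuous.
  by apply: (@cvgB _ _ _ (nbhs (g y))); [exact: cvg_cst|apply: cvgMr; exact: cvg_id].
exists f; split; first split => //.
- by move=> y; rewrite /f le_min ler01 le_max lexx.
- by move=> y; rewrite /f ge_min lexx.
- apply: (subclosed_compact _ cK); first exact: closed_closure.
  by move=> y /sub1/sub2[_ /interior_subset].
- by move=> y /sub1/sub2[].
have : \forall y \near x, g y < 4^-1.
  have /cvgrPdist_lt/(_ 4^-1) := cg x; rewrite invr_gt0 => /(_ (ltr0Sn _ _)).
  apply: filterS => y; rewrite g0 sub0r normrN; apply: le_lt_trans; exact: ler_norm.
apply: filterS => y gy; rewrite /f max_r ?min_l//; lra.
Qed.

End bump_functions.

Section partition_of_unity.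
Context {R : realType} {T : Type}.
Variable f : nat -> T -> R.
Hypothesis f0 : forall n x, 0 <= f n x.
Hypothesis f1 : forall n x, f n x <= 1.

(** The telescoping trick that turns a cover by the sets where [f n = 1] into a
    partition of unity: [chi n] vanishes where an earlier [f m] is [1]. *)
Definition chi n x := f n x * \prod_(m < n) (1 - f m x).

Lemma chi_ge0 n x : 0 <= chi n x.
Proof. by rewrite mulr_ge0// prodr_ge0// => m _; rewrite subr_ge0. Qed.

Lemma chi_eq0 m n x : f m x = 1 -> (m < n)%N -> chi n x = 0.
Proof.
by move=> fm mn; rewrite /chi (bigD1 (Ordinal mn))//= fm subrr mul0r mulr0.
Qed.

Lemma chi_neq0 n x : chi n x != 0 -> f n x != 0.
Proof. by apply: contra_neq => h; rewrite /chi h mul0r. Qed.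

Lemma sum_chi N x : \sum_(n < N) chi n x = 1 - \prod_(n < N) (1 - f n x).
Proof.
elim: N => [|N IH]; first by rewrite !big_ord0 subrr.
by rewrite !big_ord_recr/= IH /chi; ring.
Qed.

Lemma sum_chi1 m N x : f m x = 1 -> (m < N)%N -> \sum_(n < N) chi n x = 1.
Proof.
by move=> fm mN; rewrite sum_chi (bigD1 (Ordinal mN))//= fm subrr mul0r subr0.
Qed.

End partition_of_unity.

Lemma chi_continuous {R : realType} {T : topologicalType} (f : nat -> T -> R) n :
  (forall m, continuous (f m)) -> continuous (chi f n).
Proof.
move=> cf x; apply: (@continuousM _ _ (f n)); first exact: cf.
elim: n => [|n IH].
  rewrite (_ : (fun _ => _) = fun=> 1); first exact: cst_continuous.
  by apply/funext => y; rewrite big_ord0.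
rewrite (_ : (fun _ => _) = (fun y => \prod_(m < n) (1 - f m y)) \* (fun y => 1 - f n y)).
  apply: (@continuousM _ _ (fun y => \prod_(m < n) (1 - f m y))) => //.
  by apply: (@cvgB _ _ _ (nbhs x)); [exact: cvg_cst|exact: cf].
by apply/funext => y; rewrite big_ord_recr.
Qed.

(** To each member of a countable basis corresponds, when there is one, some
    function equal to [1] on it; these functions suffice. *)
Lemma countable_family (R : realType) (T : topologicalType) (I : Type)
    (P : T -> I -> Prop) (f : I -> T -> R) (x0 : T) :
  second_countable (T := T) ->
  (forall x : T, exists2 i, P x i & \forall y \near x, f i y = 1) ->
  exists e : nat -> I, (forall n, exists x, P x (e n)) /\
    forall x : T, exists n, \forall y \near x, f (e n) y = 1.
Proof.
move=> [B /countable_injP[h hinj] [oB bB]] hf.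
have [i0 Pi0 _] := hf x0.
pose good n i := (exists x, P x i) /\ exists W, [/\ B W, h W = n & W `<=` [set y | f i y = 1]].
have /choice[e he] : forall n, exists i, (exists x, P x i) /\ ((exists j, good n j) -> good n i).
  move=> n; have [[j gj]|nj] := pselect (exists j, good n j).
    by exists j; split => //; case: gj.
  by exists i0; split => //; exists x0.
exists e; split; first by move=> n; have [] := he n.
move=> x; have [i Pi fi] := hf x.
have [W [BW Wx] Wf] := bB x _ fi.
exists (h W); have [_ [|_ [W' [BW' hW' W'f]]]] := he (h W).
  by exists i; split; [exists x|exists W].
have WW' : W' = W by apply: hinj => //; rewrite inE.
apply: (@filterS _ (nbhs x) _ W); first by move: W'f; rewrite WW'.
exact: (open_nbhs_nbhs (conj (oB _ BW) Wx)).
Qed.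

(** * The invariant density *)

Section haar_density.
Context {R : realType} {k : nat} (G : groupoid).
Local Notation E := 'rV[R]_k.
Variables As Ar : set (chart R k G (units G)).
Hypothesis hG : continuous_family_groupoid As Ar.
Implicit Types (b c d : chart R k G (units G)) (x y z : G) (w : E).

Variables (cs : nat -> chart R k G (units G)) (f : nat -> G -> R).
Hypothesis csA : forall n, Ar (cs n).
Hypothesis fbump : forall n, bump_function (cdom (cs n)) (f n).
Hypothesis fcover : forall z : G, exists n, \forall y \near z, f n y = 1.

Let f0 n x : 0 <= f n x. Proof. exact: bump_ge0 (fbump n) _. Qed.
Let f1 n x : f n x <= 1. Proof. exact: bump_le1 (fbump n) _. Qed.

Lemma f_dom n x : f n x != 0 -> cdom (cs n) x.
Proof. by move=> fx; apply: (bump_sub (fbump n)); exact: subset_closure. Qed.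

Lemma chi_dom n x : chi f n x != 0 -> cdom (cs n) x.
Proof. by move=> h; apply: f_dom; exact: chi_neq0 h. Qed.

Lemma f_eq1 z : exists n, f n z = 1.
Proof. by have [n h] := fcover z; exists n; exact: nbhs_singleton h. Qed.

Definition idx z : nat := proj1_sig (cid (f_eq1 z)).

Lemma idxP z : f (idx z) z = 1.
Proof. exact: proj2_sig (cid (f_eq1 z)). Qed.

Definition dens_term c z n : R :=
  chi f n (gsource z) * inv_jacobian (cs n) c z (cmap (cs n) (gsource z)).2.

(** The invariant density in the chart [c], at the point [z].  The sum stops at
    an index beyond which all [chi n] vanish at [s z]; by [dens_stable] any larger
    bound gives the same value. *)
Definition haar_density c z : R := \sum_(n < (idx (gsource z)).+1) dens_term c z n.

Lemma dens_stable c z m M : f m (gsource z) = 1 -> (m < M)%N ->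
  \sum_(n < M) dens_term c z n = haar_density c z.
Proof.
move=> fm mM; rewrite /haar_density; set i := idx _.
have fi : f i (gsource z) = 1 by exact: idxP.
have widen m' M' : f m' (gsource z) = 1 -> (m' < M')%N -> forall p, (M' <= p)%N ->
    \sum_(n < M') dens_term c z n = \sum_(n < p) dens_term c z n.
  move=> fm' mM' p Mp; rewrite -!(big_mkord xpredT (dens_term c z)).
  rewrite [RHS](@big_cat_nat _ _ _ M')//= [X in _ = _ + X]big1_seq ?addr0//.
  move=> n; rewrite mem_index_iota => /andP[_ /andP[Mn _]].
  by rewrite /dens_term (chi_eq0 fm') ?mul0r// (leq_trans mM').
rewrite (widen _ _ fm mM (maxn M i.+1)) ?leq_maxl//.
by rewrite (widen _ _ fi (ltnSn i) (maxn M i.+1)) ?leq_maxr.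
Qed.

Lemma trans_dom_source n c z : Ar c -> cdom c z -> cdom (cs n) (gsource z) ->
  trans_dom (cs n) c (z, (cmap (cs n) (gsource z)).2).
Proof.
move=> Ac cz nz; apply: (trans_domE hG (csA n)) => //; last by rewrite gmul_source.
by rewrite grange_source.
Qed.

Lemma trans_source n c z : cdom (cs n) (gsource z) ->
  trans (cs n) c z (cmap (cs n) (gsource z)).2 = (cmap c z).2.
Proof.
move=> nz; rewrite (transE hG)//; first by rewrite gmul_source.
by rewrite grange_source.
Qed.

Lemma dens_term_ge0 c z n : Ar c -> cdom c z -> 0 <= dens_term c z n.
Proof.
move=> Ac cz; have [h|h] := eqVneq (chi f n (gsource z)) 0.
  by rewrite /dens_term h mul0r.
rewrite mulr_ge0 ?chi_ge0// ltW//; apply: (inv_jacobian_gt0 hG (csA n) Ac).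
by apply: trans_dom_source => //; exact: chi_dom.
Qed.

Lemma dens_gt0 c z : Ar c -> cdom c z -> 0 < haar_density c z.
Proof.
move=> Ac cz; rewrite lt_neqAle sumr_ge0 ?andbT; last first.
  by move=> n _; exact: dens_term_ge0.
apply/eqP => /esym d0.
have h (n : 'I_(idx (gsource z)).+1) : chi f n (gsource z) = 0.
  have /eqP := d0; rewrite psumr_eq0 => [/allP|i _]; last exact: dens_term_ge0.
  move=> /(_ n); rewrite mem_index_enum => /(_ isT) /=.
  rewrite mulf_eq0 => /orP[/eqP//|]; have [//|chn] := eqVneq (chi f n (gsource z)) 0.
  have kp : 0 < inv_jacobian (cs n) c z (cmap (cs n) (gsource z)).2.
    by apply: (inv_jacobian_gt0 hG (csA n) Ac); apply: trans_dom_source => //; exact: chi_dom.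
  by rewrite gt_eqF.
have := sum_chi1 (idxP (gsource z)) (ltnSn _).
by rewrite big1 => [/eqP|n _]; [rewrite eq_sym oner_eq0|exact: h].
Qed.

(** Left translation by [x] preserves the source [s z], and with it the terms of
    the partition of unity; the Jacobians are related by [inv_jacobian_comp]. *)
Lemma dens_trans c c' x z : Ar c -> Ar c' -> gsource x = grange z ->
  cdom c z -> cdom c' (gmul x z) ->
  haar_density c' (gmul x z) = inv_jacobian c c' x (cmap c z).2 * haar_density c z.
Proof.
move=> Ac Ac' xz cz c'xz; rewrite /haar_density gsource_mul// mulr_sumr.
apply: eq_bigr => n _; rewrite /dens_term gsource_mul//.
have [->|chn] := eqVneq (chi f n (gsource z)) 0; first by rewrite !mul0r mulr0.
have nz := chi_dom chn.
have h1 := trans_dom_source Ac cz nz.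
rewrite (inv_jacobian_comp hG (csA n) Ac Ac' xz h1) trans_source//; last exact: (trans_domE hG Ac).
by rewrite [RHS]mulrCA; congr (_ * _); rewrite mulrC.
Qed.

(** The Jacobian makes sense only when [s z] is in the domain of [cs n]; the
    support of [chi n] is inside this domain, and so the term vanishes near the
    other points. *)
Lemma dens_term_continuous n c z : Ar c -> cdom c z ->
  {for z, continuous (fun y => dens_term c y n)}.
Proof.
move=> Ac cz.
have cS := @gsource_continuous R k G As Ar hG.
have [cl|ncl] := pselect (closure [set x | f n x != 0] (gsource z)); last first.
  have h : \forall y \near z, dens_term c y n = 0.
    have /cS hc : nbhs (gsource z) (~` closure [set x | f n x != 0]).
      apply: open_nbhs_nbhs; split => //; apply: closed_openC; exact: closed_closure.
    apply: (@filterS _ (nbhs z) _ _ _ _ hc) => y /= hy; rewrite /dens_term.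
    suff -> : chi f n (gsource y) = 0 by rewrite mul0r.
    apply/eqP; apply: contrapT => /negP h0; apply: hy; apply: subset_closure; exact: chi_neq0 h0.
  have z0 := nbhs_singleton h.
  rewrite /prop_for /continuous_at z0; apply: cvg_near_cst.
  by apply: filterS h => y ->.
have nz : cdom (cs n) (gsource z) by exact: (bump_sub (fbump n)).
have hd := trans_dom_source Ac cz nz.
apply: (@continuousM _ _ (fun y => chi f n (gsource y))).
  apply: (@continuous_comp _ _ _ (@gsource G) (chi f n)); first exact: cS.
  by apply: chi_continuous => m; exact: bump_continuous (fbump m).
apply: (@continuous_comp _ _ _ (fun y => (y, (cmap (cs n) (gsource y)).2))
  (fun a : G * E => inv_jacobian (cs n) c a.1 a.2)); last exact: (inv_jacobian_continuous hG (csA n) Ac hd).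
apply: (@continuous_pair _ _ _ id); first by move=> Q.
apply: (@continuous_comp _ _ _ (@gsource G) (fun y => (cmap (cs n) y).2)); first exact: cS.
apply: (@continuous_comp _ _ _ (cmap (cs n)) snd); last exact: continuous_snd.
apply: cmap_continuous nz.
by case: (cfg_range hG) => _ /atlas_chart h _; exact: h (csA n).
Qed.

Lemma dens_continuous c z : Ar c -> cdom c z -> {for z, continuous (haar_density c)}.
Proof.
move=> Ac cz; have [m hm] := fcover (gsource z).
have hm' : \forall y \near z, f m (gsource y) = 1.
  exact: (@gsource_continuous R k G As Ar hG z _ hm).
have cs' : {for z, continuous (fun y => \sum_(n < m.+1) dens_term c y n)}.
  rewrite /prop_for /continuous_at; apply: cvg_big => [|n _].
    exact: add_continuous.
  exact: dens_term_continuous.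
have e y : f m (gsource y) = 1 -> \sum_(n < m.+1) dens_term c y n = haar_density c y.
  by move=> fy; apply: dens_stable fy _.
move: cs'; rewrite /prop_for /continuous_at e; last exact: nbhs_singleton hm'.
apply: cvg_trans; apply: near_eq_cvg; apply: filterS hm' => y hy.
by rewrite -e.
Qed.

End haar_density.

(** * Measures on the range fibers *)

Section fibers.
Context (G : groupoid).
Implicit Types (x : G) (u v : units G).

Lemma gfiber_val_continuous u : continuous (@gfiber_val G u).
Proof. exact: (@set_val_continuous G [set z : G | grange z = \val u]). Qed.

Lemma gfiber_range u (z : gfiber u) : grange (gfiber_val z) = \val u.
Proof. exact: set_valP z. Qed.

Lemma gfiber_rmap u (z : gfiber u) : rmap (gfiber_val z) = u.
Proof. by apply: val_inj; exact: gfiber_range. Qed.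

Lemma gfiber_val_inj u : injective (@gfiber_val G u).
Proof. exact: val_inj. Qed.

Definition gfiber_mk u x (h : grange x = \val u) : gfiber u := SigSub (mem_set h).

Lemma continuous_to_gfiber (S : topologicalType) u (f : S -> gfiber u) s :
  {for s, continuous (fun y => gfiber_val (f y))} -> {for s, continuous f}.
Proof. exact: (@continuous_to_subtype G [set z : G | grange z = \val u]). Qed.

Lemma transl_subproof x u v : gsource x = \val u -> grange x = \val v ->
  forall z : gfiber u, grange (gmul x (gfiber_val z)) = \val v.
Proof. by move=> eu ev z; rewrite grange_mul// gfiber_range. Qed.

Definition transl x u v (eu : gsource x = \val u) (ev : grange x = \val v)
  (z : gfiber u) : gfiber v := gfiber_mk (transl_subproof eu ev z).

Lemma translE x u v (eu : gsource x = \val u) (ev : grange x = \val v) z :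
  gfiber_val (transl eu ev z) = gmul x (gfiber_val z).
Proof. by []. Qed.

End fibers.

Section haar_measures.
Context {R : realType} {k : nat} (G : groupoid).
Local Notation E := 'rV[R]_k.
Local Notation lam := (lebesgue_rV k : {measure set (borel 'rV[R]_k) -> \bar R}).
Variables As Ar : set (chart R k G (units G)).
Hypothesis hG : continuous_family_groupoid As Ar.
Implicit Types (b c d : chart R k G (units G)) (x y z : G) (w t : E) (u v : units G).

Variables (cs : nat -> chart R k G (units G)) (f : nat -> G -> R).
Hypothesis csA : forall n, Ar (cs n).
Hypothesis fbump : forall n, bump_function (cdom (cs n)) (f n).
Hypothesis fcover : forall z : G, exists n, \forall y \near z, f n y = 1.
Local Notation dens := (haar_density cs fcover).
Local Notation chi := (chi f).

Local Notation gchart := (range_chart hG).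

Definition fiber_img c u : set E := [set t | cimg c (u, t)].

Lemma slice_continuous u t : {for t, continuous (fun t : E => (u, t))}.
Proof.
exact: (@continuous_pair _ _ _ (fun=> u) (fun v : E => v) t (@cst_continuous _ _ u t) (fun Q h => h)).
Qed.

Lemma fiber_img_open c u : Ar c -> open (fiber_img c u).
Proof.
move=> Ac; apply: (open_comp _ (chart_open_img (gchart Ac))) => t _.
exact: slice_continuous.
Qed.

(** The inverse of the chart [c] on the fiber over [u], with the base point of
    the fiber as a junk value. *)
Definition fiber_inv0 c u t : gfiber u :=
  if pselect (grange (cinv c (u, t)) = \val u) is left h then gfiber_mk h else point.

(** Constant outside of the image of the chart, and therefore measurable. *)
Definition fiber_inv c u : E -> gfiber u := fiber_inv0 c u \_ (fiber_img c u).

Lemma val_fiber_inv0 c u t : Ar c -> cimg c (u, t) ->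
  gfiber_val (fiber_inv0 c u t) = cinv c (u, t).
Proof.
move=> Ac ct; rewrite /fiber_inv0; case: pselect => // h; exfalso; apply: h.
by have := chart_base_inv (gchart Ac) ct => /(congr1 val).
Qed.

Lemma val_fiber_inv c u t : Ar c -> cimg c (u, t) ->
  gfiber_val (fiber_inv c u t) = cinv c (u, t).
Proof.
by move=> Ac ct; rewrite /fiber_inv patchE mem_set// val_fiber_inv0.
Qed.

Lemma fiber_inv_continuous c u t : Ar c -> fiber_img c u t ->
  {for t, continuous (fiber_inv c u)}.
Proof.
move=> Ac ct.
apply: continuous_to_gfiber; rewrite /prop_for /continuous_at val_fiber_inv//.
have : {for t, continuous (fun t : E => cinv c (u, t))}.
  apply: (@continuous_comp _ _ _ (fun t : E => (u, t)) (cinv c)).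
    exact: slice_continuous.
  exact: cinv_continuous (gchart Ac) ct.
have nI : nbhs t (fiber_img c u) by apply: open_nbhs_nbhs; split => //; exact: fiber_img_open.
rewrite /prop_for /continuous_at => h; apply: cvg_trans h; apply: near_eq_cvg.
  exact: (nbhs_filter t).
by apply: (@filterS _ (nbhs t) _ _ _ _ nI) => s cs'; rewrite val_fiber_inv.
Qed.

Lemma measurable_fiber_inv c u : Ar c ->
  measurable_fun setT (fiber_inv c u : borel E -> borel (gfiber u)).
Proof.
move=> Ac; have oI := @fiber_img_open c u Ac.
apply/(@measurable_restrict _ _ (borel E) (borel (gfiber u))) => //.
  exact: open_borel.
rewrite setTI; apply: (@eq_measurable_fun _ _ (borel E) (borel (gfiber u)) _ (fiber_inv c u)).
  by move=> t tI; rewrite /fiber_inv patchE tI.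
apply: (within_continuous_borel oI).
by apply/(open_within_continuousP _ oI) => t ct; exact: fiber_inv_continuous.
Qed.

Definition fiber_dens c u t : R := if t \in fiber_img c u then dens c (cinv c (u, t)) else 0.

Lemma dens_inv_gt0 c u t : Ar c -> cimg c (u, t) -> 0 < dens c (cinv c (u, t)).
Proof.
move=> Ac ct; apply: (dens_gt0 hG csA fbump) => //.
by have [] := chart_inv_in (gchart Ac) ct.
Qed.

Lemma dens_inv_continuous c a : Ar c -> cimg c a ->
  {for a, continuous (fun a => dens c (cinv c a))}.
Proof.
move=> Ac ca; apply: (@continuous_comp _ _ _ (cinv c) (dens c)).
  exact: cinv_continuous (gchart Ac) ca.
apply: (dens_continuous hG csA fbump) => //.
by have [] := chart_inv_in (gchart Ac) ca.
Qed.

Lemma fiber_dens_ge0 c u : Ar c -> forall t, 0 <= fiber_dens c u t.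
Proof.
move=> Ac t; rewrite /fiber_dens; case: ifPn => // /set_mem ct.
exact/ltW/dens_inv_gt0.
Qed.

Lemma measurable_fiber_dens c u : Ar c ->
  measurable_fun setT (fiber_dens c u : borel E -> R).
Proof.
move=> Ac; have oI := @fiber_img_open c u Ac.
have -> : fiber_dens c u = (fun t => dens c (cinv c (u, t))) \_ (fiber_img c u).
  by apply/funext => t; rewrite patchE.
apply/(@measurable_restrict _ _ (borel E)) => //; first exact: open_borel.
rewrite setTI; apply: (within_continuous_measurable oI).
apply/(open_within_continuousP _ oI) => t ct.
apply: (@continuous_comp _ _ _ (fun t : E => (u, t)) (fun a => dens c (cinv c a))).
  exact: slice_continuous.
exact: dens_inv_continuous.
Qed.

(** The part of the Haar measure carried by the domain of the chart [c]. *)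
Definition chart_haar c (Ac : Ar c) u : {measure set (borel (gfiber u)) -> \bar R} :=
  measure_function_pushforward__canonical__measure_function_Measure
    (density lam (@fiber_dens_ge0 c u Ac) (@measurable_fiber_dens c u Ac))
    (@measurable_fiber_inv c u Ac).

Lemma chart_haar_integral c (Ac : Ar c) u (F : gfiber u -> \bar R) :
  (forall p, 0 <= F p)%E -> measurable_fun setT (F : borel (gfiber u) -> \bar R) ->
  (\int[chart_haar Ac u]_p F p =
   \int[lam]_(t in fiber_img c u) (F (fiber_inv c u t) * (dens c (cinv c (u, t)))%:E))%E.
Proof.
move=> F0 mF.
have := ge0_integral_pushforward (@measurable_fiber_inv c u Ac)
  (density lam (@fiber_dens_ge0 c u Ac) (@measurable_fiber_dens c u Ac)) measurableT mF
  (fun p _ => F0 p).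
rewrite preimage_setT ge0_integral_density; last 2 first.
- by move=> t; exact: F0.
- exact: (measurableT_comp mF (@measurable_fiber_inv c u Ac)).
move=> e; rewrite [LHS]e [RHS]integral_mkcond; apply: eq_integral => t _.
by rewrite patchE /fiber_dens; case: ifPn => // _; rewrite mule0.
Qed.

Lemma measurable_transl x u v (eu : gsource x = \val u) (ev : grange x = \val v) :
  measurable_fun setT (transl eu ev : borel (gfiber u) -> borel (gfiber v)).
Proof.
apply: continuous_borel => z; apply: continuous_to_gfiber.
rewrite (_ : (fun y : gfiber u => gfiber_val (transl eu ev y)) =
    (fun y : gfiber u => gmult (comp_pair x (gfiber_val y)))); last first.
  by apply/funext => y; rewrite gmult_comp_pair// gfiber_range.
apply: (@continuous_comp _ _ _ (fun y : gfiber u => comp_pair x (gfiber_val y)) (@gmult G)).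
  apply: comp_pair_continuous; first exact: cst_continuous.
    exact: gfiber_val_continuous.
  by apply: (@filterE _ (nbhs z)) => p; rewrite gfiber_range.
exact: (gmult_continuous hG).
Qed.

(** After the change of variables [trans c c' x], the density on the left becomes the
    density on the right, by [dens_trans].  The condition on [F] says that it lives
    where both charts, one of them translated by [x], are defined. *)
Lemma chart_haar_transl c c' (Ac : Ar c) (Ac' : Ar c') x u v
    (eu : gsource x = \val u) (ev : grange x = \val v) (F : gfiber v -> \bar R) :
  (forall p, 0 <= F p)%E -> measurable_fun setT (F : borel (gfiber v) -> \bar R) ->
  (forall p, F p != 0%E -> cdom c' (gfiber_val p) /\ cdom c (gmul (ginv x) (gfiber_val p))) ->
  (\int[chart_haar Ac' v]_p F p = \int[chart_haar Ac u]_p F (transl eu ev p))%E.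
Proof.
move=> F0 mF Fsupp.
have ux : u = smap x by apply: val_inj; rewrite /= -eu.
have vx : v = smap (ginv x) by apply: val_inj; rewrite val_smap gsource_inv ev.
rewrite !chart_haar_integral//; last first.
  exact: (measurableT_comp mF (measurable_transl eu ev)).
pose V : set E := [set w | trans_dom c c' (x, w)].
pose W : set E := [set t | trans_dom c' c (ginv x, t)].
have oV : open V by exact: (trans_section_open hG Ac Ac').
have oW : open W by exact: (trans_section_open hG Ac' Ac).
have VI : V `<=` fiber_img c u by move=> w [/= + _]; rewrite -ux.
have WI : W `<=` fiber_img c' v by move=> w [/= + _]; rewrite -vx.
pose g' t := (F (fiber_inv c' v t) * (fiber_dens c' v t)%:E)%E.
have mg' : measurable_fun setT (g' : borel E -> \bar R).
  apply: emeasurable_funM.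
    exact: (measurableT_comp mF (@measurable_fiber_inv c' v Ac')).
  by apply/measurable_EFinP; exact: measurable_fiber_dens.
have g'0 t : (0 <= g' t)%E by rewrite mule_ge0// lee_fin fiber_dens_ge0.
transitivity (\int[lam]_(t in W) g' t)%E.
  rewrite [LHS]integral_mkcond [RHS]integral_mkcond; apply: eq_integral => t _.
  rewrite !patchE; have [tW|tW] := boolP (t \in W).
    have tI : t \in fiber_img c' v by apply/mem_set/WI; rewrite -inE.
    by rewrite tI /g' /fiber_dens tI.
  case: ifPn => // /set_mem tI.
  have [->|Fn] := eqVneq (F (fiber_inv c' v t)) 0%E; first by rewrite mul0e.
  exfalso; move/negP: tW; apply; apply/mem_set.
  have [h1 h2] := Fsupp _ Fn; split => /=; first by rewrite -vx.
  by move: h2; rewrite val_fiber_inv// -vx.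
rewrite (trans_change_of_variables hG x Ac Ac' g'0 mg').
rewrite [LHS]integral_mkcond [RHS]integral_mkcond; apply: eq_integral => w _.
rewrite !patchE; have [/set_mem wV|wV] := boolP (w \in V); last first.
  case: ifPn => // /set_mem wI.
  have [->|Fn] := eqVneq (F (transl eu ev (fiber_inv c u w))) 0%E; first by rewrite mul0e.
  exfalso; move/negP: wV; apply; apply/mem_set.
  have [h1 _] := Fsupp _ Fn; split => /=; first by rewrite -ux.
  by move: h1; rewrite translE val_fiber_inv// -ux.
rewrite mem_set; last exact: VI.
have [y [cy xy wE c'xy]] := trans_domP hG Ac wV.
have ryu : rmap y = u by apply: val_inj; rewrite val_rmap -xy eu.
have cinvw : cinv c (u, w) = y by rewrite ux wE (cinv_cmap hG).
have tE : trans c c' x w = (cmap c' (gmul x y)).2 by rewrite wE (transE hG).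
have sxi : gsource (ginv x) = grange (gmul x y) by rewrite gsource_inv grange_mul.
have cimg' : cimg c' (v, trans c c' x w) by rewrite tE vx; exact: (cimg_cmap hG).
have cinv' : cinv c' (v, trans c c' x w) = gmul x y by rewrite tE vx (cinv_cmap hG).
rewrite /g'; have -> : fiber_inv c' v (trans c c' x w) = transl eu ev (fiber_inv c u w).
  apply: gfiber_val_inj; rewrite val_fiber_inv// cinv' translE val_fiber_inv//; last exact: VI.
  by rewrite cinvw.
rewrite /fiber_dens mem_set// cinv' (dens_trans hG csA fbump fcover Ac)// cinvw -muleA -EFinM.
congr (_ * _%:E)%E; rewrite -wE mulrAC divff ?mul1r// gt_eqF//.
exact: (inv_jacobian_gt0 hG).
Qed.

End haar_measures.

(** * The Haar measures *)

Lemma eseries_finite (R : realType) (a : nat -> \bar R) N :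
  (forall n, 0 <= a n)%E -> (forall n, (N <= n)%N -> a n = 0%E) ->
  (\sum_(n <oo) a n = \sum_(n < N) a n)%E.
Proof.
move=> a0 aN; rewrite (@nneseries_split _ a 0 N)// add0n eseries0 ?adde0 ?big_mkord//.
by move=> i Ni _; exact: aN.
Qed.

Section haar_system.
Context {R : realType} {k : nat} (G : groupoid).
Local Notation E := 'rV[R]_k.
Variables As Ar : set (chart R k G (units G)).
Hypothesis hG : continuous_family_groupoid As Ar.

Variables (cs : nat -> chart R k G (units G)) (f : nat -> G -> R).
Hypothesis csA : forall n, Ar (cs n).
Hypothesis fbump : forall n, bump_function (cdom (cs n)) (f n).
Hypothesis fcover : forall z : G, exists n, \forall y \near z, f n y = 1.

Local Notation J Ac u := (chart_haar hG csA fbump fcover Ac u).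
Local Notation Jn n u := (J (csA n) u).

Let f0 n x : 0 <= f n x. Proof. exact: bump_ge0 (fbump n) _. Qed.
Let f1 n x : f n x <= 1. Proof. exact: bump_le1 (fbump n) _. Qed.

Lemma chi_cont n : continuous (chi f n).
Proof. by apply: chi_continuous => m; exact: bump_continuous (fbump m). Qed.

Lemma chi_series z : (\sum_(n <oo) (chi f n z)%:E = 1)%E.
Proof.
have [m fm] := f_eq1 fcover z.
rewrite (@eseries_finite _ _ m.+1) => [|n|n mn].
- by rewrite sumEFin (sum_chi1 fm).
- by rewrite lee_fin chi_ge0.
- by rewrite (chi_eq0 fm).
Qed.

Definition fchi u n (p : gfiber u) : R := chi f n (gfiber_val p).

Lemma fchi_ge0 u n (p : gfiber u) : 0 <= fchi n p.
Proof. exact: chi_ge0. Qed.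

Lemma measurable_fchi u n : measurable_fun setT (fchi n : borel (gfiber u) -> R).
Proof.
have := @within_continuous_measurable (gfiber u) R setT (fchi n) openT; apply.
apply: continuous_subspaceT => p.
apply: (@continuous_comp _ _ _ (@gfiber_val G u) (chi f n)).
  exact: gfiber_val_continuous.
exact: chi_cont.
Qed.

Definition haar_part u n : {measure set (borel (gfiber u)) -> \bar R} :=
  density (Jn n u) (@fchi_ge0 u n) (@measurable_fchi u n).

(** The Haar measure on the fiber over [u], glued from the measures in the charts
    [cs n] by the partition of unity. *)
Definition haar u : {measure set (borel (gfiber u)) -> \bar R} :=
  mseries (haar_part u) 0.

Lemma haar_integral u (F : gfiber u -> R) : (forall p, 0 <= F p) ->
  measurable_fun setT (F : borel (gfiber u) -> R) ->
  (\int[haar u]_p (F p)%:E = \sum_(n <oo) \int[Jn n u]_p (F p * fchi n p)%:E)%E.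
Proof.
move=> F0 mF; have mFE : measurable_fun setT (EFin \o F : borel (gfiber u) -> \bar R).
  exact/measurable_EFinP.
have F0E p : [set: borel (gfiber u)] p -> (0 <= (EFin \o F) p)%E by move=> _; rewrite lee_fin.
transitivity (\sum_(n <oo) \int[haar_part u n]_p (F p)%:E)%E.
  exact: (@ge0_integral_measure_series _ _ R (haar_part u) setT measurableT (EFin \o F) F0E mFE).
apply: eq_eseriesr => n _.
exact: (@ge0_integral_density _ _ R (Jn n u) _ (@fchi_ge0 u n) (@measurable_fchi u n)
  (EFin \o F) (fun p => F0E p I) mFE).
Qed.

(** Splitting [F] with the partition of unity on both sides of the translation
    reduces the equality to [chart_haar_transl], term by term in a double
    series. *)
Lemma haar_transl x u v (eu : gsource x = \val u) (ev : grange x = \val v)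
    (F : gfiber v -> R) : (forall p, 0 <= F p) ->
  measurable_fun setT (F : borel (gfiber v) -> R) ->
  (\int[haar v]_p (F p)%:E = \int[haar u]_p (F (transl eu ev p))%:E)%E.
Proof.
move=> F0 mF.
have mL := measurable_transl hG eu ev.
have mFL : measurable_fun setT (F \o transl eu ev : borel (gfiber u) -> R).
  exact: (measurableT_comp mF mL).
have eu' : gsource (ginv x) = \val v by rewrite gsource_inv.
have ev' : grange (ginv x) = \val u by rewrite grange_inv.
have mL' := measurable_transl hG eu' ev'.
rewrite haar_integral// (haar_integral (F := F \o transl eu ev))//; last by move=> p; exact: F0.
(* The part of [F] in the domain of [cs n] that comes, by translation, from the
   domain of [cs m]. *)
pose K n m p : R := F p * fchi n p * fchi m (transl eu' ev' p).
have K0 n m p : 0 <= K n m p by apply: mulr_ge0; [apply: mulr_ge0; [exact: F0|exact: fchi_ge0]|exact: fchi_ge0].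
have mK n m : measurable_fun setT (K n m : borel (gfiber v) -> R).
  apply: measurable_funM; first by apply: measurable_funM => //; exact: measurable_fchi.
  exact: (measurableT_comp (@measurable_fchi u m) mL').
have mKE n m : measurable_fun setT (EFin \o K n m : borel (gfiber v) -> \bar R).
  exact/measurable_EFinP.
pose K' n m p : R := (F (transl eu ev p) * fchi m p) * fchi n (transl eu ev p).
have K'0 n m p : 0 <= K' n m p by apply: mulr_ge0; [apply: mulr_ge0; [exact: F0|exact: fchi_ge0]|exact: fchi_ge0].
have mK' n m : measurable_fun setT (K' n m : borel (gfiber u) -> R).
  apply: measurable_funM; first by apply: measurable_funM => //; exact: measurable_fchi.
  exact: (measurableT_comp (@measurable_fchi v n) mL).
have mK'E n m : measurable_fun setT (EFin \o K' n m : borel (gfiber u) -> \bar R).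
  exact/measurable_EFinP.
have KK' n m p : K n m (transl eu ev p) = K' n m p.
  rewrite /K /K' mulrAC; congr (_ * _ * _); rewrite /fchi !translE gmulKV//.
  by rewrite gfiber_range.
transitivity (\sum_(n <oo) \sum_(m <oo) \int[Jn n v]_p (K n m p)%:E)%E.
  apply: eq_eseriesr => n _.
  rewrite -(@integral_nneseries _ _ _ (Jn n v) setT _ (fun m => EFin \o K n m))//; last first.
    by move=> m p _; rewrite lee_fin.
  apply: eq_integral => p _ /=; rewrite /K.
  under eq_eseriesr do rewrite EFinM.
  rewrite nneseriesZl; last by move=> m _; rewrite lee_fin fchi_ge0.
  by rewrite chi_series mule1.
transitivity (\sum_(n <oo) \sum_(m <oo) \int[Jn m u]_p (K' n m p)%:E)%E.
  apply: eq_eseriesr => n _; apply: eq_eseriesr => m _.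
  rewrite (@chart_haar_transl _ _ _ _ _ hG _ _ csA fbump fcover _ _ (csA m) (csA n) x u v eu ev
    (EFin \o K n m))//; last 2 first.
  - by move=> p; rewrite lee_fin.
  - move=> p /=; rewrite eqe => KP; split.
      apply: (chi_dom fbump (n := n)); apply: contra_neq KP => c0.
      by rewrite /K [fchi n p]c0 mulr0 mul0r.
    apply: (chi_dom fbump (n := m)); apply: contra_neq KP => c0.
    by rewrite /K [fchi m _]c0 mulr0.
  by apply: eq_integral => p _ /=; rewrite KK'.
rewrite nneseries_interchange; last first.
  by move=> n m; apply: integral_ge0 => p _; rewrite lee_fin.
apply: eq_eseriesr => m _.
rewrite -(@integral_nneseries _ _ _ (Jn m u) setT _ (fun n => EFin \o K' n m))//; last first.
  by move=> n p _; rewrite lee_fin.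
apply: eq_integral => p _ /=; rewrite /K'.
under eq_eseriesr do rewrite EFinM.
rewrite nneseriesZl; last by move=> n _; rewrite lee_fin fchi_ge0.
by rewrite chi_series mule1.
Qed.

(** Translation by the unit [u] is the identity of the fiber, so that
    [chart_haar_transl] compares the measures in the charts [c] and [cs n]. *)
Lemma haar_local c (Ac : Ar c) u (F : gfiber u -> R) : (forall p, 0 <= F p) ->
  measurable_fun setT (F : borel (gfiber u) -> R) ->
  (forall p, F p != 0 -> cdom c (gfiber_val p)) ->
  (\int[haar u]_p (F p)%:E = \int[J Ac u]_p (F p)%:E)%E.
Proof.
move=> F0 mF Fc; rewrite haar_integral//.
have eu : gsource (\val u) = \val u.
  by have [y _ <-] := set_valP u; exact: gsource_range.
have ev : grange (\val u) = \val u.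
  by have [y _ <-] := set_valP u; exact: grange_range.
have Lid p : transl eu ev p = p.
  apply: gfiber_val_inj; rewrite translE -{1}(gfiber_range p) gmul_range//.
have mFn n : measurable_fun setT ((fun p => F p * fchi n p) : borel (gfiber u) -> R).
  by apply: measurable_funM => //; exact: measurable_fchi.
have ginvu p : gmul (ginv (\val u)) (gfiber_val p) = gfiber_val (p : gfiber u).
  have up : gmul (\val u) (gfiber_val p) = gfiber_val p by rewrite -{2}(Lid p).
  by rewrite -{1}up gmulKV// eu gfiber_range.
transitivity (\sum_(n <oo) \int[J Ac u]_p (F p * fchi n p)%:E)%E.
  apply: eq_eseriesr => n _.
  rewrite (@chart_haar_transl _ _ _ _ _ hG _ _ csA fbump fcover _ _ Ac (csA n) (\val u) u u eu ev
    (fun p => (F p * fchi n p)%:E)).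
  - by apply: eq_integral => p _; rewrite Lid.
  - by move=> p; rewrite lee_fin mulr_ge0// fchi_ge0.
  - exact/measurable_EFinP.
  - move=> p; rewrite eqe mulf_eq0 negb_or => /andP[Fp cn].
    by split; [exact: (chi_dom fbump cn)|rewrite ginvu; exact: Fc].
rewrite -(@integral_nneseries _ _ _ (J Ac u) setT _ (fun n p => (F p * fchi n p)%:E))//; last 2 first.
- by move=> n; exact/measurable_EFinP.
- by move=> n p _; rewrite lee_fin mulr_ge0// fchi_ge0.
apply: eq_integral => p _.
under eq_eseriesr do rewrite EFinM.
rewrite nneseriesZl; last by move=> n _; rewrite lee_fin fchi_ge0.
by rewrite chi_series mule1.
Qed.

End haar_system.

(** * Haar measures in charts *)

Section haar_in_charts.
Context {R : realType} {k : nat} (G : groupoid).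
Local Notation E := 'rV[R]_k.
Local Notation lam := (lebesgue_rV k : {measure set (borel 'rV[R]_k) -> \bar R}).
Variables As Ar : set (chart R k G (units G)).
Hypothesis hG : continuous_family_groupoid As Ar.

Variables (cs : nat -> chart R k G (units G)) (f : nat -> G -> R).
Hypothesis csA : forall n, Ar (cs n).
Hypothesis fbump : forall n, bump_function (cdom (cs n)) (f n).
Hypothesis fcover : forall z : G, exists n, \forall y \near z, f n y = 1.

Local Notation haar u := (haar hG csA fbump fcover u).
Local Notation dens := (haar_density cs fcover).

Local Notation gchart := (range_chart hG).

Lemma chart_fiberE c u (p : gfiber u) : Ar c -> cdom c (gfiber_val p) ->
  cmap c (gfiber_val p) = (u, chart_fiber c p).
Proof. by move=> Ac cp; rewrite (chart_mapE (gchart Ac) cp) gfiber_rmap. Qed.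

Lemma fiber_inv_dom c u t : Ar c -> fiber_img c u t ->
  cdom c (gfiber_val (fiber_inv c u t)).
Proof.
move=> Ac ct; rewrite (val_fiber_inv hG Ac ct).
by have [] := chart_inv_in (gchart Ac) ct.
Qed.

Lemma chart_fiberK c u t : Ar c -> fiber_img c u t ->
  chart_fiber c (fiber_inv c u t) = t.
Proof.
move=> Ac ct; rewrite /chart_fiber (val_fiber_inv hG Ac ct).
by have [_ ->] := chart_inv_in (gchart Ac) ct.
Qed.

Lemma chart_fiber_imgE c u : Ar c -> chart_fiber_img c u = fiber_img c u.
Proof.
move=> Ac; apply/seteqP; split => [_ [p cp <-]|t ct].
  by exists (gfiber_val p) => //; exact: chart_fiberE.
by exists (fiber_inv c u t); [exact: fiber_inv_dom|exact: chart_fiberK].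
Qed.

Lemma chart_fiber_dom_open c u : Ar c -> open (@chart_fiber_dom R G k c u).
Proof.
move=> Ac; apply: (open_comp _ (chart_open_dom (gchart Ac))) => p _.
exact: gfiber_val_continuous.
Qed.

Lemma chart_fiber_continuous c u (p : gfiber u) : Ar c -> cdom c (gfiber_val p) ->
  {for p, continuous (@chart_fiber R G k c u)}.
Proof.
move=> Ac cp.
apply: (@continuous_comp _ _ _ (@gfiber_val G u) (fun z => (cmap c z).2)).
  exact: gfiber_val_continuous.
apply: (@continuous_comp _ _ _ (cmap c) snd); last exact: continuous_snd.
exact: cmap_continuous (gchart Ac) cp.
Qed.

Lemma haar_chart c u (B : set (borel E)) : Ar c -> measurable B ->
  B `<=` chart_fiber_img c u ->
  chart_measure c u (fun u => haar u) B =
  (\int[lam]_(t in B) (dens c (cinv c (u, t)))%:E)%E.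
Proof.
move=> Ac mB; rewrite chart_fiber_imgE// => BI.
pose S : set (borel (gfiber u)) := chart_fiber_dom c (u := u) `&` (@chart_fiber R G k c u) @^-1` B.
have oD := chart_fiber_dom_open u Ac.
have mS : measurable S.
  apply: (within_continuous_borel oD) => //; last exact: open_borel.
  by apply/(open_within_continuousP _ oD) => p cp; exact: chart_fiber_continuous.
transitivity (\int[haar u]_p (\1_S p)%:E)%E; first by rewrite integral_indic// setIT.
rewrite (haar_local hG csA fbump fcover Ac)//; last first.
  by move=> p; rewrite indicE; case: (boolP (p \in S)) => [/set_mem[]|_ /eqP].
rewrite chart_haar_integral//; last first.
  by apply/measurable_EFinP; exact: measurable_indic.
rewrite [LHS]integral_mkcond [RHS]integral_mkcond; apply: eq_integral => t _.
rewrite !patchE; case: ifPn => [/set_mem tI|tI]; last first.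
  by rewrite ifF//; apply: contraNF tI => /set_mem/BI/mem_set.
rewrite indicE (_ : (_ \in S) = (t \in B)).
  by case: ifP => _; rewrite ?mul1e ?mul0e.
apply/idP/idP => /set_mem h; apply/mem_set.
  by case: h => _ /=; rewrite chart_fiberK.
by split; [exact: fiber_inv_dom|rewrite /= chart_fiberK].
Qed.

(** The Radon-Nikodym derivative in the chart [c] is [haar_density c]; as it is
    positive, the measures have the same null sets. *)
Lemma haar_continuous : continuous_haar_system Ar (fun u => haar u).
Proof.
move=> c Ac; split => [u _ B mB BI|]; last first.
  exists (fun a => dens c (cinv c a)); split => [||u _ B mB BI].
  - apply/(open_within_continuousP _ (chart_open_img (gchart Ac))) => a ca.
    exact: (dens_inv_continuous hG csA fbump).
  - by move=> [u t] ca; exact/ltW/(dens_inv_gt0 hG csA fbump).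
  - exact: haar_chart.
rewrite haar_chart//.
have D0 t : B t -> 0 < dens c (cinv c (u, t)).
  by move=> /BI; rewrite chart_fiber_imgE// => ct; exact: (dens_inv_gt0 hG csA fbump).
have mD : measurable_fun B ((fun t => (dens c (cinv c (u, t)))%:E) : borel E -> \bar R).
  apply/measurable_EFinP.
  apply: (@eq_measurable_fun _ _ _ _ _ (fiber_dens cs fcover c u : borel E -> R)).
    move=> t /set_mem /BI; rewrite chart_fiber_imgE// => ct.
    by rewrite /fiber_dens mem_set.
  apply: (@measurable_funS _ _ _ _ setT) => //.
  exact: (measurable_fiber_dens hG csA fbump).
have h := ae_eq_integral_abs lam mB mD.
have -> : (\int[lam]_(t in B) (dens c (cinv c (u, t)))%:E =
    \int[lam]_(t in B) `|(dens c (cinv c (u, t)))%:E|)%E.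
  by apply: eq_integral => t /set_mem Bt; rewrite gee0_abs// lee_fin ltW// D0.
have [h1 h2] := h; split.
  move=> /h1 [N [mN N0 NB]].
  apply: (@subset_measure0 _ _ _ lam B N) => // t Bt; apply: NB => /= Dt.
  by have := EFin_inj (Dt Bt); apply/eqP; rewrite gt_eqF// D0.
move=> B0; apply: h2; exists B; split => // t /=; apply: contra_notP => nB Bt.
by exfalso; exact: nB.
Qed.

(** In a chart, a nonempty open set contains a cube. *)
Lemma haar_open_gt0 u (U : set (gfiber u)) : open U -> U !=set0 -> (0 < haar u U)%E.
Proof.
move=> oU [p Up]; have [c Ac cp] : exists2 c, Ar c & cdom c (gfiber_val p).
  by case: (cfg_range hG) => _ /atlas_cover h _; exact: h.
pose V := fiber_img c u `&` fiber_inv c u @^-1` U.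
pose t0 := chart_fiber c p.
have ct0 : fiber_img c u t0.
  by rewrite /fiber_img /= /t0 -(chart_fiberE Ac cp); exists (gfiber_val p).
have pt0 : fiber_inv c u t0 = p.
  apply: gfiber_val_inj; rewrite (val_fiber_inv hG Ac ct0) /t0 -(chart_fiberE Ac cp).
  exact: (chart_cancel (gchart Ac)).
have oV : open V.
  apply: open_setI_preimage oU; first exact: (fiber_img_open hG).
  apply/(open_within_continuousP _ (fiber_img_open hG Ac)) => t ct.
  exact: (fiber_inv_continuous hG).
have mV : measurable (V : set (borel E)) by exact: open_borel.
have VI : V `<=` chart_fiber_img c u by rewrite chart_fiber_imgE// => t [].
have cu : (rmap (G:=G) @` cdom c) u by exists (gfiber_val p) => //; exact: gfiber_rmap.
have [/(_ u cu V mV VI) [h _] _] := haar_continuous Ac.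
pose S : set (borel (gfiber u)) := chart_fiber_dom c (u := u) `&` (@chart_fiber R G k c u) @^-1` V.
have oS : open S.
  have oD := @chart_fiber_dom_open c u Ac.
  apply: open_setI_preimage oV => //.
  by apply/(open_within_continuousP _ oD) => q cq; exact: chart_fiber_continuous.
have SU : S `<=` U.
  move=> q [cq [cfq]]; congr (U _); apply: gfiber_val_inj.
  rewrite (val_fiber_inv hG Ac cfq) -(chart_fiberE Ac cq).
  exact: (chart_cancel (gchart Ac)).
have : (0 < haar u S)%E.
  rewrite lt_neqAle measure_ge0 andbT eq_sym; apply/eqP => /h V0.
  have Vt0 : V t0 by split => //=; rewrite pt0.
  have /nbhs_ballP[e e0 eV] : nbhs t0 V by exact: open_nbhs_nbhs.
  have : (0 < lam (cube t0 (e / 2)))%E.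
    by rewrite lebesgue_cube ?lte_fin ?exprn_gt0 ?pmulrn_rgt0 ?divr_gt0// divr_ge0// ltW.
  rewrite ltNge -V0 => /negP; apply; apply: le_measure; rewrite ?inE//.
    exact: measurable_box.
  move=> v /cube_norm vt; apply: eV; rewrite -ball_normE /= distrC.
  by rewrite (le_lt_trans (vt _))// ?divr_ge0 ?ltW// ltr_pdivrMr// ltr_pMr// ltr1n.
move=> /lt_le_trans; apply; apply: le_measure; rewrite ?inE//; exact: open_borel.
Qed.

End haar_in_charts.

(** * Integrals depending on a parameter *)

(** Points separated by a continuous map into a Hausdorff space have disjoint
    neighborhoods. *)
Lemma cluster_map_eq (T U : topologicalType) (g : T -> U) (p q : T) :
  hausdorff_space U -> continuous g -> cluster (nbhs p) q -> g p = g q.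
Proof.
move=> hU cg pq; apply: hU => A B Ap Bq.
by have [x [Ax Bx]] := pq _ _ (cg p _ Ap) (cg q _ Bq); exists (g x).
Qed.

Lemma hausdorff_prod (T U : topologicalType) :
  hausdorff_space T -> hausdorff_space U -> hausdorff_space (T * U)%type.
Proof.
move=> hT hU [p p'] [q q'] pq; congr (_, _).
  exact: (cluster_map_eq (g := fst) hT (@continuous_fst T U) pq).
exact: (cluster_map_eq (g := snd) hU (@continuous_snd T U) pq).
Qed.

Section parameter_integrals.
Context {R : realType} {k : nat} (Y : topologicalType).
Local Notation E := 'rV[R]_k.
Local Notation lam := (lebesgue_rV k : {measure set (borel 'rV[R]_k) -> \bar R}).
Variables (H : Y * E -> R) (C : set (Y * E)).
Hypothesis H0 : forall a, 0 <= H a.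
Hypothesis cH : continuous H.
Hypothesis cC : compact C.
Hypothesis HC : forall a, H a != 0 -> C a.

Let slice_cont y : continuous (fun t => H (y, t)).
Proof.
move=> t; apply: (@continuous_comp _ _ _ (fun t : E => (y, t)) H); last exact: cH.
exact: (@continuous_pair _ _ _ (fun=> y) (fun v : E => v) t (@cst_continuous _ _ y t) (fun Q h => h)).
Qed.

Let mH y : measurable_fun setT ((fun t => H (y, t)) : borel E -> R).
Proof.
have := @within_continuous_measurable E R setT (fun t => H (y, t)) openT; apply.
apply: continuous_subspaceT; exact: slice_cont.
Qed.

Let support_cube : exists2 r : R, 0 <= r & forall y t, H (y, t) != 0 -> cube (0 : E) r t.
Proof.
have cS : compact (snd @` C).
  apply: continuous_compact => //; apply: continuous_subspaceT.
  exact: (@continuous_snd Y E).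
have [M [_ hM]] := compact_bounded cS.
have M0 : 0 <= Num.max M 0 + 1 by rewrite addr_ge0// le_max lexx orbT.
exists (Num.max M 0 + 1) => // y t /HC Ct.
apply/cube_norm => //; rewrite subr0; apply: hM; last by exists (y, t).
by rewrite (@le_lt_trans _ _ (Num.max M 0)) ?le_max ?lexx// ltrDl.
Qed.

Let bounded : exists M, forall a, H a <= M.
Proof.
have cS : compact (H @` C) by apply: continuous_compact => //; exact: continuous_subspaceT.
have [M [_ hM]] := compact_bounded cS.
have M0 : 0 <= Num.max M 0 + 1 by rewrite addr_ge0// le_max lexx orbT.
exists (Num.max M 0 + 1) => a; have [->//|Ha] := eqVneq (H a) 0.
apply: le_trans (ler_norm _) _; apply: hM; last by exists a => //; exact: HC.
by rewrite (@le_lt_trans _ _ (Num.max M 0)) ?le_max ?lexx// ltrDl.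
Qed.

(** All the functions [H (y, _)] vanish outside of a fixed cube, and by
    compactness of this cube they are uniformly close to [H (y0, _)] for [y]
    near [y0]. *)
Lemma parameter_integral : exists2 h : Y -> R, continuous h &
  forall y, (\int[lam]_t (H (y, t))%:E = (h y)%:E)%E.
Proof.
have [r r0 Hr] := support_cube; have [M HM] := bounded.
pose K : set (borel E) := cube (0 : E) r.
have mK : measurable K by exact: measurable_box.
have mHK y : measurable_fun K ((fun t => (H (y, t))%:E) : borel E -> \bar R).
  by apply/measurable_EFinP; apply: measurable_funS (mH y).
have HK y : (\int[lam]_t (H (y, t))%:E = \int[lam]_(t in K) (H (y, t))%:E)%E.
  rewrite [RHS]integral_mkcond; apply: eq_integral => t _; rewrite patchE.
  case: ifPn => // tK; have [->//|/Hr tK'] := eqVneq (H (y, t)) 0.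
  by rewrite mem_set in tK.
pose m := (r *+ 2) ^+ k; have lK : lam K = m%:E by exact: lebesgue_cube.
have le_int y (g : E -> R) e : 0 <= e -> (forall t, 0 <= g t) ->
    measurable_fun K ((fun t => (g t)%:E) : borel E -> \bar R) ->
    (forall t, K t -> H (y, t) <= g t + e) ->
    (\int[lam]_(t in K) (H (y, t))%:E <= \int[lam]_(t in K) (g t)%:E + (e * m)%:E)%E.
  move=> e0 g0 mg Hg; rewrite EFinM -lK -(integral_cst lam mK e%:E).
  have mc : measurable_fun K (cst e%:E : borel E -> \bar R) by exact: measurable_cst.
  have g0E t : K t -> (0 <= (g t)%:E)%E by rewrite lee_fin.
  have e0E t : K t -> (0 <= cst e%:E t)%E by rewrite lee_fin.
  rewrite -(ge0_integralD lam mK g0E mg e0E mc).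
  by apply: ge0_le_integral => //; [move=> t _; rewrite lee_fin|exact: emeasurable_funD].
have fin y : (\int[lam]_(t in K) (H (y, t))%:E)%E \is a fin_num.
  have Hi0 : (0 <= \int[lam]_(t in K) (H (y, t))%:E)%E by apply: integral_ge0 => t _; rewrite lee_fin.
  rewrite (ge0_fin_numE Hi0).
  have M0 : 0 <= Num.max M 0 by rewrite le_max lexx orbT.
  have mc : measurable_fun K ((fun t => ((fun=> 0) t)%:E) : borel E -> \bar R).
    exact: measurable_cst.
  have HM0 t : K t -> H (y, t) <= 0 + Num.max M 0 by move=> _; rewrite add0r le_max HM.
  have := @le_int y (fun=> 0) (Num.max M 0) M0 (fun=> lexx _) mc HM0.
  by rewrite integral0 add0e => /le_lt_trans -> //; rewrite ltry.
pose h y := fine (\int[lam]_(t in K) (H (y, t))%:E)%E.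
exists h => [y0|y]; last by rewrite HK fineK.
apply/(@cvgrPdist_le _ _ _ (nbhs y0)) => e e0.
have m0 : 0 <= m by rewrite exprn_ge0// mulrn_wge0.
pose e' := e / (m + 1); have e'0 : 0 < e' by rewrite divr_gt0// ltr_wpDl.
have e'm : e' * m <= e.
  by rewrite /e' mulrAC ler_pdivrMr ?ltr_wpDl// ler_pM2l// lerDl.
have near_K : \forall y \near y0, K `<=` (fun t => `|H (y, t) - H (y0, t)| <= e').
  have /compact_near_coveringP nc : compact (K : set E) by exact: compact_box.
  apply: (nc _ (nbhs y0) (fun y t => `|H (y, t) - H (y0, t)| <= e')) => t _.
  have e'2 : 0 < e' / 2 by rewrite divr_gt0.
  have h1 : \forall t' \near t & y \near y0, `|H (y0, t) - H (y, t')| <= e' / 2.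
    have /(@cvgrPdist_le _ _ _ (nbhs (y0, t))) /(_ _ e'2) := @cH (y0, t).
    case => -[A B] /= [Ay Bt] AB; exists (B, A) => //= -[t' y] [/= Bt' Ay'].
    exact: (AB (y, t')).
  have h2 : \forall t' \near t, `|H (y0, t) - H (y0, t')| <= e' / 2.
    by have /(@cvgrPdist_le _ _ _ (nbhs t)) /(_ _ e'2) := @slice_cont y0 t.
  have h3 : \forall t' \near t & y \near y0, `|H (y0, t) - H (y0, t')| <= e' / 2.
    by exists ([set t' | `|H (y0, t) - H (y0, t')| <= e' / 2], setT) => [|[? ?] []//]; split => //; exact: filterT.
  apply: filterS2 h1 h3 => -[t' y] /= a b.
  rewrite (splitr e') (le_trans (ler_distD (H (y0, t)) _ _))// lerD//.
  by rewrite distrC.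
apply: (@filterS _ (nbhs y0) _ _ _ _ near_K) => y hy.
have le_h y1 y2 : (forall t, K t -> H (y1, t) <= H (y2, t) + e') -> h y1 <= h y2 + e.
  move=> h12; apply: (@le_trans _ _ (h y2 + e' * m)); last by rewrite lerD2l.
  rewrite -lee_fin EFinD !fineK//; apply: le_int => //; exact: ltW.
rewrite ler_distl; apply/andP; split.
  rewrite lerBlDr; apply: le_h => t /hy.
  by rewrite ler_distl lerBlDr => /andP[_ ->].
by apply: le_h => t /hy; rewrite ler_distl lerBlDr => /andP[-> _].
Qed.

End parameter_integrals.

(** * Integrals of compactly supported functions *)

Lemma continuous_sum (R : realType) (T : topologicalType) (h : nat -> T -> R) N :
  (forall n, continuous (h n)) -> continuous (fun x => \sum_(n < N) h n x).
Proof.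
move=> ch x; apply: cvg_big => [|n _]; [exact: add_continuous|exact: ch].
Qed.

Section haar_continuity.
Context {R : realType} {k : nat} (G : groupoid).
Local Notation E := 'rV[R]_k.
Variables As Ar : set (chart R k G (units G)).
Hypothesis hG : continuous_family_groupoid As Ar.

Variables (cs : nat -> chart R k G (units G)) (f : nat -> G -> R).
Hypothesis csA : forall n, Ar (cs n).
Hypothesis fbump : forall n, bump_function (cdom (cs n)) (f n).
Hypothesis fcover : forall z : G, exists n, \forall y \near z, f n y = 1.

Local Notation haar u := (haar hG csA fbump fcover u).
Local Notation J Ac u := (chart_haar hG csA fbump fcover Ac u).
Local Notation dens := (haar_density cs fcover).

Local Notation gchart := (range_chart hG).

Let f0 n x : 0 <= f n x. Proof. exact: bump_ge0 (fbump n) _. Qed.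
Let f1 n x : f n x <= 1. Proof. exact: bump_le1 (fbump n) _. Qed.

Lemma units_hausdorff : hausdorff_space (units G).
Proof. by case: (cfg_range hG) => /fs_hausdorff_base. Qed.

Lemma rV_hausdorff : hausdorff_space E.
Proof. exact: norm_hausdorff. Qed.

Lemma measurable_gfiber_comp u (g : G -> R) : continuous g ->
  measurable_fun setT ((fun p => g (gfiber_val p)) : borel (gfiber u) -> R).
Proof.
move=> cg; have := @within_continuous_measurable (gfiber u) R setT _ openT; apply.
apply: continuous_subspaceT => p.
apply: (@continuous_comp _ _ _ (@gfiber_val G u) g); last exact: cg.
exact: gfiber_val_continuous.
Qed.

(** The integrand in the chart, extended by [0], is continuous on the whole space:
    the image of the support of [g] is compact, hence closed. *)
Lemma chart_haar_integral_continuous c (Ac : Ar c) (g : G -> R) :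
  continuous g -> (forall z, 0 <= g z) -> compact (closure [set z | g z != 0]) ->
  closure [set z | g z != 0] `<=` cdom c ->
  exists2 h : units G -> R, continuous h &
    forall u, (\int[J Ac u]_p (g (gfiber_val p))%:E = (h u)%:E)%E.
Proof.
move=> cg g0 cK Kc; set K := closure _ in cK Kc.
pose H a : R := if a \in cimg c then g (cinv c a) * dens c (cinv c a) else 0.
pose C := cmap c @` K.
have cC : compact C.
  apply: continuous_compact cK.
  exact: continuous_subspaceW Kc (chart_continuous (gchart Ac)).
have HC a : H a != 0 -> C a.
  rewrite /H; case: ifPn => [/set_mem ca|_ /eqP//]; rewrite mulf_eq0 negb_or => /andP[ga _].
  have [_ ea] := chart_inv_in (gchart Ac) ca.
  by exists (cinv c a) => //; exact: subset_closure.
have H0 a : 0 <= H a.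
  rewrite /H; case: ifPn => // /set_mem ca; rewrite mulr_ge0//.
  by apply/ltW; case: a ca => u t; exact: (dens_inv_gt0 hG csA fbump).
have cH : continuous H.
  move=> a; have [Ca|nCa] := pselect (C a); last first.
    have nC : nbhs a (~` C).
      apply: open_nbhs_nbhs; split => //; apply: closed_openC.
      apply: compact_closed cC; apply: hausdorff_prod; first exact: units_hausdorff.
      exact: rV_hausdorff.
    have Hn b : (~` C) b -> H b = 0 by move=> nb; apply/eqP; apply: contra_notT nb; exact: HC.
    rewrite /continuous_at (Hn _ nCa); apply: cvg_near_cst.
    exact: (@filterS _ (nbhs a) _ _ _ _ nC).
  have ca : cimg c a by case: Ca => z /Kc cz <-; exists z.
  have nI : nbhs a (cimg c) by apply: open_nbhs_nbhs; split => //; exact: chart_open_img (gchart Ac).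
  have : {for a, continuous (fun a => g (cinv c a) * dens c (cinv c a))}.
    apply: (@continuousM _ _ (fun a => g (cinv c a))).
      apply: (@continuous_comp _ _ _ (cinv c) g); last exact: cg.
      exact: cinv_continuous (gchart Ac) ca.
    exact: (dens_inv_continuous hG csA fbump).
  rewrite /prop_for /continuous_at {2}/H mem_set// => h.
  apply: cvg_trans h; apply: near_eq_cvg.
  by apply: (@filterS _ (nbhs a) _ _ _ _ nI) => b cb; rewrite /H mem_set.
have [h ch hE] := parameter_integral H0 cH cC HC.
exists h => // u; rewrite -hE chart_haar_integral; last 2 first.
- by move=> p; rewrite lee_fin.
- by apply/measurable_EFinP; exact: measurable_gfiber_comp.
rewrite [LHS]integral_mkcond; apply: eq_integral => t _; rewrite patchE /H.
have -> : ((u, t) \in cimg c) = (t \in fiber_img c u) by apply/idP/idP => /set_mem h'; exact/mem_set.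
by case: ifPn => // /set_mem ct; rewrite (val_fiber_inv hG Ac ct).
Qed.

(** On a compact set, the partition of unity reduces to its first [N] terms. *)
Lemma compact_chi (K : set G) : compact K ->
  exists N, forall z, K z -> exists2 m, f m z = 1 & (m < N)%N.
Proof.
move=> /compact_near_coveringP nc.
have := nc _ \oo (fun N z => exists2 m, f m z = 1 & (m < N)%N) _ _.
case=> [z _|N _ h]; last by exists N => z Kz; apply: (h N) => //=.
have [m fm] := fcover z.
exists ([set y | f m y = 1], [set N | (m < N)%N]) => [|[y N] /= [fy mN]]; last by exists m.
by split => //; exists m.+1.
Qed.

Lemma closure_sub_compact (T : topologicalType) (A K : set T) :
  compact K -> closed K -> A `<=` K -> compact (closure A).
Proof.
move=> cK clK AK; apply: (subclosed_compact _ cK); first exact: closed_closure.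
by rewrite [X in _ `<=` X](closure_id K).1//; exact: closureS.
Qed.

Lemma haar_integral_continuous (g : G -> R) : Cc G g -> (forall z, 0 <= g z) ->
  exists2 h : units G -> R, continuous h &
    forall u, (\int[haar u]_p (g (gfiber_val p))%:E = (h u)%:E)%E.
Proof.
move=> [cg cK] g0; have [N hN] := compact_chi cK.
have hn n : exists h : units G -> R, continuous h /\
    forall u, (\int[J (csA n) u]_p (g (gfiber_val p) * fchi f n p)%:E = (h u)%:E)%E.
  have cc : continuous (chi f n) by exact: (chi_cont fbump).
  pose g' z := g z * chi f n z.
  have sub : [set z | g' z != 0] `<=` [set z | f n z != 0].
    by move=> z /=; rewrite mulf_eq0 negb_or => /andP[_]; exact: chi_neq0.
  have [h ch hE] : exists2 h : units G -> R, continuous h &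
      forall u, (\int[J (csA n) u]_p (g' (gfiber_val p))%:E = (h u)%:E)%E.
    apply: chart_haar_integral_continuous.
    - by move=> z; apply: (@continuousM _ _ g); [exact: cg|exact: cc].
    - by move=> z; rewrite mulr_ge0// chi_ge0.
    - apply: (closure_sub_compact (bump_compact (fbump n))); first exact: closed_closure.
      by move=> z /sub; exact: subset_closure.
    - by apply: subset_trans (bump_sub (fbump n)); exact: closureS.
  by exists h.
have [h hP] := choice hn.
exists (fun u => \sum_(n < N) h n u) => [|u].
  by apply: continuous_sum => n; exact: (hP n).1.
rewrite haar_integral//; last exact: measurable_gfiber_comp.
rewrite (@eseries_finite _ _ N) => [|n|n Nn].
- by rewrite -sumEFin; apply: eq_bigr => n _; rewrite (hP n).2.
- by apply: integral_ge0 => p _; rewrite lee_fin mulr_ge0//; exact: chi_ge0.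
apply: integral0_eq => p _.
have [->|gp] := eqVneq (g (gfiber_val p)) 0; first by rewrite mul0r.
have [|m fm mN] := hN (gfiber_val p); first exact: subset_closure.
by rewrite /fchi (chi_eq0 fm) ?mulr0// (leq_trans mN).
Qed.

Let pos (g : G -> R) z := Num.max (g z) 0.

Let pos_Cc g : Cc G g -> Cc G (pos g).
Proof.
move=> [cg cK]; split.
  by move=> z; apply: (@continuous_max _ _ g (fun=> 0)); [exact: cg|exact: cst_continuous].
apply: (closure_sub_compact cK); first exact: closed_closure.
move=> z /= h; apply: subset_closure => /=; apply: contra_neq h => g0.
by rewrite /pos g0 maxxx.
Qed.

Let opp_Cc (g : G -> R) : Cc G g -> Cc G (fun z => - g z).
Proof.
move=> [cg cK]; split; first by move=> z; apply: continuousN; exact: cg.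
by under eq_set do rewrite oppr_eq0.
Qed.

Let integral_pos u (g : G -> R) : (\int[haar u]_p (g (gfiber_val p))%:E =
  \int[haar u]_p (pos g (gfiber_val p))%:E -
  \int[haar u]_p (pos (fun z => - g z) (gfiber_val p))%:E)%E.
Proof.
rewrite integralE; congr (_ - _)%E; apply: eq_integral => p _.
  by rewrite funeposE EFin_max.
by rewrite funenegE EFin_max.
Qed.

(** The integral vanishes at [u] unless [u] is in the image of the support of [g]
    under the range map, which is compact. *)
Lemma haar_integral_Cc (g : G -> R) : Cc G g -> exists2 h, Cc (units G) h &
  forall u, (\int[haar u]_p (g (gfiber_val p))%:E = (h u)%:E)%E.
Proof.
move=> gC; have [cg cK] := gC.
have pos_ge0 g' z : 0 <= pos g' z by rewrite /pos le_max lexx orbT.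
have [h1 ch1 h1E] := haar_integral_continuous (pos_Cc gC) (pos_ge0 g).
have [h2 ch2 h2E] := haar_integral_continuous (pos_Cc (opp_Cc gC)) (pos_ge0 _).
have hE u : (\int[haar u]_p (g (gfiber_val p))%:E = (h1 u - h2 u)%:E)%E.
  by rewrite integral_pos h1E h2E EFinB.
exists (fun u => h1 u - h2 u) => //; split => [u|].
  by apply: continuousB; [exact: ch1|exact: ch2].
have cC : compact (@rmap G @` closure [set z | g z != 0]).
  apply: continuous_compact cK; apply: continuous_subspaceT.
  exact: (rmap_continuous hG).
apply: (closure_sub_compact cC).
  by apply: compact_closed cC; exact: units_hausdorff.
move=> u /=; apply: contra_neqP => nC.
apply: EFin_inj; rewrite -hE; apply: integral0_eq => p _; congr (_%:E).
apply/eqP; apply: contra_notT nC => gp.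
by exists (gfiber_val p); [exact: subset_closure|exact: gfiber_rmap].
Qed.

Lemma haar_left_invariant x (g : G -> R) : continuous g ->
  (\int[haar (smap x)]_p (g (gmul x (gfiber_val p)))%:E =
   \int[haar (rmap x)]_p (g (gfiber_val p))%:E)%E.
Proof.
move=> cg.
have h (g' : G -> R) : continuous g' -> (forall z, 0 <= g' z) ->
  (\int[haar (smap x)]_p (g' (gmul x (gfiber_val p)))%:E =
   \int[haar (rmap x)]_p (g' (gfiber_val p))%:E)%E.
  move=> cg' g'0.
  rewrite (haar_transl hG csA fbump fcover (erefl : gsource x = \val (smap x))
    (erefl : grange x = \val (rmap x)))//.
  exact: measurable_gfiber_comp.
have cpos g' : continuous g' -> continuous (pos g').
  by move=> cg' z; apply: (@continuous_max _ _ g' (fun=> 0)); [exact: cg'|exact: cst_continuous].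
have pos_ge0 g' z : 0 <= pos g' z by rewrite /pos le_max lexx orbT.
rewrite [RHS]integral_pos -!h//; last 2 first.
- by apply: cpos => z; apply: continuousN; exact: cg.
- exact: cpos.
rewrite integralE; congr (_ - _)%E; apply: eq_integral => p _.
  by rewrite funeposE EFin_max.
by rewrite funenegE EFin_max.
Qed.

End haar_continuity.

(** * Regularity of the Haar measures *)

Section haar_regularity.
Context {R : realType} {k : nat} (G : groupoid).
Variables As Ar : set (chart R k G (units G)).
Hypothesis hG : continuous_family_groupoid As Ar.

Variables (cs : nat -> chart R k G (units G)) (f : nat -> G -> R).
Hypothesis csA : forall n, Ar (cs n).
Hypothesis fbump : forall n, bump_function (cdom (cs n)) (f n).
Hypothesis fcover : forall z : G, exists n, \forall y \near z, f n y = 1.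

Local Notation haar u := (haar hG csA fbump fcover u).

Let f0 n x : 0 <= f n x. Proof. exact: bump_ge0 (fbump n) _. Qed.
Let f1 n x : f n x <= 1. Proof. exact: bump_le1 (fbump n) _. Qed.

Let hausG : hausdorff_space G.
Proof. by case: (cfg_locally_compact hG). Qed.

Let lcG : locally_compact [set: G].
Proof. by case: (cfg_locally_compact hG). Qed.

Lemma gfiber_hausdorff (u : units G) : hausdorff_space (gfiber u).
Proof.
move=> p q pq; apply: gfiber_val_inj.
exact: (cluster_map_eq (g := @gfiber_val G u) hausG (@gfiber_val_continuous G u) pq).
Qed.

Lemma gfiber_closed (u : units G) : closed [set z : G | grange z = \val u].
Proof.
have -> : [set z : G | grange z = \val u] = @grange G @^-1` [set \val u] by [].
apply: closed_comp; first by move=> z _; exact: (grange_continuous hG).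
exact: (accessible_closed_set1 (hausdorff_accessible hausG)).
Qed.

Lemma gfiber_preimage_compact (u : units G) (K : set G) : compact K ->
  compact (@gfiber_val G u @^-1` K).
Proof.
move=> cK F PF FK.
have cK' : compact (K `&` [set z : G | grange z = \val u]).
  apply: (subclosed_compact _ cK) => [|z []//].
  by apply: closedI; [exact: compact_closed cK|exact: gfiber_closed].
have [|z [[Kz zu] Fz]] := cK' (@gfiber_val G u @ F) _.
  by apply: (@filterS _ F _ _ _ _ FK) => p Kp; split => //; exact: gfiber_range.
exists (gfiber_mk zu); split => // A B FA Bz.
have [W [oW Wz] WB] := (@nbhs_subtype G [set z : G | grange z = \val u] _ _).1 Bz.
have FA' : (@gfiber_val G u @ F) (@gfiber_val G u @` A).
  by apply: (@filterS _ F _ _ _ _ FA) => p Ap; exists p.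
have [_ [[p Ap <-] Wp]] := Fz _ _ FA' (open_nbhs_nbhs (conj oW Wz)).
by exists p; split => //; exact: WB.
Qed.

(** An open set is covered by the members of a countable basis of [G] whose
    closures are compact and meet the fiber inside this open set. *)
Lemma gfiber_open_sigma_compact (u : units G) (U : set (gfiber u)) : open U ->
  exists2 K : nat -> set (gfiber u), forall n, compact (K n) & U = \bigcup_n K n.
Proof.
move=> oU; have [[B /countable_injP[h hinj] [oB bB]] _ _ _ _] := cfg_locally_compact hG.
pose good n W := [/\ B W, h W = n, compact (closure W) &
  @gfiber_val G u @^-1` closure W `<=` U].
exists (fun n => [set p | exists2 W, good n W & closure W (gfiber_val p)]) => [n|].
  have [[W gW]|nW] := pselect (exists W, good n W); last first.
    rewrite (_ : [set p | _] = set0); first exact: compact0.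
    by rewrite -subset0 => p [W gW _]; apply: nW; exists W.
  rewrite (_ : [set p | _] = @gfiber_val G u @^-1` closure W).
    by apply: gfiber_preimage_compact; case: gW.
  apply/seteqP; split => [p [W' gW']|p Wp]; last by exists W.
  have -> // : W' = W.
  have [BW hW _ _] := gW; have [BW' hW' _ _] := gW'.
  by apply: hinj; rewrite ?inE// hW.
apply/seteqP; split => [p Up|p [n _ [W [_ _ _ WU] Wp]]]; last exact: WU.
have [Q [oQ Qp] QU] := (@nbhs_subtype G [set z : G | grange z = \val u] _ _).1
  (open_nbhs_nbhs (conj oU Up)).
have [g [gQ g1]] := @bump_exists R G lcG hausG Q (gfiber_val p) oQ Qp.
have [W [BW Wp] Wg] := bB (gfiber_val p) _ g1.
have clW : closure W `<=` closure [set z | g z != 0].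
  by apply: closureS => z /Wg /= ->; rewrite oner_eq0.
exists (h W) => //; exists W; last exact: subset_closure.
split => //.
  apply: (closure_sub_compact (bump_compact gQ)); first exact: closed_closure.
  by apply: subset_trans clW; exact: subset_closure.
by move=> q /clW /(bump_sub gQ); exact: QU.
Qed.

Let psum n z : R := \sum_(m < n) chi f m z.

(** The partial sums of the partition of unity are compactly supported, so their
    integrals are finite; where they are bounded from below, the Haar measure
    is finite. *)
Lemma psum_Cc n : Cc G (psum n).
Proof.
split; first by apply: continuous_sum => m; exact: (chi_cont fbump).
have [K [cK clK sK]] : exists K : set G, [/\ compact K, closed K & forall z, psum n z != 0 -> K z].
  elim: n => [|n [K [cK clK sK]]].
    exists set0; split; [exact: compact0|exact: closed0|].
    by move=> z; rewrite /psum big_ord0 eqxx.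
  exists (K `|` closure [set z | f n z != 0]); split.
  - by apply: compactU => //; exact: bump_compact (fbump n).
  - by apply: closedU => //; exact: closed_closure.
  - move=> z; rewrite /psum big_ord_recr /= -/(psum n z) => h.
    have [p0|/sK] := eqVneq (psum n z) 0; last by left.
    by right; apply: subset_closure; apply: (@chi_neq0 _ _ f n z); move: h; rewrite p0 add0r.
exact: (closure_sub_compact cK).
Qed.

Let psum_ge0 n z : 0 <= psum n z.
Proof. by apply: sumr_ge0 => m _; exact: chi_ge0. Qed.

Lemma haar_psum_lty u n : (\int[haar u]_p (psum n (gfiber_val p))%:E < +oo)%E.
Proof. by have [h _ ->] := haar_integral_Cc hG csA fbump fcover (psum_Cc n); rewrite ltry. Qed.

Lemma haar_lty u n (B : set (borel (gfiber u))) (a : R) : 0 < a -> measurable B ->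
  (forall p, B p -> a <= psum n (gfiber_val p)) -> (haar u B < +oo)%E.
Proof.
move=> a0 mB Ba.
have ms : measurable_fun setT ((fun p => psum n (gfiber_val p)) : borel (gfiber u) -> R).
  by apply: (measurable_gfiber_comp); exact: (psum_Cc n).1.
have msE : measurable_fun setT ((fun p => (psum n (gfiber_val p))%:E) : borel (gfiber u) -> \bar R).
  exact/measurable_EFinP.
have : (a%:E * haar u B <= \int[haar u]_p (psum n (gfiber_val p))%:E)%E.
  rewrite -(integral_cst (haar u) mB a%:E).
  apply: (@le_trans _ _ (\int[haar u]_(p in B) (psum n (gfiber_val p))%:E)%E).
    apply: ge0_le_integral => //.
    - by move=> p _; rewrite lee_fin ltW.
    - exact: measurable_funS msE.
  by apply: ge0_subset_integral => // p _; rewrite lee_fin.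
move=> /le_lt_trans /(_ (haar_psum_lty u n)) h.
rewrite ltey; apply/eqP => E; move: h; rewrite E gt0_muley ?lte_fin//.
Qed.

(** The open sets where the partial sums exceed [1 / 2] increase with [n], have
    finite measure and cover the fiber. *)
Lemma haar_regular_borel u : regular_borel (haar u).
Proof.
pose O n : set (gfiber u) := [set p | 2^-1 < psum n (gfiber_val p)].
have oO n : open (O n).
  apply: (open_comp (D := [set x : R | 2^-1 < x])); last exact: open_gt.
  move=> p _; apply: (@continuous_comp _ _ _ (@gfiber_val G u) (psum n)).
    exact: gfiber_val_continuous.
  exact: (psum_Cc n).1.
have ndO : nondecreasing_seq O.
  apply/nondecreasing_seqP => n; apply/subsetPset => p /= h.
  by rewrite /O /= /psum big_ord_recr /= ltr_wpDr ?chi_ge0.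
apply: (@regular_borel_of_open_cover R (gfiber u) (haar u) (@gfiber_hausdorff u)
  (@gfiber_open_sigma_compact u) O) => //.
- apply/seteqP; split => // p _; have [m fm] := f_eq1 fcover (gfiber_val p).
  by exists m.+1 => //; rewrite /O /= /psum (sum_chi1 fm)// invf_lt1// ltr1n.
- move=> n; apply: (@haar_lty u n _ 2^-1) => // [|p /ltW//].
  exact: open_borel.
- move=> K cK.
  have cK' : compact (@gfiber_val G u @` K).
    apply: continuous_compact cK; apply: continuous_subspaceT.
    exact: gfiber_val_continuous.
  have [N hN] := compact_chi fcover cK'.
  apply: (@haar_lty u N _ 1) => // [|p Kp].
    by apply: closed_borel; apply: compact_closed cK; exact: gfiber_hausdorff.
  have [|m fm mN] := hN (gfiber_val p); first by exists p.
  by rewrite /psum (sum_chi1 fm mN).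
Qed.

End haar_regularity.

(** * Existence of a continuous Haar system *)

Lemma chart_partition (R : realType) (k : nat) (G : groupoid)
    (As Ar : set (chart R k G (units G))) (hG : continuous_family_groupoid As Ar) (z0 : G) :
  exists (cs : nat -> chart R k G (units G)) (f : nat -> G -> R),
    [/\ forall n, Ar (cs n), forall n, bump_function (cdom (cs n)) (f n) &
        forall z : G, exists n, \forall y \near z, f n y = 1].
Proof.
have [sG lG hausG _ _] := cfg_locally_compact hG.
have [_ [Ach Acov _] _] := cfg_range hG.
pose P (_ : G) (i : chart R k G (units G) * (G -> R)) :=
  Ar i.1 /\ bump_function (cdom i.1) i.2.
have [z|e [eP ecov]] := @countable_family R G _ P (fun i => i.2) z0 sG.
  have [c Ac cz] := Acov z.
  have [g [gc g1]] := @bump_exists R G lG hausG _ z (chart_open_dom (Ach _ Ac)) cz.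
  by exists (c, g).
exists (fun n => (e n).1), (fun n => (e n).2); split => // n.
  by have [_ []] := eP n.
by have [_ []] := eP n.
Qed.

Theorem theorem1 (R : realType) (k : nat) (hk : (0 < k)%N) (G : groupoid)
    (As Ar : set (chart R k G (units G)))
    (hG : continuous_family_groupoid As Ar) :
  exists lam : forall u : units G, {measure set (borel (gfiber u)) -> \bar R},
    left_haar_system lam /\ continuous_haar_system Ar lam.
Proof.
(* A sequence of charts exists only when [G] is nonempty. *)
have [[z0 _]|G0] := pselect (exists z : G, True); last first.
  have nU (u : units G) : False by apply: G0; exists (\val u).
  exists (fun u => False_rect _ (nU u)); split; last first.
    move=> c _; split => [u|]; first by case: (nU u).
    exists (fun=> 0); split => [||u]; last by case: (nU u).
      by apply: continuous_subspaceT => a; exact: cst_continuous.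
    by [].
  split => [u|u|g _|x]; [by case: (nU u)|by case: (nU u)| |by case: (nU (rmap x))].
  exists (fun=> 0) => [|u]; last by case: (nU u).
  split; first by move=> u; exact: cst_continuous.
  rewrite (_ : [set x | _] = set0) ?closure0; first exact: compact0.
  by rewrite -subset0 => u; case: (nU u).
have [cs [f [csA fbump fcover]]] := chart_partition hG z0.
exists (haar hG csA fbump fcover); split; last exact: haar_continuous.
split.
- exact: haar_regular_borel.
- exact: haar_open_gt0.
- exact: haar_integral_Cc.
- by move=> x g [cg _]; exact: haar_left_invariant.
Qed.
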